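(* Let $\Gamma$ be a mandarin graph with $N\ge3$ edges. Let $q$ be a polynomial on $\mathbb{C}^N\times\mathbb{C}^{4N}$ that is homogeneous in the $\mathbb{C}^{4N}$ coordinates. Suppose there exist $\boldsymbol{\ell}\in\mathbb{R}_+^N$ and an eigenpair $(k^2,f)$ of $(\Gamma,\boldsymbol{\ell})$ such that (i) $k^2$ is a non-zero simple eigenvalue, and (ii) $f$ is symmetric (respectively anti-symmetric) and $q(\exp(ik\boldsymbol{\ell}),\mathrm{tr}_k(f))\ne0$. Then the following property of eigenpairs $(k^2,f)$ with $k>0$ is both strongly and ergodically generic: (1) $k^2$ is a simple eigenvalue, and (2) $q(\exp(ik\boldsymbol{\ell}),\mathrm{tr}_k(f))\neq0$ whenever $f$ is symmetric (respectively anti-symmetric).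
   Context: A mandarin graph has exactly two vertices and $N$ edges $e_1,\dots,e_N$, each joining the two vertices; orient every edge. $(\Gamma,\boldsymbol{\ell})$: edge $e_j\cong[0,\ell_j]$, Laplacian $-d^2/dt^2$ edgewise with standard vertex conditions (continuity at each vertex and vanishing sum of outgoing derivatives at each vertex). Let $R$ be the map reflecting every edge, $t\mapsto\ell_j-t$ on $e_j$ (it swaps the two vertices). An eigenfunction $f$ is symmetric if $f\circ R=f$ and anti-symmetric if $f\circ R=-f$. $\exp(ik\boldsymbol{\ell}):=(e^{ik\ell_1},\dots,e^{ik\ell_N})$. For an eigenpair with $k>0$, $f|_{e_j}(t)=A_j\cos(kt)+B_j\sin(kt)=C_j\cos(k(\ell_j-t))+D_j\sin(k(\ell_j-t))$, and $\mathrm{tr}_k(f)\in\mathbb{C}^{4N}$ is the vector of all $A_j,B_j,C_j,D_j$ in a fixed order. For a property $\mathcal{P}$ of eigenpairs, let $G$ be the set of $\boldsymbol{\ell}$ such that every eigenpair with $k>0$ satisfies $\mathcal{P}$; $\mathcal{P}$ is strongly generic if $\mathbb{R}_+^N\setminus G$ is a countable union of closed subanalytic sets (locally finite unions/intersections of projections of sets defined by real-analytic equalities and strict inequalities over compact parameter sets) of dimension at most $N-1$; $\mathcal{P}$ is ergodically generic if for every $\mathbb{Q}$-independent $\boldsymbol{\ell}$ the proportion of $k\in\mathrm{spec}(\Gamma,\boldsymbol{\ell})\cap[0,T]$ (multiset of $k\ge0$ with $k^2$ an eigenvalue) having an eigenfunction $f$ with $(k^2,f)$ satisfying $\mathcal{P}$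 tends to $1$ as $T\to\infty$. *)

(* Defs.v *)
From HB Require Import structures.
From mathcomp Require Import all_boot all_order all_algebra complex.
From mathcomp Require Import all_classical all_reals all_analysis.
From mathcomp Require mpoly.

Set Implicit Arguments.
Unset Strict Implicit.
Unset Printing Implicit Defensive.

Import Order.TTheory GRing.Theory Num.Theory.
Import numFieldNormedType.Exports.
Local Open Scope classical_set_scope.
Local Open Scope ring_scope.

Section Mandarin.
Variable R : realType.

(** f is real-analytic at a: on some ball around a, f is the sum of an
    absolutely convergent power series centred at a (multi-indices are
    functions 'I_n -> nat; partial sums are taken over the cubes of
    multi-indices with all entries <= d). *)
Definition analytic_at (n : nat) (f : 'rV[R]_n -> R) (a : 'rV[R]_n) : Prop :=
  exists (c : ('I_n -> nat) -> R) (r : R), 0 < r /\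
  forall y : 'rV[R]_n, `|y - a| < r ->
    (exists M : R, forall d : nat,
       \sum_(al : {ffun 'I_n -> 'I_d.+1})
          `|c (fun i => nat_of_ord (al i))| *
          \prod_(i < n) `|y 0 i - a 0 i| ^+ al i <= M) /\
    (fun d : nat => \sum_(al : {ffun 'I_n -> 'I_d.+1})
          c (fun i => nat_of_ord (al i)) *
          \prod_(i < n) (y 0 i - a 0 i) ^+ al i : R) @ \oo --> (f y : R).

Definition analytic_on (n : nat) (U : set 'rV[R]_n) (f : 'rV[R]_n -> R) :=
  forall a, U a -> analytic_at f a.

Definition semianalytic (n : nat) (S : set 'rV[R]_n) : Prop :=
  forall a : 'rV[R]_n, exists U : set 'rV[R]_n, open U /\ U a /\
    exists (p q : nat) (f g : 'I_p -> 'I_q -> 'rV[R]_n -> R),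
      (forall i j, analytic_on U (f i j) /\ analytic_on U (g i j)) /\
      S `&` U = U `&` [set x | exists i : 'I_p,
                                forall j : 'I_q, f i j x = 0 /\ 0 < g i j x].

Definition subanalytic (n : nat) (S : set 'rV[R]_n) : Prop :=
  forall a : 'rV[R]_n, exists U : set 'rV[R]_n, open U /\ U a /\
    exists (m : nat) (B : set 'rV[R]_(n + m)),
      semianalytic B /\ (exists M : R, forall z, B z -> `|z| <= M) /\
      S `&` U = [set lsubmx z | z in B].

Definition open_cube (m : nat) : set 'rV[R]_m :=
  [set x | forall i : 'I_m, 0 < x 0 i < 1].

Definition dim_le (n : nat) (S : set 'rV[R]_n) (d : nat) : Prop :=
  forall (m : nat) (h : 'rV[R]_m -> 'rV[R]_n),
    (forall x, (@open_cube m) x -> S (h x)) ->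
    {in (@open_cube m) &, injective h} ->
    {within (@open_cube m), continuous h} ->
    (exists g : 'rV[R]_n -> 'rV[R]_m,
        (forall x, (@open_cube m) x -> g (h x) = x) /\
        {within h @` (@open_cube m), continuous g}) ->
    (m <= d)%N.

(* Edge e_j = [0, l_j], oriented from vertex v0 (t = 0) to v1 (t=l_j). *)

Variable N : nat.

Definition pos_lengths (l : 'rV[R]_N) : Prop := forall j, 0 < l 0 j.

Definition cR (x : R) : R[i] := (x%:C)%C.
Definition expi (x : R) : R[i] := (cos x +i* sin x)%C.

Definition coefA (x : 'rV[R[i]]_(N + N)) (j : 'I_N) : R[i] := x 0 (lshift N j).
Definition coefB (x : 'rV[R[i]]_(N + N)) (j : 'I_N) : R[i] := x 0 (rshift N j).

Definition efun (k : R) (x : 'rV[R[i]]_(N + N)) (j : 'I_N) (t : R) : R[i] :=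
  coefA x j * cR (cos (k * t)) + coefB x j * cR (sin (k * t)).

Definition cderiv (f : R -> R[i]) (t : R) : R[i] :=
  ((derive1 (fun s => complex.Re (f s)) t) +i* (derive1 (fun s => complex.Im (f s)) t))%C.

Definition vertex_conditions (l : 'rV[R]_N) (k : R) (x : 'rV[R[i]]_(N + N))
  : Prop :=
  (forall j j' : 'I_N, efun k x j 0 = efun k x j' 0) /\
  (forall j j' : 'I_N, efun k x j (l 0 j) = efun k x j' (l 0 j')) /\
  \sum_(j < N) cderiv (efun k x j) 0 = 0 /\
  \sum_(j < N) - cderiv (efun k x j) (l 0 j) = 0.

Definition eigenpair (l : 'rV[R]_N) (k : R) (x : 'rV[R[i]]_(N + N)) : Prop :=
  0 < k /\ x != 0 /\ vertex_conditions l k x.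

Definition has_mult (l : 'rV[R]_N) (k : R) (d : nat) : Prop :=
  (exists X : d.-tuple 'rV[R[i]]_(N + N),
      free X /\ forall x, x \in X -> vertex_conditions l k x) /\
  (forall X : d.+1.-tuple 'rV[R[i]]_(N + N),
      (forall x, x \in X -> vertex_conditions l k x) -> ~~ free X).

Definition mult (l : 'rV[R]_N) (k : R) : nat := xget 0%N [set d | has_mult l k d].

Definition simple_eigenvalue (l : 'rV[R]_N) (k : R) : Prop := mult l k = 1%N.

Definition symmetric (l : 'rV[R]_N) (k : R) (x : 'rV[R[i]]_(N + N)) : Prop :=
  forall j t, 0 <= t <= l 0 j -> efun k x j (l 0 j - t) = efun k x j t.
Definition antisymmetric (l : 'rV[R]_N) (k : R) (x : 'rV[R[i]]_(N + N)) : Prop :=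
  forall j t, 0 <= t <= l 0 j -> efun k x j (l 0 j - t) = - efun k x j t.

Definition has_parity (anti : bool) l k x : Prop :=
  if anti then antisymmetric l k x else symmetric l k x.

(** tr_k(f) in C^{4N} = (A_1..A_N, B_1..B_N, C_1..C_N, D_1..D_N), where
    f|_{e_j}(t) = C_j cos(k(l_j - t)) + D_j sin(k(l_j - t)). *)
Definition is_trace (l : 'rV[R]_N) (k : R) (x : 'rV[R[i]]_(N + N))
  (v : 'I_(N + N + N + N) -> R[i]) : Prop :=
  (forall j, v (lshift N (lshift N (lshift N j))) = coefA x j) /\
  (forall j, v (lshift N (lshift N (rshift N j))) = coefB x j) /\
  (forall j t, efun k x j t =
      v (lshift N (rshift (N + N) j)) * cR (cos (k * (l 0 j - t))) +
      v (rshift (N + N + N) j) * cR (sin (k * (l 0 j - t)))).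

Definition qpoint (l : 'rV[R]_N) (k : R) (v : 'I_(N + N + N + N) -> R[i])
  : 'I_(N + (N + N + N + N)) -> R[i] :=
  fun i => match fintype.split i with
           | inl j => expi (k * l 0 j)
           | inr m => v m
           end.

Definition qeval (q : mpoly.mpoly (N + (N + N + N + N)) R[i])
  (l : 'rV[R]_N) (k : R) (v : 'I_(N + N + N + N) -> R[i]) : R[i] :=
  mpoly.meval (qpoint l k v) q.

Definition homog_in_trace (q : mpoly.mpoly (N + (N + N + N + N)) R[i]) : Prop :=
  exists d : nat, forall m : mpoly.multinom (N + (N + N + N + N)), mpoly.mcoeff m q != 0 ->
    (\sum_(i < N + N + N + N) mpoly.fun_of_multinom m (rshift N i))%N = d.

Definition propP (anti : bool) (q : mpoly.mpoly (N + (N + N + N + N)) R[i])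
  (l : 'rV[R]_N) (k : R) (x : 'rV[R[i]]_(N + N)) : Prop :=
  simple_eigenvalue l k /\
  (has_parity anti l k x ->
     forall v, is_trace l k x v -> qeval q l k v != 0).

Definition good_set (P : 'rV[R]_N -> R -> 'rV[R[i]]_(N + N) -> Prop)
  : set 'rV[R]_N :=
  [set l | forall k x, eigenpair l k x -> P l k x].

Definition strongly_generic (P : 'rV[R]_N -> R -> 'rV[R[i]]_(N + N) -> Prop)
  : Prop :=
  exists F : nat -> set 'rV[R]_N,
    (forall n, closed (F n) /\ subanalytic (F n) /\ dim_le (F n) (N - 1)) /\
    [set l | pos_lengths l] `\` good_set P = \bigcup_n F n.

Definition Q_independent (l : 'rV[R]_N) : Prop :=
  forall c : 'I_N -> rat,
    \sum_(j < N) ratr (c j) * l 0 j = 0 -> forall j, c j = 0.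

Definition spec_count (l : 'rV[R]_N) (Q : R -> Prop) (T : R) : \bar R :=
  esum [set k : R | 0 < k <= T /\ Q k] (fun k => ((mult l k)%:R)%:E).

Definition ergodically_generic
  (P : 'rV[R]_N -> R -> 'rV[R[i]]_(N + N) -> Prop) : Prop :=
  forall l : 'rV[R]_N, pos_lengths l -> Q_independent l ->
    (fun T : R =>
       fine (spec_count l (fun k => exists x, eigenpair l k x /\ P l k x) T) /
       fine (spec_count l (fun _ => True) T)) @ +oo --> (1 : R).

End Mandarin.

(* Main.v *)
(** Let phi_j = k l_j / 2.  Centred at the midpoints of the edges, an eigenfunction is
    E_j cos + O_j sin on e_j, and the vertex conditions decouple the symmetric part E from the
    anti-symmetric part O.  If no ratio l_i / l_j is rational, every eigenvalue carries a
    vector of one parity with nonzero amplitudes, and then sum_j t_j = 0, where t_j is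
    tan phi_j in the symmetric case and cot phi_j in the anti-symmetric case.  The property
    fails only if moreover e_{N-1}(t) = 0 (an eigenfunction of the other parity has the same
    eigenvalue) or Q(t) = 0, where Q is q read off t.  The given eigenpair shows that Q does
    not vanish identically on the hyperplane sum_j t_j = 0; neither does e_{N-1}, as N >= 3.

    Strong genericity: the failure set is a countable union of projections of compact sets
    cut out by analytic equations, hence of closed subanalytic sets.  It is also covered by
    countably many Lipschitz images of null sets, while by a Poincare-Miranda argument every
    Lipschitz approximation of the inverse of an embedding of the N-cube covers an open set.

    Ergodic genericity: between two poles sum_j t_j is monotone in k, so a short window holds
    at most N + 1 eigenvalues of each parity, and the flow k |-> (phi_j) sampled at a generic
    step spends a small proportion of time near the hypersurfaces above.  The total count
    grows at least linearly, by Rolle's theorem. *)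

Require Import Defs.
From HB Require Import structures.
From mathcomp Require Import all_boot all_order all_algebra all_fingroup complex.
From mathcomp Require Import all_classical all_reals all_analysis.
From mathcomp Require Import ring lra zify.
From mathcomp Require mpoly.
Set Implicit Arguments.
Unset Strict Implicit.
Unset Printing Implicit Defensive.
Import Order.TTheory GRing.Theory Num.Theory.
Import numFieldNormedType.Exports.

(** * A cubical Sperner lemma *)

Section Cubes.

(** In the coordinates t_j the point (exp(ikl), tr_k(f)) is, up to a scalar on the trace, rational
    in t, because exp(2i phi) is rational in tan phi; hence everything reduces to zeros of
    polynomials on a hyperplane. Two lengths with a rational ratio may put two phases on a pole at
    once; such lengths lie on countably many hyperplanes, and Q-independent lengths avoid them.

    The dimension bound speaks of embeddings that are merely homeomorphisms onto their image. Their
    inverses may carry a null set onto a cube, so measure alone is no obstruction. Lipschitz maps do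
    preserve null sets, and the conclusion of Poincare-Miranda survives an error of 1/8; this is why
    the inverse is approximated.

    One estimate serves both halves: the zeros of a nonzero polynomial in a box are covered by few
    cubes of any small side. For the dimension it gives null sets. For the count, each cube is paid
    for by the frequency of visits of the sampled flow. Only an upper bound on this frequency is
    needed, and the average of a product of powers of cosines yields it without a full
    equidistribution theorem. *)

Lemma addb_big_involution (T : finType) (f : T -> bool) (h : T -> T)
    (e : T -> bool) :
  involutive h -> (forall x, f (h x) = f x) -> (forall x, e (h x) = ~~ e x) ->
  \big[addb/false]_x f x = false.
Proof.
move=> hK fh eh; rewrite (bigID e) /= (reindex_inj (inv_inj hK)) /=.
under eq_bigl do rewrite eh.
by under eq_bigr do rewrite fh; rewrite addbb.
Qed.

(* [a i t] is the i-th label of vertex t of a simplex; the face omits vertex k. *)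
Definition face_term (a : nat -> nat -> bool) n k :=
  a 0 (bump k 0) &&
  \big[andb/true]_(i < n) (a i.+1 (bump k i.+1) (+) a i.+1 (bump k i)).

(** Over the field with two elements this is the coboundary formula for cup products, d(a_0 da_1 ...
    da_n) = da_0 da_1 ... da_n, evaluated on one simplex. The induction splits off the last label;
    only the last two faces need care. *)
Lemma face_sum (a : nat -> nat -> bool) n :
  \big[addb/false]_(k < n.+2) face_term a n k =
  \big[andb/true]_(i < n.+1) (a i i.+1 (+) a i i).
Proof.
elim: n => [|n IHn].
  rewrite !big_ord_recl !big_ord0 /face_term /= !big_ord0 !andbT addbF /bump /=.
  by [].
rewrite [RHS]big_ord_recr /= -IHn.
rewrite big_ord_recr big_ord_recr /= [in RHS]big_ord_recr /=.
rewrite andb_addl big_distrl /=.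
rewrite -[LHS]addbA; congr (_ (+) _).
  apply: eq_bigr => -[k /= lekn] _.
  rewrite /face_term big_ord_recr /= andbA; congr (_ && (a _ _ (+) a _ _)).
  - by rewrite /bump leqW // .
  - by rewrite /bump -ltnS lekn.
set P := face_term a n n.+1.
have PE k : n < k -> a 0 (bump k 0) &&
  \big[andb/true]_(i < n) (a i.+1 (bump k i.+1) (+) a i.+1 (bump k i)) = P.
  move=> ltnk; rewrite /P /face_term; congr (_ && _).
    by rewrite /bump (leqNgt k) (leq_ltn_trans _ ltnk).
  apply: eq_bigr => i _; rewrite /bump.
  have lt1 : (k <= i.+1) = false.
    by apply/negbTE; rewrite -ltnNge (leq_ltn_trans _ ltnk).
  have lt2 : (k <= i) = false.
    by apply/negbTE; rewrite -ltnNge (leq_trans _ ltnk) // ltnS ltnW.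
  have lt3 : (n < i.+1) = false by apply/negbTE; rewrite -leqNgt.
  have lt4 : (n < i) = false by apply/negbTE; rewrite -leqNgt ltnW.
  by rewrite lt1 lt2 lt3 lt4.
rewrite {1}/face_term {1}/face_term !big_ord_recr /= !andbA !PE //.
have -> : bump n.+1 n.+1 = n.+2 by rewrite /bump leqnn.
have -> : bump n.+1 n = n by rewrite /bump ltnn.
have -> : bump n.+2 n.+1 = n.+1 by rewrite /bump ltnn.
have -> : bump n.+2 n = n by rewrite /bump ltnNge leqnSn.
by case: (P) => //=; do 3!case: (a _ _).
Qed.

Variable m : nat.

(* The t-th vertex of the simplex of the cube at [z] which raises the coordinates in the order
   given by [r]. *)
Definition cube_vertex n (z : {ffun 'I_n -> nat}) (r : 'S_n) (t : nat) :
  {ffun 'I_n -> nat} := [ffun j => z j + (r j < t)].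

Definition ffnat n (x : {ffun 'I_n -> 'I_m.+1}) : {ffun 'I_n -> nat} :=
  [ffun j => nat_of_ord (x j)].

Definition chain_prod n (lam : 'I_n -> {ffun 'I_n -> nat} -> bool) z r :=
  \big[andb/true]_(i < n)
     (lam i (cube_vertex z r i.+1) (+) lam i (cube_vertex z r i)).

Definition shift_coord n (j : 'I_n) (z : {ffun 'I_n -> nat}) :
  {ffun 'I_n -> nat} := [ffun i => z i + (i == j)].

(** Shifting by one in direction [j] turns each layer into the next, so modulo 2 only the two outer
    layers survive, and the lower one vanishes by assumption. *)
Lemma addb_telescope n (j : 'I_n) (G : {ffun 'I_n -> nat} -> bool) :
  (forall x : {ffun 'I_n -> 'I_m.+1}, x j = ord0 -> G (ffnat x) = false) ->
  \big[addb/false]_(x : {ffun 'I_n -> 'I_m.+1}) G (shift_coord j (ffnat x)) (+)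
  \big[addb/false]_(x : {ffun 'I_n -> 'I_m.+1}) G (ffnat x) =
  \big[addb/false]_(x : {ffun 'I_n -> 'I_m.+1} | x j == ord_max) G (shift_coord j (ffnat x)).
Proof.
case: n j G => [[]//|n] j G G0.
pose h (x : {ffun 'I_n.+1 -> 'I_m.+1}) := [ffun i => if i == j then ordS (x i) else x i].
have hinj : injective h.
  move=> x y /ffunP hxy; apply/ffunP => i; move: (hxy i); rewrite !ffunE.
  by case: eqP => // _ /(can_inj (@ordSK _)).
rewrite [X in _ (+) X](reindex_inj hinj) /= -big_split /=.
rewrite (bigID (fun x : {ffun 'I_n.+1 -> 'I_m.+1} => x j == ord_max)) /=.
rewrite [X in _ (+) X]big1 ?addbF.
  apply: eq_bigr => x /eqP xj; rewrite [X in _ (+) X]G0 ?addbF //.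
  by apply/val_inj; rewrite /= ffunE eqxx xj /= modnn.
move=> x xj; rewrite (_ : shift_coord j _ = ffnat (h x)) ?addbb //.
apply/ffunP => i; rewrite !ffunE; case: eqP => [->|_]; last by rewrite addn0.
rewrite /= modn_small ?addn1 // ltnS ltn_neqAle -ltnS ltn_ord andbT.
by apply: contra xj => /eqP xj; apply/eqP/val_inj.
Qed.

(** Exchanging two consecutive steps of the path moves only the vertex between them. *)
Lemma cube_vertex_tperm n (z : {ffun 'I_n.+1 -> nat}) (r : 'S_n.+1) (k k' : 'I_n.+1) (t : nat) :
  k' = k.+1 :> nat -> t != k' ->
  cube_vertex z (r * tperm k k') t = cube_vertex z r t.
Proof.
move=> kk' tk; apply/ffunP => j; rewrite !ffunE permM; congr (_ + nat_of_bool _).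
have tk' : (k.+1 == t) = false by move: tk; rewrite kk' eq_sym => /negbTE.
case: tpermP => [->|->|//]; rewrite kk'; first by rewrite [RHS]leq_eqVlt tk'.
by rewrite [LHS]leq_eqVlt tk'.
Qed.

Definition rot_perm n : 'S_n.+1 := perm (can_inj (@ord_predK n.+1)).

(** Without its first vertex the path is a path of the neighbouring cube without its last vertex:
    the first direction has become the last. *)
Lemma cube_vertex_rot n (z : {ffun 'I_n.+1 -> nat}) (r : 'S_n.+1) (j : 'I_n.+1) t :
  r j = ord0 -> t <= n ->
  cube_vertex z r t.+1 = cube_vertex (shift_coord j z) (r * rot_perm n) t.
Proof.
move=> rj0 ltn; apply/ffunP => i; rewrite !ffunE permM permE /=.
case: eqP => [->|/eqP ij].
  rewrite rj0 /=. rewrite modn_small //= [n < t]ltnNge ltn addn0 //.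
rewrite addn0; congr (_ + nat_of_bool _).
have ri : 0 < r i.
  rewrite lt0n; apply: contra ij => /eqP ri.
  by apply/eqP/(@perm_inj _ r); rewrite rj0; apply/val_inj.
rewrite -{1}(prednK ri) ltnS.
rewrite (_ : (r i + n.+1).-1 = (r i).-1 + n.+1); last by rewrite -{1}(prednK ri).
by rewrite modnDr modn_small // (leq_ltn_trans (leq_pred _)).
Qed.

(** When [face_sum] is summed over all simplices, a face inside the big cube belongs to two
    simplices and cancels. A boundary face on z_j = 0 or z_j = m + 1 with j > 0 contributes 0, as
    label j is constant on it; on z_0 = 0 the factor lam_0 is 0. The facet z_0 = m + 1 carries lam_0
    = 1 and the statement in one dimension less. *)
Theorem cubical_sperner n (lam : 'I_n -> {ffun 'I_n -> nat} -> bool) :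
  (forall i (z : {ffun 'I_n -> nat}), z i = 0 -> lam i z = false) ->
  (forall i (z : {ffun 'I_n -> nat}), z i = m.+1 -> lam i z = true) ->
  \big[addb/false]_(x : {ffun 'I_n -> 'I_m.+1}) \big[addb/false]_(r : 'S_n) chain_prod lam (ffnat x) r = true.
Proof.
elim: n lam => [|n IHn] lam lam0 lam1.
  have x0 : {ffun 'I_0 -> 'I_m.+1} by apply: finfun => -[].
  rewrite (bigD1 x0) //= [X in _ (+) X]big1 ?addbF; last first.
    by move=> x; case/eqP; apply/ffunP => -[].
  rewrite (bigD1 1%g) //= [X in _ (+) X]big1 ?addbF /chain_prod ?big_ord0 // => r.
  by case/eqP; apply/permP => -[].
pose a z r i t := lam (inord i) (cube_vertex z r t).
have chainE z r : chain_prod lam z r = \big[addb/false]_(k < n.+2) face_term (a z r) n k.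
  rewrite face_sum; apply: eq_bigr => i _.
  by rewrite /a inord_val.
under eq_bigr do under eq_bigr do rewrite chainE.
rewrite exchange_big /=; under eq_bigr do rewrite exchange_big /=.
rewrite exchange_big /= big_ord_recl big_ord_recr /=.
rewrite [X in _ (+) (X (+) _)]big1 ?addFb; last first.
  move=> k _; rewrite exchange_big /= big1 // => x _.
  have kn : k < n.+1 by rewrite ltnS ltnW.
  have k1n : k.+1 <= n by exact: ltn_ord.
  pose k0 : 'I_n.+1 := Ordinal kn; pose k1 : 'I_n.+1 := Ordinal (k1n : k.+1 < n.+1).
  (* A transposition of two consecutive steps pairs the simplices that share this middle face; the
     sign of the permutation tells the partners apart. *)
  apply: (addb_big_involution (h := fun r => (r * tperm k0 k1)%g) (e := @odd_perm _)).
  - by move=> r; rewrite -mulgA tperm2 mulg1.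
  - move=> r; rewrite /face_term /a.
    have nb i : bump (bump 0 k) i != k1 by rewrite /bump /= eq_sym neq_bump.
    rewrite cube_vertex_tperm //; congr (_ && _).
    by apply: eq_bigr => i _; rewrite !cube_vertex_tperm.
  - by move=> r; rewrite odd_permM odd_tperm -val_eqE /= neq_ltn ltnSn addbT.
rewrite [X in _ (+) X](reindex_inj (mulIg (rot_perm n))) /= -big_split /=.
rewrite (bigID (fun r : 'S_n.+1 => r ord0 == ord0)) /= [X in _ (+) X]big1 ?addbF; last first.
  move=> r r0; pose j := (r^-1)%g ord0.
  have rj : r j = ord0 by rewrite /j permKV.
  have j0 : j != ord0 by apply: contra r0 => /eqP j0; rewrite -{1}j0 rj.
  pose G z := face_term (a z (r * rot_perm n)%g) n n.+1.
  have GE z : face_term (a z r) n 0 = G (shift_coord j z).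
    rewrite /G /face_term /a; congr (_ && _).
      by rewrite (cube_vertex_rot _ rj).
    apply: eq_bigr => i _; rewrite /bump /= !add1n.
    rewrite !(ltnNge n) ltn_ord (ltnW (ltn_ord i)) !add0n.
    by rewrite !(cube_vertex_rot _ rj) // ltnW.
  under eq_bigr do rewrite GE.
  (* [j] is the last direction of the path, so no vertex of this face has moved in it: label [j] is
     constant there and its factor is a sum of two equal bits. *)
  have key (z : {ffun 'I_n.+1 -> nat}) c : z j = c -> (c = 0 \/ c = m.+1) -> G z = false.
    move=> zj hc; rewrite /G /face_term.
    case: (unliftP ord0 j) j0 => [i ji _|->]; last by rewrite eqxx.
    rewrite (bigD1 i) //= andbCA.
    suff -> : a z (r * rot_perm n)%g i.+1 (bump n.+1 i.+1) =
              a z (r * rot_perm n)%g i.+1 (bump n.+1 i) by rewrite addbb.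
    have vj t : t <= n -> cube_vertex z (r * rot_perm n)%g t j = c.
      move=> tn; rewrite ffunE permM rj permE /= modn_small // zj.
      by rewrite ltnNge tn addn0.
    have ij : inord i.+1 = j by rewrite ji; apply/val_inj; rewrite /= inordK // ltnS.
    have b1 : bump n.+1 i.+1 = i.+1 by rewrite /bump ltnNge ltn_ord.
    have b2 : bump n.+1 i = i by rewrite /bump ltnNge (ltnW (ltn_ord i)).
    rewrite b1 b2 /a ij; case: hc => hc.
      by rewrite !lam0 // vj // ltnW.
    by rewrite !lam1 // vj // ltnW.
  rewrite addb_telescope; last first.
    by move=> x xj; rewrite (key _ 0) ?ffunE ?xj //; left.
  rewrite big1 // => x /eqP xj; apply: (key _ m.+1); last by right.
  by rewrite !ffunE xj eqxx addn1.
(* The remaining labels on the facet z_0 = m + 1. *)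
pose lam' (i : 'I_n) (z : {ffun 'I_n -> nat}) :=
  lam (lift ord0 i) [ffun j => if unlift ord0 j is Some j' then z j' else m.+1].
have lam'0 i (z : {ffun 'I_n -> nat}) : z i = 0 -> lam' i z = false.
  by move=> zi; apply: lam0; rewrite ffunE liftK.
have lam'1 i (z : {ffun 'I_n -> nat}) : z i = m.+1 -> lam' i z = true.
  by move=> zi; apply: lam1; rewrite ffunE liftK.
rewrite -[RHS](IHn lam' lam'0 lam'1) [RHS]exchange_big /=.
(* [lift_perm] identifies the permutations of n points with those of n + 1 points that fix 0. *)
rewrite (reindex (lift_perm ord0 ord0)); last first.
  have ulsfP i (s : 'S_n.+1) j : s i != s j -> exists k, unlift (s i) (s j) = Some k.
    by move=> sij; case: (unliftP (s i) (s j)) => [k|] e; [exists k | rewrite e eqxx in sij].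
  pose ulsf i (s : 'S_n.+1) k := odflt k (unlift (s i) (s (lift i k))).
  have ulsfK i (s : 'S_n.+1) k : lift (s i) (ulsf i s k) = s (lift i k).
    rewrite /ulsf; have:= neq_lift i k.
    by rewrite -(can_eq (permK s)) => /unlift_some[] ? ? ->.
  have inj_ulsf : injective (ulsf ord0 _).
    move=> s; apply: can_inj (ulsf (s ord0) s^-1%g) _ => k'.
    by rewrite {1}/ulsf ulsfK !permK liftK.
  exists (fun s => perm (inj_ulsf s)) => [s _ | s].
    by apply/permP=> k'; rewrite permE /ulsf lift_perm_lift lift_perm_id liftK.
  move/eqP=> si; apply/permP=> k.
  case: (unliftP ord0 k) => [k'|] ->; rewrite ?lift_perm_id //.
  by rewrite lift_perm_lift permE; have := ulsfK ord0 s k'; rewrite si.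
apply: eq_big => [s|s _]; first by rewrite lift_perm_id eqxx.
set r := lift_perm _ _ _.
have rj : r ord0 = ord0 by rewrite /r lift_perm_id.
pose G z := face_term (a z (r * rot_perm n)%g) n n.+1.
have GE z : face_term (a z r) n 0 = G (shift_coord ord0 z).
  rewrite /G /face_term /a; congr (_ && _).
    by rewrite (cube_vertex_rot _ rj).
  apply: eq_bigr => i _; rewrite /bump /= !add1n.
  rewrite !(ltnNge n) ltn_ord (ltnW (ltn_ord i)) !add0n.
  by rewrite !(cube_vertex_rot _ rj) // ltnW.
under eq_bigr do rewrite GE.
rewrite addb_telescope; last first.
  move=> x xj; rewrite /G /face_term; apply/negbTE/negP => /andP[+ _].
  rewrite /a (_ : inord 0 = ord0); last by apply/val_inj; rewrite /= inordK.
  by rewrite lam0 // !ffunE xj.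
pose h (x : {ffun 'I_n -> 'I_m.+1}) : {ffun 'I_n.+1 -> 'I_m.+1} :=
  [ffun j => if unlift ord0 j is Some j' then x j' else ord_max].
pose h' (x : {ffun 'I_n.+1 -> 'I_m.+1}) : {ffun 'I_n -> 'I_m.+1} :=
  [ffun j => x (lift ord0 j)].
rewrite (reindex h) /=; last first.
  exists h' => [x _|x]; first by apply/ffunP => j; rewrite !ffunE liftK.
  rewrite inE => /eqP xj; apply/ffunP => j; rewrite !ffunE.
  by case: unliftP => [j' ->|->]; rewrite ?ffunE.
apply: eq_big => [x|x _]; first by rewrite ffunE unlift_none eqxx.
rewrite -GE /face_term /a lam1 /=; last first.
  rewrite (_ : inord 0 = ord0); last by apply/val_inj; rewrite /= inordK.
  by rewrite !ffunE unlift_none /= rj addn1.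
apply: eq_bigr => i _.
rewrite (_ : inord i.+1 = lift ord0 i); last by apply/val_inj; rewrite /= inordK // ltnS.
have vE t : cube_vertex (ffnat (h x)) r t.+1 =
    [ffun j => if unlift ord0 j is Some j' then cube_vertex (ffnat x) s t j' else m.+1].
  apply/ffunP => j; rewrite !ffunE; case: unliftP => [j' ->|->].
    by rewrite !ffunE /r lift_perm_lift.
  by rewrite rj addn1.
by rewrite /bump /= !add1n !vE.
Qed.

(** An odd sum has a nonzero term, and each factor of that chain product is a change of one label
    between two vertices of the same cube. *)
Corollary cubical_miranda n (lam : 'I_n -> {ffun 'I_n -> nat} -> bool) :
  (forall i (z : {ffun 'I_n -> nat}), z i = 0 -> lam i z = false) ->
  (forall i (z : {ffun 'I_n -> nat}), z i = m.+1 -> lam i z = true) ->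
  exists x : {ffun 'I_n -> 'I_m.+1}, forall i : 'I_n,
    exists z z' : {ffun 'I_n -> nat},
    [/\ forall j, x j <= z j <= (x j).+1, forall j, x j <= z' j <= (x j).+1,
        lam i z = false & lam i z' = true].
Proof.
move=> lam0 lam1; have := cubical_sperner lam0 lam1.
case: (pickP (fun p : {ffun 'I_n -> 'I_m.+1} * 'S_n =>
    chain_prod lam (ffnat p.1) p.2)) => [[x r] /= hxr _|h]; last first.
  by rewrite big1 // => x _; rewrite big1 // => r _; exact: (h (x, r)).
exists x => i; move: hxr; rewrite /chain_prod (bigD1 i) //= => /andP[hi _].
have bd t j : x j <= cube_vertex (ffnat x) r t j <= (x j).+1.
  by rewrite !ffunE leq_addr /=; case: (_ < _); rewrite ?addn1 ?addn0.
move: hi; set z := cube_vertex _ _ _; set z' := cube_vertex _ _ _.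
case lz : (lam i z); case lz' : (lam i z') => // _.
- by exists z', z; split=> // j; exact: bd.
- by exists z, z'; split=> // j; exact: bd.
Qed.

End Cubes.

Local Open Scope classical_set_scope.
Local Open Scope ring_scope.

(** * Sets missed by Lipschitz maps have small dimension *)

Section RowNorm.
Variable R : realType.

Lemma row_norm_le n (x : 'rV[R]_n) (e : R) :
  0 <= e -> (forall i, `|x 0 i| <= e) -> `|x| <= e.
Proof.
move=> e0 xe; rewrite [leLHS]/Num.norm /= mx_normrE.
by apply/bigmax_leP; split=> // -[i j] _ /=; rewrite (ord1 i).
Qed.

Lemma row_norm_lt n (x : 'rV[R]_n) (e : R) :
  0 < e -> (forall i, `|x 0 i| < e) -> `|x| < e.
Proof.
move=> e0 xe; rewrite [ltLHS]/Num.norm /= mx_normrE.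
by apply/bigmax_ltP; split=> // -[i j] _ /=; rewrite (ord1 i).
Qed.

Lemma row_coord_le_norm n (x : 'rV[R]_n) i : `|x 0 i| <= `|x|.
Proof.
by rewrite [leRHS]/Num.norm /= mx_normrE; apply/bigmax_geP; right; exists (0, i).
Qed.

Lemma continuous_row_mk (T : topologicalType) n (f : T -> 'rV[R]_n) (x : T) :
  (forall i, (fun y => f y 0 i) @ x --> f x 0 i) -> f @ x --> f x.
Proof.
move=> fi; apply/cvgrPdist_lt => e e0.
have H i : \forall y \near x, `|f x 0 i - f y 0 i| < e.
  by have /cvgrPdist_lt := fi i; apply.
have : \forall y \near x, forall i, `|f x 0 i - f y 0 i| < e.
  by apply: filter_forall.
apply: filterS => y hy; apply: row_norm_lt => // i.
by rewrite !mxE; exact: hy.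
Qed.

Lemma compact_unif_cts (V W : normedModType R) (K : set V) (f : V -> W) :
  compact K -> {within K, continuous f} ->
  forall e : R, 0 < e -> exists2 d : R, 0 < d &
    forall x y, K x -> K y -> `|x - y| < d -> `|f x - f y| < e.
Proof.
move=> /compact_near_coveringP/near_covering_withinP cK /subspace_continuousP fc e e0.
have e20 : 0 < e / 2 by rewrite divr_gt0.
pose P (d : R) (x : V) := forall y, K y -> `|x - y| < d -> `|f x - f y| < e.
have : \forall d \near 0^'+, K `<=` P d.
  apply: cK => x Kx.
  have /cvgrPdist_lt/(_ _ e20) := fc x Kx.
  rewrite near_withinE => /nbhs_normP[r /= r0 hr].
  have r20 : 0 < r / 2 by rewrite divr_gt0.
  exists (ball x (r / 2), [set d : R | d < r / 2]).
    split=> /=; first by apply: nbhsx_ballx.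
    by apply: nbhs_right_lt.
  move=> [x' d] /= [xx' dr] Kx' y Ky xy.
  rewrite -ball_normE /= in xx'.
  have h1 : `|f x - f x'| < e / 2.
    by apply: hr => //=; apply: lt_trans xx' _; lra.
  have h2 : `|f x - f y| < e / 2.
    apply: hr => //=; apply: le_lt_trans (ler_distD x' _ _) _.
    by have := lt_trans xy dr; lra.
  apply: le_lt_trans (ler_distD (f x) _ _) _.
  by rewrite (distrC (f x')); lra.
move=> H; near (0 : R)^'+ => d.
have KP : K `<=` P d by near: d.
by exists d => // x y Kx Ky; exact: KP.
Unshelve. all: by end_near. Qed.

End RowNorm.

Section Dimension.
Variable R : realType.

(** Poincare-Miranda in approximate form: on x_i = 1/4 the bounds give u_i <= 3/8 < c_i, on x_i =
    3/4 they give u_i >= 5/8 > c_i. On a grid finer than the modulus of continuity some cell sees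
    both signs of every u_i - c_i. *)
Lemma approx_surjective n (u : 'rV[R]_n -> 'rV[R]_n) (c : 'rV[R]_n) :
  let K := [set x : 'rV[R]_n | forall i, 1/4 <= x 0 i <= 3/4] in
  (forall e : R, 0 < e -> exists2 d : R, 0 < d &
     forall x y, K x -> K y -> `|x - y| < d -> `|u x - u y| < e) ->
  (forall x i, K x -> `|u x 0 i - x 0 i| <= 1/8) ->
  (forall i, `|c 0 i - 1/2| < 1/8) ->
  forall e : R, 0 < e -> exists2 x, K x & `|u x - c| <= e.
Proof.
move=> K ucont uid cK e e0; have [d d0 hd] := ucont _ e0.
have [m hm] : exists m : nat, (2 * m.+1%:R)^-1 < d.
  exists (Num.truncn d^-1); rewrite invf_plt ?posrE // ?mulr_gt0 //.
  have := truncnS_gt d^-1; have : 0 < (Num.truncn d^-1).+1%:R :> R by [].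
  lra.
(* m + 1 steps of length 1 / (2 (m + 1)) lead from 1/4 to 3/4. *)
pose p (z : {ffun 'I_n -> nat}) : 'rV[R]_n :=
  \row_i (1/4 + (z i)%:R / (2 * m.+1%:R)).
have m0 : 0 < m.+1%:R :> R by [].
have pK (z : {ffun 'I_n -> nat}) : (forall i, (z i <= m.+1)%N) -> K (p z).
  move=> zm i; rewrite mxE.
  have h0 : 0 <= (z i)%:R / (2 * m.+1%:R) :> R by rewrite divr_ge0.
  have h1 : (z i)%:R / (2 * m.+1%:R) <= 1 / 2 :> R.
    rewrite ler_pdivrMr ?mulr_gt0 // (_ : 1 / 2 * _ = m.+1%:R); last by field.
    by rewrite ler_nat.
  by move: h0 h1; set w := _ / _ => h0 h1; apply/andP; split; lra.
(* The boundary values are forced, since the labels must be right at all integer points; on the grid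
   they agree with the sign test, by [lamE]. *)
pose lam i (z : {ffun 'I_n -> nat}) := (z i != 0%N) && ((z i == m.+1) || (c 0 i <= u (p z) 0 i)).
have lam0 i (z : {ffun 'I_n -> nat}) : z i = 0%N -> lam i z = false.
  by move=> zi; rewrite /lam zi.
have lam1 i (z : {ffun 'I_n -> nat}) : z i = m.+1 -> lam i z = true.
  by move=> zi; rewrite /lam zi eqxx.
have lamE i (z : {ffun 'I_n -> nat}) : (forall j, (z j <= m.+1)%N) ->
    lam i z = (c 0 i <= u (p z) 0 i).
  move=> zm; have := uid _ i (pK _ zm); have := cK i.
  rewrite /lam !ltr_norml !ler_norml.
  have [zi|zi] /= := eqVneq (z i) 0%N.
    by rewrite mxE zi mul0r addr0 => /andP[? ?] /andP[? ?]; apply/esym/negbTE; rewrite -ltNge; lra.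
  have [zi'|zi'] //= := eqVneq (z i) m.+1.
  rewrite mxE zi' (_ : m.+1%:R / _ = 1 / 2); last by rewrite invfM mulrCA mulfV ?gt_eqF // mulr1 div1r.
  by move=> /andP[? ?] /andP[? ?]; apply/esym; lra.
have [x hx] := cubical_miranda lam0 lam1.
have xm (z : {ffun 'I_n -> nat}) : (forall j, (x j <= z j <= (x j).+1)%N) -> forall j, (z j <= m.+1)%N.
  by move=> xz j; have /andP[_ /leq_trans] := xz j; apply.
have pd (z : {ffun 'I_n -> nat}) : (forall j, (x j <= z j <= (x j).+1)%N) ->
    `|p (ffnat x) - p z| < d.
  move=> xz; apply: row_norm_lt => // j; rewrite !mxE !ffunE.
  have /andP[h1 h2] := xz j.
  rewrite opprD addrACA subrr add0r distrC -mulrBl.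
  have -> : (z j)%:R - (x j)%:R = (z j - x j)%:R :> R by rewrite natrB.
  rewrite ger0_norm ?divr_ge0 //.
  apply: le_lt_trans hm; rewrite ler_pdivrMr ?mulr_gt0 // mulVf ?mulf_neq0 //.
  by rewrite lern1; lia.
have xx (j : 'I_n) : (x j <= ffnat x j <= (x j).+1)%N by rewrite ffunE leqnn leqnSn.
have Kx := pK _ (xm _ xx).
exists (p (ffnat x)) => //; apply: row_norm_le; first exact: ltW.
move=> i; have [z [z' [xz xz' l0 l1]]] := hx i.
move: l0 l1; rewrite !lamE; try exact: xm.
move=> /negbT; rewrite -ltNge => l0 l1.
have d1 := le_lt_trans (row_coord_le_norm _ i) (hd _ _ Kx (pK _ (xm _ xz)) (pd _ xz)).
have d2 := le_lt_trans (row_coord_le_norm _ i) (hd _ _ Kx (pK _ (xm _ xz')) (pd _ xz')).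
move: d1 d2; rewrite !mxE !ltr_norml ler_norml; lra.
Qed.

(** An embedded cube of dimension m >= n contains an embedded n-cube, the slice given by [e]. The
    inverse is uniformly continuous on a compact part, so an inf-convolution yields a Lipschitz [P]
    within 1/8 of it. Then [P] after the embedding moves points of [K] by at most 1/8 and covers a
    ball, against the hypothesis on [S]. *)
Lemma dim_le_of_lipschitz_null n (S : set 'rV[R]_n) : (0 < n)%N ->
  (forall (P : 'rV[R]_n -> 'rV[R]_n) (L : R),
     (forall x y, `|P x - P y| <= L * `|x - y|) ->
     forall O : set 'rV[R]_n, O !=set0 -> open O ->
     exists2 c, O c & forall s, S s -> P s <> c) ->
  dim_le S (n - 1).
Proof.
move=> n0 Snull m h hS hinj hcont [g [gh gcont]].
rewrite leqNgt; apply/negP => mn; have nm : (n <= m)%N by lia.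
pose K := [set x : 'rV[R]_n | forall i, 1/4 <= x 0 i <= 3/4].
pose e (x : 'rV[R]_n) : 'rV[R]_m :=
  \row_j (if insub (val j) is Some i then x 0 i else 1/2).
pose pr (y : 'rV[R]_m) : 'rV[R]_n := \row_i y 0 (widen_ord nm i).
have eK x : K x -> @open_cube R m (e x).
  move=> Kx i; rewrite mxE; case: insubP => [j _ _|_]; last by lra.
  by have := Kx j; lra.
have pre x : pr (e x) = x.
  apply/rowP => i; rewrite !mxE /= insubT //= => lt; congr (x 0 _); exact: val_inj.
have econt : continuous e.
  move=> x; apply: continuous_row_mk => j; rewrite [X in _ --> X]mxE.
  under eq_fun do rewrite mxE.
  case: insubP => [i _ _|_]; [exact: coord_continuous | by move=> A /nbhs_singleton hA; apply: (@filterE _ (nbhs x)) => y].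
have prcont : continuous pr.
  move=> x; apply: continuous_row_mk => j; rewrite [X in _ --> X]mxE.
  under eq_fun do rewrite mxE.
  exact: coord_continuous.
have cK : compact K.
  have -> : K = [set v : 'rV[R]_n | forall i, `[(1/4 : R), 3/4]%classic (v ord0 i)].
    by apply/seteqP; split=> x /= hx i; have := hx i; rewrite /= ?in_itv.
  by apply: (@rV_compact _ n (fun=> `[(1/4 : R), 3/4]%classic)) => _; exact: segment_compact.
have heC : {within K, continuous (h \o e)}.
  apply/subspace_continuousP => x Kx.
  move/subspace_continuousP : hcont => /(_ _ (eK _ Kx)) hc.
  apply: cvg_comp hc => A /=; rewrite !nbhs_simpl /= /within /= => nA.
  apply: (filterS _ (econt x _ nA : nbhs x _)) => y hy Ky.
  exact: hy (eK _ Ky).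
pose S' := (h \o e) @` K.
have cS' : compact S' by exact: continuous_compact.
have S'S s : S' s -> (h @` (@open_cube R m)) s.
  by case=> x Kx <-; exists (e x) => //; exact: eK.
pose gh' := pr \o g.
have ghe x : K x -> gh' (h (e x)) = x.
  by move=> Kx; rewrite /gh' /= gh ?pre //; exact: eK.
have gcont' : {within S', continuous gh'}.
  apply/subspace_continuousP => s S's.
  move/subspace_continuousP : gcont => /(_ _ (S'S _ S's)) hc.
  apply: (cvg_comp _ _ _ (prcont _)).
  move=> A /hc; rewrite !nbhs_simpl /= /within /= => nA.
  by apply: (filterS _ (nA : nbhs s _)) => y hy S'y; exact: hy (S'S _ S'y).
have e8 : 0 < 1/8 :> R by lra.
have [d d0 hd] := compact_unif_cts cS' gcont' e8.
(* McShane's formula with slope 1 / d, where d is the modulus of continuity for 1/8: a point closer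
   than d changes the value by less than 1/8, a farther one pays at least 1, more than the length
   1/2 of the range. *)
pose E (y : 'rV[R]_n) i := [set gh' s 0 i + `|y - s| / d | s in S'].
have KS' s i : S' s -> 1/4 <= gh' s 0 i <= 3/4.
  by case=> x Kx <-; rewrite /comp ghe.
pose x0 : 'rV[R]_n := \row__ (1/2).
have Kx0 : K x0 by move=> i; rewrite mxE; lra.
have En y i : E y i !=set0.
  by exists (gh' (h (e x0)) 0 i + `|y - h (e x0)| / d); exists (h (e x0)) => //; exists x0.
have Elb y i : has_lbound (E y i).
  exists (1/4) => _ [s S's <-]; have := KS' s i S's => /andP[+ _].
  have : 0 <= `|y - s| / d by rewrite divr_ge0 // ltW.
  lra.
pose P (y : 'rV[R]_n) : 'rV[R]_n := \row_i inf (E y i).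
have Plip x y : `|P x - P y| <= d^-1 * `|x - y|.
  have H a b i : inf (E a i) <= inf (E b i) + d^-1 * `|a - b|.
    rewrite -lerBlDr; apply: lb_le_inf => // _ [s S's <-].
    rewrite lerBlDr; apply: (@le_trans _ _ (gh' s 0 i + `|a - s| / d)).
      by apply: ge_inf => //; exists s.
    rewrite -addrA lerD2l -!(mulrC d^-1) -mulrDr ler_pM2l ?invr_gt0 //.
    by rewrite [leRHS]addrC ler_distD.
  apply: row_norm_le => [|i]; first by rewrite mulr_ge0 // invr_ge0 ltW.
  rewrite !mxE ler_norml; have := H x y i; have := H y x i; rewrite distrC; lra.
have Pg s i : S' s -> `|P s 0 i - gh' s 0 i| <= 1/8.
  move=> S's; rewrite mxE ler_norml; apply/andP; split.
    rewrite lerBrDr; apply: lb_le_inf => // _ [s' S's' <-].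
    have [ss'|ss'] := ltP `|s - s'| d.
      have := le_lt_trans (row_coord_le_norm _ i) (hd _ _ S's S's' ss').
      rewrite !mxE ltr_norml => /andP[_ h1].
      have : 0 <= `|s - s'| / d by rewrite divr_ge0 // ltW.
      lra.
    have h1 : 1 <= `|s - s'| / d by rewrite ler_pdivlMr // mul1r.
    have := KS' s i S's; have := KS' s' i S's'; lra.
  suff : inf (E s i) <= gh' s 0 i by lra.
  by apply: ge_inf => //; exists s => //; rewrite subrr normr0 mul0r addr0.
have Pcont (x : 'rV[R]_n) : P @ x --> P x.
  apply/(@cvgrPdist_lt _ _ _ _ (nbhs_filter x)) => r r0.
  have H : \forall y \near x, `|x - y| < r * d.
    by apply/nbhs_normP; exists (r * d) => //=; exact: mulr_gt0.
  apply: (filterS _ (H : nbhs x _)) => y /= xy.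
  by apply: le_lt_trans (Plip _ _) _; rewrite mulrC ltr_pdivrMr.
pose u := P \o (h \o e).
have uC : {within K, continuous u}.
  apply/subspace_continuousP => x Kx.
  move/subspace_continuousP : heC => /(_ _ Kx) hc.
  exact: (cvg_comp _ _ hc (Pcont _)).
have uU := compact_unif_cts cK uC.
have uid x i : K x -> `|u x 0 i - x 0 i| <= 1/8.
  move=> Kx; have := Pg (h (e x)) i; rewrite ghe // => hh; apply: hh.
  by exists x.
have O0 : ball x0 (1/8 : R) !=set0 by exists x0; exact: ballxx.
have [c cO cS] := Snull P d^-1 Plip _ O0 (ball_open x0 (1/8)).
have cb i : `|c 0 i - 1/2| < 1/8.
  move: cO; rewrite -ball_normE /= => /(le_lt_trans (row_coord_le_norm _ i)).
  by rewrite !mxE distrC.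
(* Approximate solutions suffice, because the image of the compact [K] is closed. *)
have cuK : closed (u @` K).
  by apply: compact_closed; [exact: norm_hausdorff | exact: continuous_compact].
have : (u @` K) c.
  apply: cuK => B /nbhs_normP[r /= r0 hr].
  have r20 : 0 < r / 2 by rewrite divr_gt0.
  have [x Kx xc] := approx_surjective uU uid cb r20.
  exists (u x); split; first by exists x.
  by apply: hr; rewrite /ball_ /= distrC; lra.
case=> x Kx uxc; apply: (cS (h (e x))) => //.
by apply: hS; exact: eK.
Unshelve. all: by end_near. Qed.

End Dimension.

(** * Covering zero sets of polynomial functions *)

Section PolyFun.
Variable R : realType.
Implicit Types (f g : (nat -> R) -> R) (x y : nat -> R).

(* Polynomials in x 0, ..., x (n - 1), as polynomials in x (n - 1) whose coefficients are
   polynomials in the previous variables. *)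
Fixpoint polyfun (n : nat) f : Prop :=
  if n is n'.+1 then
    exists d (a : nat -> (nat -> R) -> R),
      (forall i, polyfun n' (a i)) /\
      (forall x, f x = \sum_(i < d) a i x * x n' ^+ i)
  else exists c, forall x, f x = c.

Lemma polyfun_ext n f g : f =1 g -> polyfun n f -> polyfun n g.
Proof.
move=> fg; case: n => [[c fc]|n [d [a [pa fE]]]].
  by exists c => x; rewrite -fg.
by exists d, a; split=> // x; rewrite -fg.
Qed.

Lemma polyfun_widen n f : polyfun n f -> polyfun n.+1 f.
Proof.
move=> pf; exists 1%N, (fun=> f); split=> // x.
by rewrite big_ord1 expr0 mulr1.
Qed.

Lemma polyfun_cst n c : polyfun n (fun=> c).
Proof. by elim: n => [|n IHn]; [exists c | exact: polyfun_widen]. Qed.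

Lemma polyfun_if n (b : bool) f : polyfun n f -> polyfun n (if b then f else fun=> 0).
Proof. by case: b => // _; exact: polyfun_cst. Qed.

Lemma polyfun_monom n k f : polyfun n f -> polyfun n.+1 (fun x => f x * x n ^+ k).
Proof.
move=> pf; exists k.+1, (fun i => if i == k then f else fun=> 0); split.
  by move=> i; exact: polyfun_if.
move=> x; rewrite big_ord_recr /= eqxx big1 ?add0r // => i _.
by rewrite ltn_eqF // mul0r.
Qed.

Lemma polyfun_coord n i : (i < n)%N -> polyfun n (fun x => x i).
Proof.
elim: n => // n IHn; rewrite ltnS leq_eqVlt => /predU1P[->|/IHn]; last first.
  exact: polyfun_widen.
have := polyfun_monom 1 (polyfun_cst n 1).
by apply: polyfun_ext => x; rewrite mul1r expr1.
Qed.

Lemma polyfunD n f g : polyfun n f -> polyfun n g -> polyfun n (fun x => f x + g x).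
Proof.
elim: n f g => [|n IHn] f g.
  by move=> [c fc] [c' gc']; exists (c + c') => x; rewrite fc gc'.
move=> [d [a [pa fE]]] [e [b [pb gE]]].
exists (d + e)%N, (fun i x => (if (i < d)%N then a i else fun=> 0) x +
                              (if (i < e)%N then b i else fun=> 0) x); split.
  by move=> i; apply: IHn; [exact: (polyfun_if _ (pa i))|exact: (polyfun_if _ (pb i))].
move=> x; rewrite fE gE.
under [RHS]eq_bigr do rewrite mulrDl.
rewrite big_split /=; congr (_ + _).
  rewrite (big_ord_widen (d + e) (fun i => a i x * x n ^+ i)) ?leq_addr //.
  by rewrite big_mkcond /=; apply: eq_bigr => i _; case: ifP => //; rewrite mul0r.
rewrite (big_ord_widen (d + e) (fun i => b i x * x n ^+ i)) ?leq_addl //.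
by rewrite big_mkcond /=; apply: eq_bigr => i _; case: ifP => //; rewrite mul0r.
Qed.

Lemma polyfun_sum n (I : Type) (r : seq I) (P : pred I) (F : I -> (nat -> R) -> R) :
  (forall i, P i -> polyfun n (F i)) -> polyfun n (fun x => \sum_(i <- r | P i) F i x).
Proof.
move=> pF; elim: r => [|i r IHr].
  by apply: (polyfun_ext _ (polyfun_cst n 0)) => x; rewrite big_nil.
case Pi : (P i).
  apply: (polyfun_ext _ (polyfunD (pF i Pi) IHr)) => x.
  by rewrite big_cons Pi.
by apply: (polyfun_ext _ IHr) => x; rewrite big_cons Pi.
Qed.

Lemma polyfunM n f g : polyfun n f -> polyfun n g -> polyfun n (fun x => f x * g x).
Proof.
elim: n f g => [|n IHn] f g.
  by move=> [c fc] [c' gc']; exists (c * c') => x; rewrite fc gc'.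
move=> [d [a [pa fE]]] [e [b [pb gE]]].
have : polyfun n.+1 (fun x => \sum_(i < d) \sum_(j < e) (a i x * b j x) * x n ^+ (i + j)).
  apply: polyfun_sum => i _; apply: polyfun_sum => j _.
  by apply: polyfun_monom; exact: (IHn _ _ (pa i) (pb j)).
apply: polyfun_ext => x; rewrite fE gE big_distrlr /=.
by apply: eq_bigr => i _; apply: eq_bigr => j _; rewrite exprD mulrACA.
Qed.

Lemma polyfun_prod n (I : Type) (r : seq I) (P : pred I) (F : I -> (nat -> R) -> R) :
  (forall i, P i -> polyfun n (F i)) -> polyfun n (fun x => \prod_(i <- r | P i) F i x).
Proof.
move=> pF; elim: r => [|i r IHr].
  by apply: (polyfun_ext _ (polyfun_cst n 1)) => x; rewrite big_nil.
case Pi : (P i).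
  by apply: (polyfun_ext _ (polyfunM (pF i Pi) IHr)) => x; rewrite big_cons Pi.
by apply: (polyfun_ext _ IHr) => x; rewrite big_cons Pi.
Qed.

Lemma polyfun_local n f x y :
  polyfun n f -> (forall i, (i < n)%N -> x i = y i) -> f x = f y.
Proof.
elim: n f => [|n IHn] f; first by move=> [c fc] _; rewrite !fc.
move=> [d [a [pa fE]]] xy; rewrite !fE; apply: eq_bigr => i _.
by rewrite xy // (IHn _ (pa i)) // => j jn; apply: xy; exact: ltnW.
Qed.

(** Only the first [n] values of a point count; all dimensions share the type [nat -> R], so that
    inductions on [n] need no casts. *)
Definition in_box n (M : R) x := forall i, (i < n)%N -> `|x i| <= M.
Definition box_close n (r : R) x y := forall i, (i < n)%N -> `|x i - y i| <= r.

(** One constant bounds both the values and the slope, which makes the notion stable under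
    products. *)
Definition box_lipschitz n M f := exists L, 0 <= L /\ forall x y,
  in_box n M x -> in_box n M y -> `|f x| <= L /\
  forall r, 0 <= r -> box_close n r x y -> `|f x - f y| <= L * r.

Lemma box_lipschitzM n M f g :
  box_lipschitz n M f -> box_lipschitz n M g -> box_lipschitz n M (fun x => f x * g x).
Proof.
move=> [L [L0 hf]] [K [K0 hg]]; exists (L * K + L * K); split.
  by rewrite addr_ge0 ?mulr_ge0.
move=> x y bx bY; have [fx fxy] := hf x y bx bY; have [gx gxy] := hg x y bx bY.
have [fy _] := hf y y bY bY; split.
  rewrite normrM; apply: le_trans (ler_pM _ _ fx gx) _ => //.
  by rewrite lerDl mulr_ge0.
move=> r r0 xy; rewrite (_ : _ - _ = (f x - f y) * g x + f y * (g x - g y)); last by ring.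
apply: le_trans (ler_normD _ _) _; rewrite !normrM mulrDl lerD //.
  by rewrite -mulrA (mulrC K) mulrA ler_pM // fxy.
by rewrite -mulrA ler_pM // gxy.
Qed.

Lemma box_lipschitzD n M f g :
  box_lipschitz n M f -> box_lipschitz n M g -> box_lipschitz n M (fun x => f x + g x).
Proof.
move=> [L [L0 hf]] [K [K0 hg]]; exists (L + K); split; first exact: addr_ge0.
move=> x y bx bY; have [fx fxy] := hf x y bx bY; have [gx gxy] := hg x y bx bY; split.
  by apply: le_trans (ler_normD _ _) _; exact: lerD.
move=> r r0 xy; rewrite opprD addrACA mulrDl.
by apply: le_trans (ler_normD _ _) _; apply: lerD; [exact: fxy|exact: gxy].
Qed.

Lemma box_lipschitz_cst n M c : box_lipschitz n M (fun=> c).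
Proof.
exists `|c|; split=> // x y _ _; split=> // r r0 _.
by rewrite subrr normr0 mulr_ge0.
Qed.

Lemma box_lipschitz_coord n M i : (i < n)%N -> box_lipschitz n M (fun x => x i).
Proof.
move=> ltin; exists (`|M| + 1); split; first by rewrite addr_ge0.
move=> x y bx bY; split.
  by apply: le_trans (bx i ltin) _; rewrite ler_wpDr // ler_norm.
move=> r r0 xy; apply: le_trans (xy i ltin) _.
by rewrite mulrDl mul1r lerDr mulr_ge0.
Qed.

Lemma box_lipschitz_exp n M f k :
  box_lipschitz n M f -> box_lipschitz n M (fun x => f x ^+ k).
Proof.
move=> hf; elim: k => [|k IHk]; first exact: box_lipschitz_cst.
have [L [L0 H]] := box_lipschitzM hf IHk; exists L; split=> // x y bx bY.
by rewrite !exprS; exact: H.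
Qed.

Lemma box_lipschitz_widen n M f : box_lipschitz n M f -> box_lipschitz n.+1 M f.
Proof.
move=> [L [L0 H]]; exists L; split=> // x y bx bY.
have [||h1 h2] := H x y; [by move=> i /leqW; exact: bx|by move=> i /leqW; exact: bY|].
by split=> // r r0 xy; apply: h2 => // i /leqW; exact: xy.
Qed.

Lemma polyfun_lipschitz n M f : polyfun n f -> box_lipschitz n M f.
Proof.
elim: n f => [|n IHn] f.
  move=> [c fc]; have [L [L0 H]] := box_lipschitz_cst 0 M c.
  by exists L; split=> // x y; rewrite !fc; exact: H.
move=> [d [a [pa fE]]].
suff [L [L0 H]] : box_lipschitz n.+1 M (fun x => \sum_(i < d) a i x * x n ^+ i).
  by exists L; split=> // x y; rewrite !fE; exact: H.
elim: d {fE} => [|d IHd].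
  have [L [L0 H]] := box_lipschitz_cst n.+1 M 0.
  by exists L; split=> // x y; rewrite !big_ord0; exact: H.
have h1 : box_lipschitz n.+1 M (fun x => a d x * x n ^+ d).
  apply: box_lipschitzM; first by apply: box_lipschitz_widen; exact: (IHn _ (pa d)).
  by apply: box_lipschitz_exp; exact: box_lipschitz_coord.
have [L [L0 H]] := box_lipschitzD IHd h1.
by exists L; split=> // x y; rewrite !big_ord_recr; exact: H.
Qed.

(* Divided differences: if p is small at x0, then (p - p(x0))/(X - x0) is small
   at the small points of p that are s-far from x0. *)
Lemma count_small_poly (vs : seq R) (K : nat) (s : R) (d : nat) : 0 < s ->
  (forall v0, (count (fun v => `|v - v0| < s)%R vs <= K)%N) ->
  forall (p : {poly R}) (e : R), 0 <= e -> (size p <= d.+1)%N ->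
  e * (2 / s) ^+ d < `|p`_d| ->
  (count (fun v => `|p.[v]| <= e)%R vs <= d * K)%N.
Proof.
move=> s0 hK; elim: d => [|d IHd] p e e0 sp pd.
  rewrite mul0n leqn0 -leqn0 -[0%N]/(0 * size vs)%N.
  move: pd; rewrite expr0 mulr1 => pd.
  rewrite (@eq_count _ _ pred0) ?count_pred0 // => v /=.
  by rewrite (size1_polyC sp) hornerC; apply/negbTE; rewrite -ltNge.
case: (boolP (has (fun v => `|p.[v]| <= e) vs)) => [/hasP[v0 _ pv0]|]; last first.
  by rewrite has_count -leqNgt leqn0 => /eqP ->.
have /factor_theorem[q qE] : root (p - p.[v0]%:P) v0.
  by rewrite rootE hornerD hornerN hornerC subrr.
have pE : p = q * ('X - v0%:P) + p.[v0]%:P by rewrite -qE subrK.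
have sq : (size q <= d.+1)%N.
  have [->|q0] := eqVneq q 0; first by rewrite size_poly0.
  have : (size (p - p.[v0]%:P)%R <= d.+2)%N.
    rewrite (leq_trans (size_polyD _ _)) // geq_max sp size_polyN.
    by rewrite (leq_trans (size_polyC_leq1 _)).
  by rewrite qE size_Mmonic ?monicXsubC // size_XsubC addn2 /= ltnS.
have qd : q`_d = p`_d.+1.
  rewrite [in RHS]pE coefD coefC /= addr0 mulrBr coefB coefMX /= coefMC.
  by rewrite (nth_default _ sq) mul0r subr0.
have eq0 : 0 <= 2 * e / s by rewrite divr_ge0 ?mulr_ge0 // ltW.
have := IHd q (2 * e / s) eq0 sq; rewrite qd.
rewrite (_ : 2 * e / s * (2 / s) ^+ d = e * (2 / s) ^+ d.+1); last by rewrite exprS; ring.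
move=> /(_ pd) cq; rewrite mulSn.
apply: leq_trans (leq_add (hK v0) cq).
rewrite -count_predUI; apply: leq_trans (leq_addr _ _).
apply: sub_count => v /= pv; have [//|vv0] := ltP `|v - v0| s.
have qv : q.[v] * (v - v0) = p.[v] - p.[v0].
  by rewrite [in RHS]pE !hornerE /= subrr mulr0 add0r addrK.
have : `|q.[v]| * `|v - v0| <= 2 * e.
  rewrite -normrM qv; apply: le_trans (ler_normB _ _) _.
  by rewrite mulr2n mulrDl mul1r lerD.
move=> h; rewrite orFb ler_pdivlMr //; apply: le_trans h.
by rewrite ler_wpM2l.
Qed.

Lemma count_near_iota (G : nat) (w s : R) :
  (count (fun i : nat => `|i%:R - w| < s)%R (iota 0 G) <= (Num.truncn (2 * s)%R).+1)%N.
Proof.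
rewrite -size_filter; set F := (X in size X).
case: (boolP (nilp F)) => [/nilP -> //|Fn].
have hF : has (fun i : nat => `|i%:R - w| < s) (iota 0 G) by rewrite has_count -size_filter lt0n.
have [i0 hi0 mi0] : exists2 i0 : nat, `|i0%:R - w| < s & forall i, i \in F -> (i0 <= i)%N.
  have ex : exists i : nat, `|i%:R - w| < s.
    by case/hasP: hF => i _; exists i.
  case: (ex_minnP ex) => i0 h0 m0; exists i0 => // i.
  by rewrite mem_filter => /andP[/m0].
rewrite -(size_iota i0 (Num.truncn (2 * s)%R).+1); apply: uniq_leq_size.
  by rewrite filter_uniq ?iota_uniq.
move=> i iF; rewrite mem_iota mi0 //=.
have : `|i%:R - w| < s by move: iF; rewrite mem_filter => /andP[].
move: hi0; rewrite !ltr_norml => /andP[a1 a2] /andP[b1 b2].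
have s0 : 0 <= 2 * s by lra.
have := truncnS_gt (2 * s) => h.
have : (i - i0)%:R < (Num.truncn (2 * s)).+1%:R :> R.
  by rewrite natrB ?mi0 //; lra.
rewrite ltr_nat; have := mi0 _ iF; lia.
Qed.

Definition grid1 (dl M : R) (G : nat) : seq R := [seq - M + dl * i%:R | i <- iota 0 G.+1].
Definition upd n x (v : R) : nat -> R := fun i => if i == n then v else x i.
Fixpoint grid (dl M : R) G n : seq (nat -> R) :=
  if n is n'.+1 then [seq upd n' x v | x <- grid dl M G n', v <- grid1 dl M G]
  else [:: fun=> 0].

Lemma gridS dl M G n : grid dl M G n.+1 =
  [seq upd n x v | x <- grid dl M G n, v <- grid1 dl M G].
Proof. by []. Qed.

Lemma size_grid dl M G n : size (grid dl M G n) = (G.+1 ^ n)%N.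
Proof.
elim: n => // n IHn; rewrite gridS size_allpairs IHn size_map size_iota.
by rewrite expnS mulnC.
Qed.

Lemma count_allpairs_le (T U V : Type) (h : T -> U -> V) (P : pred V) (Q : pred T)
    (s : seq T) (t : seq U) (K : nat) :
  (forall w, ~~ Q w -> (count (fun v => P (h w v)) t <= K)%N) ->
  (count P [seq h w v | w <- s, v <- t] <= count Q s * size t + size s * K)%N.
Proof.
move=> hQ; elim: s => //= x s IHs; rewrite count_cat count_map.
case: (boolP (Q x)) => Qx /=.
  apply: leq_trans (leq_add (count_size (fun v => P (h x v)) t) IHs) _.
  rewrite add1n !mulSn; lia.
apply: leq_trans (leq_add (hQ _ Qx) IHs) _.
rewrite add0n mulSn; lia.
Qed.

(** Where the leading coefficient is small, the induction hypothesis bounds the number of lines;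
    elsewhere [count_small_poly] bounds the small values along the last coordinate. Each case costs
    at most eta / 2. The product with dl^n is the volume of the cubes at the counted grid points. *)
Lemma grid_count_small n f : polyfun n f -> (exists x, f x != 0) ->
  forall M eta : R, 0 < M -> 0 < eta ->
  exists2 e : R, 0 < e & exists2 d0 : R, 0 < d0 &
  forall (dl : R) (G : nat), 0 < dl -> dl < d0 -> dl * G%:R <= 2 * M + 1 ->
  (count (fun x => `|f x| <= e) (grid dl M G n))%:R * dl ^+ n <= eta.
Proof.
elim: n f => [|n IHn] f.
  move=> [c fc] [x]; rewrite fc => c0 M eta M0 eta0.
  exists (`|c| / 2); first by rewrite divr_gt0 // normr_gt0.
  exists 1 => // dl G _ _ _ /=; rewrite fc.
  have /negbTE -> : ~~ (`|c| <= `|c| / 2).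
    by rewrite -ltNge ltr_pdivrMr // ltr_pMr ?normr_gt0 // ltr1n.
  by rewrite addn0 mul0r ltW.
move=> [d [a [pa fE]]] f0 M eta M0 eta0.
(* The degree is lowered until the leading coefficient is not identically zero. *)
have [{}d [{}fE [x0 ad0]]] : exists d, (forall x, f x = \sum_(i < d.+1) a i x * x n ^+ i) /\
    exists x, a d x != 0.
  elim: d fE => [|d IHd] fE.
    by case: f0 => x; rewrite fE big_ord0 eqxx.
  have [h|h] := pselect (exists x, a d x != 0); first by exists d.
  apply: IHd => x; rewrite fE big_ord_recr /=.
  suff -> : a d x = 0 by rewrite mul0r addr0.
  by apply/eqP/negP => /negP adx; apply: h; exists x.
pose C := 2 * M + 2; have C0 : 0 < C by rewrite /C; lra.
have Cn0 : 0 < C ^+ n by exact: exprn_gt0.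
have [|e1 e10 [d1 d10 H]] := IHn (a d) (pa d) (ex_intro _ x0 ad0) M (eta / 2 / C) M0.
  by rewrite !divr_gt0.
(* Since K dl <= 3 s below, the good lines contribute at most C^n (d + 1) 3 s = eta / 2; [e] is then
   chosen so that e (2 / s)^d = e1 / 2. *)
pose s := eta / (6 * C ^+ n * d.+1%:R).
have s0 : 0 < s by rewrite divr_gt0 // !mulr_gt0.
pose e := e1 / (2 / s) ^+ d / 2.
have e0 : 0 < e by rewrite !divr_gt0 // exprn_gt0 // divr_gt0.
exists e => //; exists (Num.min d1 (Num.min s 1)).
  by rewrite !lt_min d10 s0 ltr01.
move=> dl G dl0; rewrite !lt_min => /and3P[dld1 dls dl1] dlG.
have cb := H dl G dl0 dld1 dlG.
pose K := (Num.truncn (2 * (s / dl))).+1.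
have CG : dl * G.+1%:R <= C by rewrite -addn1 natrD mulrDr mulr1 /C; lra.
have cK v0 : (count (fun v => `|v - v0| < s)%R (grid1 dl M G) <= K)%N.
  rewrite count_map; apply: leq_trans (count_near_iota G.+1 ((v0 + M) / dl) (s / dl)).
  apply: sub_count => i /= hi; rewrite ltr_pdivlMr //; move: hi.
  suff -> : `|i%:R - (v0 + M) / dl| * dl = `|- M + dl * i%:R - v0| by [].
  transitivity `|(i%:R - (v0 + M) / dl) * dl|; first by rewrite normrM (gtr0_norm dl0).
  congr `|_|.
  by field; rewrite gt_eqF.
have good x : ~~ (`|a d x| <= e1) ->
    (count (fun v => `|f (upd n x v)| <= e)%R (grid1 dl M G) <= d * K)%N.
  rewrite -ltNge => adx.
  pose p := \poly_(i < d.+1) a i x.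
  rewrite (eq_count (a2 := fun v => `|p.[v]| <= e)); last first.
    move=> v /=; rewrite fE horner_poly; congr (`|_| <= _).
    apply: eq_bigr => i _; rewrite /upd eqxx; congr (_ * _).
    by apply: polyfun_local (pa i) _ => j jn; rewrite ltn_eqF.
  apply: (count_small_poly s0 cK) => //; [exact: ltW|exact: size_poly|].
  rewrite coef_poly ltnSn; apply: le_lt_trans adx.
  rewrite /e mulrAC divfK ?gt_eqF //; last by rewrite exprn_gt0 // divr_gt0.
  by rewrite ler_pdivrMr //; lra.
rewrite gridS; have := count_allpairs_le (P := fun x => `|f x| <= e) (grid dl M G n) good.
rewrite size_grid size_map size_iota -(ler_nat R) => /(ler_wpM2r (ltW (exprn_gt0 n.+1 dl0))).
move=> /le_trans; apply; rewrite natrD !natrM natrX mulrDl.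
rewrite [leRHS](_ : eta = eta / 2 / C * C + eta / 2); last first.
  by rewrite divfK ?gt_eqF //; lra.
apply: lerD.
  rewrite exprSr mulrACA; apply: ler_pM => //.
  - by rewrite mulr_ge0 // exprn_ge0 // ltW.
  - by rewrite mulr_ge0 // ltW.
  - by rewrite mulrC.
have KE : K%:R * dl <= 3 * s.
  have : K%:R <= 2 * (s / dl) + 1.
    rewrite /K -addn1 natrD lerD2r; have /truncn_itv/andP[] // : 0 <= 2 * (s / dl).
    by rewrite mulr_ge0 // divr_ge0 // ltW.
  move=> /(ler_wpM2r (ltW dl0)) /le_trans; apply.
  by rewrite mulrDl mul1r -mulrA divfK ?gt_eqF //; lra.
rewrite (_ : _ * _ * _ = (dl * G.+1%:R) ^+ n * (d%:R * (K%:R * dl))); last first.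
  by rewrite exprMn exprSr; ring.
have -> : eta / 2 = C ^+ n * (d.+1%:R * (3 * s)).
  by rewrite /s; field; rewrite !gt_eqF //=; lra.
apply: ler_pM.
- by rewrite exprn_ge0 // mulr_ge0 // ltW.
- by rewrite !mulr_ge0 // ltW.
- by rewrite lerXn2r // nnegrE ?mulr_ge0 // ltW.
- by apply: ler_pM => //; rewrite ?mulr_ge0 ?ler_nat // ltW.
Qed.

Lemma In_cat (T : Type) (a : T) (s t : seq T) :
  List.In a s \/ List.In a t -> List.In a (s ++ t).
Proof.
elim: s => [[]//|b s IHs] /= [[->|h]|h]; [by left|right|right].
  by apply: IHs; left.
by apply: IHs; right.
Qed.

Lemma grid_close dl M n x : 0 < dl -> 0 < M -> in_box n M x ->
  exists2 g, List.In g (grid dl M (Num.truncn (2 * M / dl)) n) &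
    in_box n M g /\ box_close n dl x g.
Proof.
move=> dl0 M0; elim: n => [|n IHn] bx.
  by exists (fun=> 0); [left | split].
have [|g gin [bg xg]] := IHn; first by move=> i /leqW; exact: bx.
have := bx n (ltnSn n); rewrite ler_norml => /andP[x1 x2].
have t0 : 0 <= (x n + M) / dl by rewrite divr_ge0 ?(ltW dl0) //; lra.
set k := Num.truncn ((x n + M) / dl).
have /andP[t1 t2] : k%:R <= (x n + M) / dl < k.+1%:R by exact: truncn_itv.
pose v := - M + dl * k%:R.
move: t1 t2; rewrite ler_pdivlMr // ltr_pdivrMr // -natr1 mulrDl mul1r => t1 t2.
exists (upd n g v).
  rewrite gridS; have := gin; elim: (grid _ _ _ n) => // g' s IHs.
  rewrite allpairs_cons => -[->|/IHs h]; apply: In_cat; [left|by right].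
  have : List.In v (grid1 dl M (Num.truncn (2 * M / dl))).
    suff: (k <= Num.truncn (2 * M / dl)%R)%N.
      rewrite /grid1 /v; move: (Num.truncn _) => G kG.
      have : k \in iota 0 G.+1 by rewrite mem_iota ltnS.
      elim: (iota 0 G.+1) => //= j s' IH; rewrite inE => /predU1P[->|/IH]; first by left.
      by right.
    by apply: le_truncn; rewrite ler_pM2r ?invr_gt0 //; lra.
  by elim: (grid1 _ _ _) => //= v' s' IH [->|/IH]; [left|right].
split=> i; rewrite ltnS leq_eqVlt /upd => /predU1P[->|ltin].
- have k0 : 0 <= dl * k%:R by rewrite mulr_ge0 // ltW.
  by rewrite eqxx /v ler_norml; lra.
- by rewrite ltn_eqF //; exact: bg.
- by rewrite eqxx /v ler_norml; lra.
- by rewrite ltn_eqF //; exact: xg.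
Qed.

(** A zero lies within dl of a grid point, where |f| <= L dl <= e; so the grid points with |f| <= e
    are centres of a cover. *)
Lemma polyfun_zero_cover n f : polyfun n f -> (exists x, f x != 0) ->
  forall M eta : R, 0 < M -> 0 < eta ->
  exists2 d0 : R, 0 < d0 & forall dl : R, 0 < dl -> dl < d0 ->
  exists2 L : seq (nat -> R), (size L)%:R * dl ^+ n <= eta &
  forall x, in_box n M x -> f x = 0 ->
  exists2 c, List.In c L & box_close n dl x c.
Proof.
move=> pf f0 M eta M0 eta0.
have [e e0 [d0 d00 H]] := grid_count_small pf f0 M0 eta0.
have [L [L0 hL]] := polyfun_lipschitz M pf.
exists (Num.min d0 (Num.min 1 (e / (L + 1)))).
  by rewrite !lt_min d00 ltr01 divr_gt0 // ltr_pwDr.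
move=> dl dl0; rewrite !lt_min => /and3P[dld0 dl1 dle].
pose G := Num.truncn (2 * M / dl).
exists [seq x <- grid dl M G n | `|f x| <= e].
  rewrite size_filter; apply: H => //.
  have /truncn_itv/andP[+ _] : 0 <= 2 * M / dl by rewrite divr_ge0 ?mulr_ge0 // ltW.
  by rewrite ler_pdivlMr // -/G mulrC; lra.
move=> x bx fx; have [g gin [bg xg]] := grid_close dl0 M0 bx.
exists g => //.
have fg : `|f g| <= e.
  have [_ /(_ _ (ltW dl0) xg)] := hL x g bx bg.
  rewrite fx sub0r normrN => /le_trans; apply.
  move: dle; rewrite ltr_pdivlMr ?ltr_pwDr // mulrDr mulr1 mulrC => ?.
  by lra.
move: gin; rewrite -/G; elim: (grid _ _ _ _) => //= y s IHs [->|/IHs h].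
  by rewrite fg; left.
by case: ifP => // _; right.
Qed.

End PolyFun.

(** * Eigenfunctions centred at the midpoints *)

Import (canonicals) mpoly.
Local Notation coefA := Defs.coefA.
Local Notation coefB := Defs.coefB.

Section ComplexReal.
Variable R : realType.
Implicit Types (x y : R).

Lemma cRE x : cR x = real_complex R x. Proof. by []. Qed.
Lemma cRD x y : cR (x + y) = cR x + cR y. Proof. by rewrite !cRE rmorphD. Qed.
Lemma cRN x : cR (- x) = - cR x. Proof. by rewrite !cRE rmorphN. Qed.
Lemma cRB x y : cR (x - y) = cR x - cR y. Proof. by rewrite !cRE rmorphB. Qed.
Lemma cRM x y : cR (x * y) = cR x * cR y. Proof. by rewrite !cRE rmorphM. Qed.
Lemma cRV x : cR x^-1 = (cR x)^-1. Proof. by rewrite !cRE fmorphV. Qed.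
Lemma cRX x n : cR (x ^+ n) = cR x ^+ n. Proof. by rewrite !cRE rmorphXn. Qed.
Lemma cR0 : cR (0 : R) = 0. Proof. by []. Qed.
Lemma cR1 : cR (1 : R) = 1. Proof. by []. Qed.
Lemma cR_eq0 x : (cR x == 0) = (x == 0). Proof. by rewrite cRE fmorph_eq0. Qed.
Lemma cR_sum (I : Type) (r : seq I) (P : pred I) (F : I -> R) :
  cR (\sum_(i <- r | P i) F i) = \sum_(i <- r | P i) cR (F i).
Proof. by rewrite cRE rmorph_sum. Qed.

Lemma ReD (u v : R[i]) : complex.Re (u + v) = complex.Re u + complex.Re v.
Proof. by case: u => ? ?; case: v. Qed.
Lemma ImD (u v : R[i]) : complex.Im (u + v) = complex.Im u + complex.Im v.
Proof. by case: u => ? ?; case: v. Qed.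
Lemma ReM (u v : R[i]) : complex.Re (u * v) =
  complex.Re u * complex.Re v - complex.Im u * complex.Im v.
Proof. by case: u => ? ?; case: v. Qed.
Lemma ImM (u v : R[i]) : complex.Im (u * v) =
  complex.Re u * complex.Im v + complex.Im u * complex.Re v.
Proof. by case: u => ? ?; case: v => ? ? /=; rewrite addrC. Qed.
Lemma Re_MR (u : R[i]) x : complex.Re (u * cR x) = complex.Re u * x.
Proof. by case: u => a b /=; rewrite mulr0 subr0. Qed.
Lemma Im_MR (u : R[i]) x : complex.Im (u * cR x) = complex.Im u * x.
Proof. by case: u => a b /=; rewrite mulr0 add0r. Qed.
Lemma complex_eq (u v : R[i]) :
  complex.Re u = complex.Re v -> complex.Im u = complex.Im v -> u = v.
Proof. by case: u => ? ?; case: v => ? ? /= -> ->. Qed.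

Lemma cR_cos2sin2 x : cR (cos x) * cR (cos x) + cR (sin x) * cR (sin x) = 1.
Proof. by rewrite -!cRM -cRD -!expr2 cos2Dsin2. Qed.

Lemma expi_real x : expi x = cR (cos x) + 'i%C * cR (sin x).
Proof. by rewrite /expi [LHS]complexE. Qed.

End ComplexReal.

Section HalfEdge.
Variables (R : realType) (N : nat).
Implicit Types (l : 'rV[R]_N) (k t : R) (x : 'rV[R[i]]_(N + N)) (j : 'I_N).

Definition hphase l k j : R := k * l 0 j / 2.

(* On e_j the eigenfunction is [midE cos u + midO sin u], u = k (t - l_j / 2). *)
Definition midE l k x j : R[i] :=
  coefA x j * cR (cos (hphase l k j)) + coefB x j * cR (sin (hphase l k j)).
Definition midO l k x j : R[i] :=
  coefB x j * cR (cos (hphase l k j)) - coefA x j * cR (sin (hphase l k j)).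

Definition of_mid l k (E O : 'I_N -> R[i]) : 'rV[R[i]]_(N + N) :=
  row_mx (\row_j (E j * cR (cos (hphase l k j)) - O j * cR (sin (hphase l k j))))
         (\row_j (E j * cR (sin (hphase l k j)) + O j * cR (cos (hphase l k j)))).

Lemma coefA_mid l k x j : coefA x j =
  midE l k x j * cR (cos (hphase l k j)) - midO l k x j * cR (sin (hphase l k j)).
Proof.
rewrite -[LHS]mulr1 -(cR_cos2sin2 (hphase l k j)) /midE /midO; ring.
Qed.

Lemma coefB_mid l k x j : coefB x j =
  midE l k x j * cR (sin (hphase l k j)) + midO l k x j * cR (cos (hphase l k j)).
Proof.
rewrite -[LHS]mulr1 -(cR_cos2sin2 (hphase l k j)) /midE /midO; ring.
Qed.

Lemma coefA_of_mid l k E O j : coefA (of_mid l k E O) j =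
  E j * cR (cos (hphase l k j)) - O j * cR (sin (hphase l k j)).
Proof. by rewrite /coefA row_mxEl mxE. Qed.

Lemma coefB_of_mid l k E O j : coefB (of_mid l k E O) j =
  E j * cR (sin (hphase l k j)) + O j * cR (cos (hphase l k j)).
Proof. by rewrite /coefB row_mxEr mxE. Qed.

Lemma midE_of_mid l k E O j : midE l k (of_mid l k E O) j = E j.
Proof.
rewrite /midE coefA_of_mid coefB_of_mid -[RHS]mulr1.
rewrite -(cR_cos2sin2 (hphase l k j)); ring.
Qed.

Lemma midO_of_mid l k E O j : midO l k (of_mid l k E O) j = O j.
Proof.
rewrite /midO coefA_of_mid coefB_of_mid -[RHS]mulr1.
rewrite -(cR_cos2sin2 (hphase l k j)); ring.
Qed.

Lemma coef_eqP x y : (forall j, coefA x j = coefA y j) ->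
  (forall j, coefB x j = coefB y j) -> x = y.
Proof.
move=> hA hB; apply/rowP => i; rewrite -(splitK i).
by case: (fintype.split i) => j /=; [exact: hA | exact: hB].
Qed.

Lemma mid_eqP l k x y : (forall j, midE l k x j = midE l k y j) ->
  (forall j, midO l k x j = midO l k y j) -> x = y.
Proof.
move=> hE hO; apply: coef_eqP => j.
  by rewrite (coefA_mid l k) (coefA_mid l k y) hE hO.
by rewrite (coefB_mid l k) (coefB_mid l k y) hE hO.
Qed.

Lemma efun_mid l k x j t : efun k x j t =
  midE l k x j * cR (cos (k * t - hphase l k j)) +
  midO l k x j * cR (sin (k * t - hphase l k j)).
Proof.
rewrite /efun -[in LHS](subrK (hphase l k j) (k * t)).
move: (k * t - hphase l k j) => u; rewrite cosD sinD !(cRD, cRN, cRM) /midE /midO. ring.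
Qed.

Lemma efun0 l k x j : efun k x j 0 =
  midE l k x j * cR (cos (hphase l k j)) - midO l k x j * cR (sin (hphase l k j)).
Proof. by rewrite (efun_mid l) mulr0 sub0r cosN sinN cRN mulrN. Qed.

Lemma kl_hphase l k j : k * l 0 j - hphase l k j = hphase l k j.
Proof. by rewrite /hphase; field. Qed.

Lemma efun_end l k x j : efun k x j (l 0 j) =
  midE l k x j * cR (cos (hphase l k j)) + midO l k x j * cR (sin (hphase l k j)).
Proof. by rewrite (efun_mid l) kl_hphase. Qed.

Lemma is_derive_trig (a b k t : R) :
  is_derive t (1 : R) (fun s => a * cos (k * s) + b * sin (k * s))
    (k * (b * cos (k * t) - a * sin (k * t))).
Proof.
have h1 : is_derive t (1:R) (fun s => k * s) k.
  by apply: is_derive_eq; rewrite ?scaler0 ?add0r ?addr0 // /GRing.scale /= mulr1.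
have hc : is_derive t (1:R) (cos \o (fun s => k * s)) (k * - sin (k * t)).
  have := is_derive1_comp (is_derive_cos (k * t)) h1; rewrite mulrC; exact.
have hs : is_derive t (1:R) (sin \o (fun s => k * s)) (k * cos (k * t)).
  have := is_derive1_comp (is_derive_sin (k * t)) h1; rewrite mulrC; exact.
have ha : is_derive t (1:R) (a \*: (cos \o (fun s => k * s))) (a *: (k * - sin (k * t))).
  exact: is_deriveZ.
have hb : is_derive t (1:R) (b \*: (sin \o (fun s => k * s))) (b *: (k * cos (k * t))).
  exact: is_deriveZ.
apply: (is_derive_eq (is_deriveD ha hb)); rewrite /GRing.scale /=; ring.
Qed.

Lemma cderiv_efun l k x j t : cderiv (efun k x j) t =
  cR k * (midO l k x j * cR (cos (k * t - hphase l k j)) -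
          midE l k x j * cR (sin (k * t - hphase l k j))).
Proof.
transitivity (cR k * (coefB x j * cR (cos (k * t)) - coefA x j * cR (sin (k * t)))).
  rewrite /cderiv; apply: complex_eq => /=.
    rewrite (_ : (fun s => complex.Re _) = (fun s => complex.Re (coefA x j) * cos (k * s) + complex.Re (coefB x j) * sin (k * s))).
      have /@derive_val := is_derive_trig (complex.Re (coefA x j)) (complex.Re (coefB x j)) k t.
      rewrite derive1E => ->.
      by case: (coefA x j) => ? ?; case: (coefB x j) => ? ? /=; ring.
    by apply/funext => s; rewrite /efun ReD !Re_MR.
  rewrite (_ : (fun s => complex.Im _) = (fun s => complex.Im (coefA x j) * cos (k * s) + complex.Im (coefB x j) * sin (k * s))).
    have /@derive_val := is_derive_trig (complex.Im (coefA x j)) (complex.Im (coefB x j)) k t.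
    rewrite derive1E => ->.
    by case: (coefA x j) => ? ?; case: (coefB x j) => ? ? /=; ring.
  by apply/funext => s; rewrite /efun ImD !Im_MR.
congr (_ * _); rewrite -[in LHS](subrK (hphase l k j) (k * t)).
move: (k * t - hphase l k j) => u; rewrite cosD sinD !(cRD, cRN, cRM) /midE /midO; ring.
Qed.

Lemma cderiv_efun0 l k x j : cderiv (efun k x j) 0 =
  cR k * (midO l k x j * cR (cos (hphase l k j)) + midE l k x j * cR (sin (hphase l k j))).
Proof. by rewrite (cderiv_efun l) mulr0 sub0r cosN sinN cRN mulrN opprK. Qed.

Lemma cderiv_efun_end l k x j : cderiv (efun k x j) (l 0 j) =
  cR k * (midO l k x j * cR (cos (hphase l k j)) - midE l k x j * cR (sin (hphase l k j))).
Proof. by rewrite (cderiv_efun l) kl_hphase. Qed.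

(* Continuity at the vertices and the Kirchhoff condition for one parity. *)
Definition inU (a b : 'I_N -> R) (F : 'I_N -> R[i]) : Prop :=
  (forall i j, F i * cR (a i) = F j * cR (a j)) /\ \sum_j F j * cR (b j) = 0.

(** The values at the two ends are E_j cos phi_j -+ O_j sin phi_j, and the slopes split likewise;
    sums and differences of the conditions at the two vertices separate E from O. *)
Lemma vertex_conditions_mid l k x : 0 < k -> vertex_conditions l k x <->
  inU (fun j => cos (hphase l k j)) (fun j => sin (hphase l k j)) (midE l k x) /\
  inU (fun j => sin (hphase l k j)) (fun j => cos (hphase l k j)) (midO l k x).
Proof.
move=> k0; have k0' : cR k != 0 by rewrite cR_eq0 gt_eqF.
rewrite /vertex_conditions /inU.
under [\sum_(j < N) cderiv _ _]eq_bigr do rewrite (cderiv_efun0 l).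
under [\sum_(j < N) - cderiv _ _]eq_bigr do rewrite (cderiv_efun_end l) -mulrN opprB.
rewrite -!mulr_sumr big_split sumrB /=.
set SO := \sum_(i < N) midO l k x i * _; set SE := \sum_(i < N) midE l k x i * _.
split.
  move=> [h0 [hl [s0 sl]]].
  have {s0}/eqP : SO + SE = 0 by apply/eqP; move/eqP: s0; rewrite mulf_eq0 (negbTE k0').
  have {sl}/eqP : SE - SO = 0 by apply/eqP; move/eqP: sl; rewrite mulf_eq0 (negbTE k0').
  rewrite subr_eq0 => /eqP EO; rewrite EO -mulr2n mulrn_eq0 /= => /eqP SO0.
  split; (split; last by rewrite ?EO) => i j; have := h0 i j; have := hl i j;
    rewrite !(efun0 l) !efun_end => h1 h2; apply: (@mulfI _ 2) => //.
    transitivity (midE l k x i * cR (cos (hphase l k i)) + midO l k x i * cR (sin (hphase l k i)) + (midE l k x i * cR (cos (hphase l k i)) - midO l k x i * cR (sin (hphase l k i)))); first by ring.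
    by rewrite h1 h2; ring.
  transitivity (midE l k x i * cR (cos (hphase l k i)) + midO l k x i * cR (sin (hphase l k i)) - (midE l k x i * cR (cos (hphase l k i)) - midO l k x i * cR (sin (hphase l k i)))); first by ring.
  by rewrite h1 h2; ring.
move=> [[hE SE0] [hO SO0]]; rewrite SE0 SO0 addr0 subr0 mulr0; split; [|split=> //].
  by move=> i j; rewrite !(efun0 l) (hE i j) (hO i j).
by move=> i j; rewrite !efun_end (hE i j) (hO i j).
Qed.

End HalfEdge.

(** * Parity and the trace *)

Section Parity.
Variables (R : realType) (N : nat).
Implicit Types (l : 'rV[R]_N) (k t : R) (x : 'rV[R[i]]_(N + N)) (j : 'I_N).

Lemma symmetric_mid l k x : 0 < k -> pos_lengths l ->
  Defs.symmetric l k x <-> forall j, midO l k x j = 0.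
Proof.
move=> k0 lp; split=> [sx j|hO j t _]; last first.
  rewrite !(efun_mid l) hO !mul0r !addr0; congr (_ * cR _).
  by rewrite -cosN; congr cos; rewrite /hphase; field.
have lj : 0 < l 0 j by exact: lp.
(* The bound l_j / 2 keeps the test point on the edge, and 1 / k keeps k d in (0, 1], where the sine
   is positive. *)
pose d := Num.min (l 0 j / 2) k^-1.
have d0 : 0 < d by rewrite lt_min invr_gt0 k0 divr_gt0.
have dl : d <= l 0 j / 2 by rewrite ge_min lexx.
have dk : k * d <= 1 by rewrite mulrC -ler_pdivlMr // div1r ge_min lexx orbT.
have sd : 0 < sin (k * d) by apply: sin2_gt0; rewrite mulr_gt0 //=; lra.
have /sx : 0 <= l 0 j / 2 + d <= l 0 j by apply/andP; split; lra.
rewrite !(efun_mid l).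
rewrite (_ : k * (l 0 j - _) - _ = - (k * d)); last by rewrite /hphase; field.
rewrite (_ : k * (_ + d) - _ = k * d); last by rewrite /hphase; field.
rewrite cosN sinN cRN => /addrI /eqP; rewrite mulrN eq_sym -subr_eq0 opprK -mulr2n.
rewrite -mulrnAl mulf_eq0 cR_eq0 (gt_eqF sd) orbF mulrn_eq0 /=.
by move/eqP.
Qed.

Lemma antisymmetric_mid l k x : 0 < k -> pos_lengths l ->
  Defs.antisymmetric l k x <-> forall j, midE l k x j = 0.
Proof.
move=> k0 lp; split=> [sx j|hE j t _]; last first.
  rewrite !(efun_mid l) hE !mul0r !add0r -[RHS]mulrN -[X in _ = _ * X]cRN -sinN.
  by congr (_ * cR (sin _)); rewrite /hphase; field.
have lj : 0 < l 0 j by exact: lp.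
have /sx : 0 <= l 0 j / 2 <= l 0 j by apply/andP; split; lra.
have -> : l 0 j - l 0 j / 2 = l 0 j / 2 by field.
rewrite (efun_mid l) (_ : k * _ - _ = 0); last by rewrite /hphase; field.
rewrite cos0 sin0 mulr1 mulr0 addr0 => /eqP; rewrite -subr_eq0 opprK -mulr2n mulrn_eq0 /=.
by move/eqP.
Qed.

Definition trace_vec l k x : 'I_(N + N + N + N) -> R[i] := fun m =>
  let E := midE l k x in let O := midO l k x in
  let c j := cR (cos (hphase l k j)) in let s j := cR (sin (hphase l k j)) in
  match fintype.split m with
  | inl m1 => match fintype.split m1 with
    | inl m2 => match fintype.split m2 with
      | inl j => E j * c j - O j * s j
      | inr j => E j * s j + O j * c j
      end
    | inr j => E j * c j + O j * s j
    end
  | inr j => E j * s j - O j * c j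
  end.

Lemma split_lshift m n (i : 'I_m) : fintype.split (lshift n i) = inl i.
Proof. exact: (unsplitK (inl i)). Qed.
Lemma split_rshift m n (i : 'I_n) : fintype.split (rshift m i) = inr i.
Proof. exact: (unsplitK (inr i)). Qed.

Lemma is_traceP l k x v : 0 < k -> is_trace l k x v <-> v =1 trace_vec l k x.
Proof.
move=> k0; split=> [[vA [vB vCD]] m|vE].
  rewrite /trace_vec; rewrite -[in LHS](splitK m).
  case: (fintype.split m) => [m1|j] /=.
    rewrite -[in LHS](splitK m1); case: (fintype.split m1) => [m2|j] /=.
      rewrite -[in LHS](splitK m2); case: (fintype.split m2) => [j|j] /=.
        by rewrite vA (coefA_mid l k).
      by rewrite vB (coefB_mid l k).
    have := vCD j (l 0 j); rewrite subrr mulr0 cos0 sin0 mulr1 mulr0 addr0.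
    by rewrite efun_end => ->.
  (* A quarter of a period before the end only the sine term survives; the point may lie outside the
     edge, as [is_trace] ranges over all real t. *)
  have := vCD j (l 0 j - pi / 2 / k).
  rewrite subKr (_ : k * (_ / k) = pi / 2); last by field; rewrite gt_eqF.
  rewrite cos_pihalf sin_pihalf mulr0 mulr1 add0r => <-.
  rewrite (efun_mid l) (_ : _ - hphase l k j = hphase l k j - pi / 2); last first.
    by rewrite /hphase; field; rewrite gt_eqF.
  by rewrite cosBpihalf sinBpihalf cRN mulrN.
rewrite /is_trace; split; [|split] => j.
- by rewrite vE /trace_vec !split_lshift (coefA_mid l k).
- by rewrite vE /trace_vec !split_lshift split_rshift (coefB_mid l k).
move=> t; rewrite !vE /trace_vec split_lshift !split_rshift (efun_mid l).
have -> : k * (l 0 j - t) = hphase l k j - (k * t - hphase l k j) by rewrite /hphase; field.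
move: (k * t - _) => u; rewrite cosB sinB !(cRD, cRN, cRM).
set c := cR (cos (hphase l k j)); set s := cR (sin (hphase l k j)).
have cs : c * c + s * s = 1 by exact: cR_cos2sin2.
rewrite -[X in X + _]mulr1 -[X in _ + X]mulr1 -cs; ring.
Qed.

Lemma trace_vecP l k x : 0 < k -> is_trace l k x (trace_vec l k x).
Proof. by move=> k0; apply/is_traceP. Qed.

Section Sign.
Variable anti : bool.

Definition psign : R := if anti then -1 else 1.
Definition pcos l k j : R := if anti then sin (hphase l k j) else cos (hphase l k j).
Definition psin l k j : R := if anti then cos (hphase l k j) else sin (hphase l k j).
(** The minus sign gives the anti-symmetric trace the shape of the symmetric one up to [psign], so
    that [mandarin_pt] serves both. *)
Definition pcoef l k x j : R[i] := if anti then - midO l k x j else midE l k x j.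

(* The point (exp(ikl), tr_k(f)) of an eigenfunction f of the given parity, up to a common
   factor of the trace, in terms of al_j : be_j = cos phi_j : sin phi_j (swapped for [anti]). *)
Definition mandarin_pt (al be : 'I_N -> R) (A T : 'I_N -> R[i]) :
    'I_(N + (N + N + N + N)) -> R[i] := fun i =>
  match fintype.split i with
  | inl j => (psign * (al j ^+ 2 - be j ^+ 2) / (al j ^+ 2 + be j ^+ 2) +i*
              (2 * al j * be j / (al j ^+ 2 + be j ^+ 2)))%C
  | inr m => match fintype.split m with
    | inl m1 => match fintype.split m1 with
      | inl m2 => match fintype.split m2 with
        | inl j => A j
        | inr j => cR psign * T j
        end
      | inr j => cR psign * A j
      end
    | inr j => T j
    end
  end.

Lemma pcos2psin2 l k j : pcos l k j ^+ 2 + psin l k j ^+ 2 = 1.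
Proof. by rewrite /pcos /psin; case: anti; rewrite ?cos2Dsin2 // addrC cos2Dsin2. Qed.

Lemma parity_pcoef l k x : 0 < k -> pos_lengths l -> has_parity anti l k x <->
  (if anti then forall j, midE l k x j = 0 else forall j, midO l k x j = 0).
Proof.
move=> k0 lp; rewrite /has_parity; case: anti.
  exact: antisymmetric_mid.
exact: symmetric_mid.
Qed.

Lemma expi_kl l k j : expi (k * l 0 j) =
  (psign * (pcos l k j ^+ 2 - psin l k j ^+ 2) +i* (2 * pcos l k j * psin l k j))%C.
Proof.
have -> : k * l 0 j = hphase l k j + hphase l k j by rewrite /hphase; field.
rewrite /expi cosD sinD /psign /pcos /psin; case: anti; apply: complex_eq => /=; ring.
Qed.

Lemma qpoint_parity l k x v : 0 < k -> pos_lengths l -> has_parity anti l k x ->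
  is_trace l k x v ->
  qpoint l k v =1 mandarin_pt (pcos l k) (psin l k)
     (fun j => pcoef l k x j * cR (pcos l k j))
     (fun j => pcoef l k x j * cR (psin l k j)).
Proof.
move=> k0 lp /(parity_pcoef _ k0 lp) hp /is_traceP -/(_ k0) vE i.
rewrite /qpoint /mandarin_pt; case: (fintype.split i) => [j|m].
  by rewrite expi_kl pcos2psin2 !divr1.
rewrite vE /trace_vec /pcoef /psign /pcos /psin; move: hp.
have cRN1 : cR (-1) = -1 :> R[i] by rewrite cRN cR1.
case: anti => hp; (case: (fintype.split m) => [m1|j]; first
  (case: (fintype.split m1) => [m2|j]; first case: (fintype.split m2) => j)); rewrite !hp ?cRN1 ?cR1; ring.
Qed.

(** The first block is the rational parametrisation of the unit circle by [be / al], the tangent or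
    cotangent of half the angle k l_j, and is homogeneous of degree 0. *)
Lemma mandarin_pt_ratio al be A T : (forall j, al j != 0) ->
  mandarin_pt al be A T =1 mandarin_pt (fun=> 1) (fun j => be j / al j) A T.
Proof.
move=> al0 i; rewrite /mandarin_pt; case: (fintype.split i) => [j|//].
have a0 := al0 j; have h : al j ^+ 2 + be j ^+ 2 != 0.
  by rewrite gt_eqF // ltr_pwDl ?sqr_ge0 // exprn_even_gt0.
have h' : 1 ^+ 2 + (be j / al j) ^+ 2 != 0.
  by rewrite gt_eqF // ltr_pwDl ?sqr_ge0 // expr1n.
have e : 1 ^+ 2 + (be j / al j) ^+ 2 = (al j ^+ 2 + be j ^+ 2) / al j ^+ 2 by field.
by apply: complex_eq => /=; rewrite e; field; rewrite a0 h.
Qed.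

End Sign.

Variable q : mpoly.mpoly (N + (N + N + N + N)) R[i].

(** A nonzero rescaling of an eigenfunction multiplies q by a nonzero power, so whether q vanishes
    does not depend on the amplitude. *)
Lemma meval_homog d : (forall m : mpoly.multinom (N + (N + N + N + N)), mpoly.mcoeff m q != 0 ->
    (\sum_(i < N + N + N + N) mpoly.fun_of_multinom m (rshift N i))%N = d) ->
  forall (p p' : 'I_(N + (N + N + N + N)) -> R[i]) (kap : R[i]),
  (forall j, p (lshift _ j) = p' (lshift _ j)) ->
  (forall m, p (rshift _ m) = kap * p' (rshift _ m)) ->
  mpoly.meval p q = kap ^+ d * mpoly.meval p' q.
Proof.
move=> hq p p' kap hl hr; rewrite !mpoly.mevalE mulr_sumr.
apply: eq_big_seq => m; rewrite mpoly.mcoeff_msupp => /hq md.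
rewrite [RHS]mulrCA; congr (_ * _).
rewrite big_split_ord [X in _ = _ * X]big_split_ord /= [RHS]mulrCA; congr (_ * _).
  by apply: eq_bigr => j _; rewrite hl.
under eq_bigr do rewrite hr exprMn.
by rewrite big_split /= prodrXr md.
Qed.

Lemma meval_mandarin_pt_scale anti : homog_in_trace q -> exists d, forall al be A T kap,
  mpoly.meval (mandarin_pt anti al be (fun j => kap * A j) (fun j => kap * T j)) q =
  kap ^+ d * mpoly.meval (mandarin_pt anti al be A T) q.
Proof.
move=> [d hd]; exists d => al be A T kap; apply: (meval_homog hd) => [j|m].
  by rewrite /mandarin_pt !split_lshift.
rewrite /mandarin_pt !split_rshift; case: (fintype.split m) => [m1|//].
by case: (fintype.split m1) => [m2|j]; [case: (fintype.split m2) => [//|j]|]; rewrite mulrCA.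
Qed.

End Parity.

(** * Multiplicity and the shape of eigenvectors *)

Section Multiplicity.
Variables (R : realType) (N : nat).
Implicit Types (l : 'rV[R]_N) (k : R) (x y : 'rV[R[i]]_(N + N)).

Lemma has_mult_ex l k : exists d, has_mult l k d.
Proof.
pose P d := `[<exists X : d.-tuple 'rV[R[i]]_(N + N),
      free X /\ forall x, x \in X -> vertex_conditions l k x>].
have P0 : exists d, P d.
  by exists 0%N; apply/asboolP; exists [tuple]; split; first exact: nil_free.
have Pb d : P d -> (d <= N + N)%N.
  move=> /asboolP[X [fX _]]; rewrite -(size_tuple X).
  have := dimvS (subvf <<X>>%VS); rewrite (eqP fX) dimvf /dim /=.
  by rewrite mul1n.
case: (ex_maxnP P0 Pb) => d /asboolP Pd maxd; exists d; split=> // X hX.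
apply/negP => fX; have : (d.+1 <= d)%N by apply: maxd; apply/asboolP; exists X.
by rewrite ltnn.
Qed.

Lemma mult_spec l k : has_mult l k (mult l k).
Proof. exact: (xgetPex 0%N (has_mult_ex l k)). Qed.

Lemma mult_le l k : (mult l k <= N + N)%N.
Proof.
have [[X [fX _]] _] := mult_spec l k; rewrite -(size_tuple X).
by have := dimvS (subvf <<X>>%VS); rewrite (eqP fX) dimvf /dim /= mul1n.
Qed.

Lemma free_pair (x y : 'rV[R[i]]_(N + N)) :
  free [:: x; y] <-> y != 0 /\ forall c, x <> c *: y.
Proof.
rewrite free_cons seq1_free span_seq1; split.
  move=> /andP[xy y0]; split=> // c xE; move/negP: xy; apply.
  by apply/vlineP; exists c.
move=> [y0 xy]; rewrite y0 andbT; apply/negP => /vlineP[c].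
exact: xy.
Qed.

Lemma mult_eq0 l k : mult l k != 0%N -> exists2 x, x != 0 & vertex_conditions l k x.
Proof.
move=> m0; have [[X [fX hX]] _] := mult_spec l k.
case: X fX hX; case: (mult l k) m0 => // d _ [|x X] //= sX fX hX.
exists x; last by apply: hX; rewrite inE eqxx.
by apply: (free_not0 fX); rewrite inE eqxx.
Qed.

Lemma mult_gt0 l k x : x != 0 -> vertex_conditions l k x -> (0 < mult l k)%N.
Proof.
move=> x0 Vx; rewrite lt0n; apply/negP => /eqP m0.
have [_] := mult_spec l k; rewrite m0 => /(_ [tuple x]) H.
have /H : forall y, y \in [tuple x] -> vertex_conditions l k y.
  by move=> y; rewrite inE => /eqP ->.
by rewrite seq1_free x0.
Qed.

Lemma nonsimpleP l k x : x != 0 -> vertex_conditions l k x ->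
  ~ simple_eigenvalue l k <-> exists x y,
  [/\ vertex_conditions l k x, vertex_conditions l k y & free [:: x; y]].
Proof.
move=> x0 Vx; split; last first.
  move=> [y [z [Vy Vz fyz]]] /= s1; have [_] := mult_spec l k.
  rewrite s1 => /(_ [tuple y; z]) H.
  have /H : forall w, w \in [tuple y; z] -> vertex_conditions l k w.
    by move=> w; rewrite !inE => /orP[] /eqP ->.
  by rewrite fyz.
move=> ns; have m0 := mult_gt0 x0 Vx.
have [[X [fX hX]] _] := mult_spec l k.
have m2 : (1 < mult l k)%N.
  by rewrite ltn_neqAle m0 andbT eq_sym; apply/eqP.
case: X fX hX; case: (mult l k) m2 => [//|[//|d]] _ [|y [|z X]] //= sX fX hX.
exists y, z; split; [apply: hX|apply: hX|]; rewrite ?inE ?eqxx ?orbT //.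
by apply: (@catl_free _ _ X); exact: fX.
Qed.

End Multiplicity.

Section UStructure.
Variables (R : realType) (N : nat).
Implicit Types (a b : 'I_N -> R) (F : 'I_N -> R[i]).

(** If a_j = 0, continuity gives F_i a_i = 0 for all i, hence F_i = 0 for i != j, and the Kirchhoff
    sum leaves F_j b_j = 0 with b_j^2 = 1; so F would vanish. Otherwise F_j a_j is a constant kap,
    and the Kirchhoff sum is kap times the sum of the b_j / a_j. *)
Lemma inU_structure a b F : (forall j, a j ^+ 2 + b j ^+ 2 = 1) ->
  (forall i j, i != j -> ~ (a i = 0 /\ a j = 0)) -> inU a b F ->
  (exists j, F j != 0) ->
  [/\ forall j, a j != 0, \sum_j b j / a j = 0 &
      exists2 kap, kap != 0 & forall j, F j = kap / cR (a j)].
Proof.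
move=> ab nd [Fa Fb] [j0 Fj0].
have a0 j : a j != 0.
  apply/eqP => aj; have Fi i : i != j -> F i = 0.
    move=> ij; have /eqP := Fa i j; rewrite aj cR0 mulr0 mulf_eq0 cR_eq0.
    by case/orP => /eqP // ai; case: (nd i j ij).
  move/eqP: Fb; rewrite (bigD1 j) //= big1 ?addr0; last first.
    by move=> i ij; rewrite Fi // mul0r.
  rewrite mulf_eq0 cR_eq0 => /orP[/eqP Fj|/eqP bj].
    by move/eqP: Fj0; have [->|/Fi] := eqVneq j0 j.
  by have := ab j; rewrite aj bj expr0n /= addr0 => /eqP; rewrite eq_sym oner_eq0.
have a0' j : cR (a j) != 0 by rewrite cR_eq0.
pose kap := F j0 * cR (a j0).
have FE j : F j = kap / cR (a j) by rewrite /kap -(Fa j j0) mulfK.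
have k0 : kap != 0 by rewrite mulf_neq0.
split=> //; last by exists kap.
apply/eqP; rewrite -cR_eq0 cR_sum -(mulrI_eq0 _ (mulfI k0)) mulr_sumr; apply/eqP.
rewrite -[RHS]Fb; apply: eq_bigr => j _; rewrite FE cRM cRV; ring.
Qed.

Lemma inU_inv a b : (forall j, a j != 0) -> \sum_j b j / a j = 0 ->
  inU a b (fun j => (cR (a j))^-1).
Proof.
move=> a0 s0; have a0' j : cR (a j) != 0 by rewrite cR_eq0.
split=> [i j|]; first by rewrite !mulVf.
by rewrite -[RHS](cR0) -s0 cR_sum; apply: eq_bigr => j _; rewrite cRM cRV mulrC.
Qed.

End UStructure.

Section BadStructure.
Variables (R : realType) (N : nat) (anti : bool).
Variable q : mpoly.mpoly (N + (N + N + N + N)) R[i].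
Implicit Types (l : 'rV[R]_N) (k : R) (x y : 'rV[R[i]]_(N + N)).

Definition no_double l k := forall i j : 'I_N, i != j ->
  ~ (cos (hphase l k i) = 0 /\ cos (hphase l k j) = 0) /\
  ~ (sin (hphase l k i) = 0 /\ sin (hphase l k j) = 0).

Definition ptan (anti : bool) l k (j : 'I_N) : R := psin anti l k j / pcos anti l k j.

(* esymN1 is e_{N-1}; for nonzero t it vanishes iff sum_j 1 / t_j = 0, the condition for an
   eigenvalue of the other parity. *)
Definition esymN1 (t : 'I_N -> R) : R := \sum_j \prod_(i | i != j) t i.

Definition Qfun (t : 'I_N -> R) : R[i] :=
  mpoly.meval (mandarin_pt anti (fun=> 1) t (fun=> 1) (fun j => cR (t j))) q.

Lemma no_double_pcos (anti' : bool) l k : no_double l k ->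
  forall i j, i != j -> ~ (pcos anti' l k i = 0 /\ pcos anti' l k j = 0).
Proof. by move=> nd i j /nd[h1 h2]; rewrite /pcos; case: anti'. Qed.

Lemma midEZ l k (c : R[i]) x j : midE l k (c *: x) j = c * midE l k x j.
Proof. by rewrite /midE /coefA /coefB !mxE; ring. Qed.
Lemma midOZ l k (c : R[i]) x j : midO l k (c *: x) j = c * midO l k x j.
Proof. by rewrite /midO /coefA /coefB !mxE; ring. Qed.

Lemma mid_neq0 l k x : x != 0 ->
  (exists j, midE l k x j != 0) \/ (exists j, midO l k x j != 0).
Proof.
move=> x0; apply: contrapT => /not_orP[hE hO].
move/eqP: x0; apply; apply: (@mid_eqP _ _ l k) => j.
  rewrite -(scale0r x) midEZ mul0r; apply/eqP/negP => /negP h; apply: hE; by exists j.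
rewrite -(scale0r x) midOZ mul0r; apply/eqP/negP => /negP h; apply: hO; by exists j.
Qed.

Lemma pcoefZ (anti' : bool) l k (c : R[i]) x j :
  pcoef anti' l k (c *: x) j = c * pcoef anti' l k x j.
Proof. by rewrite /pcoef; case: anti'; rewrite ?midEZ ?midOZ ?mulrN. Qed.

Lemma vertex_conditions_pcoef (anti' : bool) l k x : 0 < k ->
  vertex_conditions l k x -> inU (pcos anti' l k) (psin anti' l k) (pcoef anti' l k x).
Proof.
move=> k0 /(vertex_conditions_mid l x k0)[hE hO]; rewrite /pcos /psin /pcoef.
case: anti' => //; split=> [i j|].
  by rewrite !mulNr (hO.1 i j).
by under eq_bigr do rewrite mulNr; rewrite sumrN hO.2 oppr0.
Qed.

Lemma pcoef_neq0 l k x : x != 0 ->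
  exists anti', exists j, pcoef anti' l k x j != 0.
Proof.
move=> /(mid_neq0 l k)[[j h]|[j h]]; [exists false|exists true]; exists j => //.
by rewrite /pcoef oppr_eq0.
Qed.

Lemma eigen_structure l k x : 0 < k -> no_double l k -> x != 0 ->
  vertex_conditions l k x ->
  exists anti', (forall j, pcos anti' l k j != 0) /\ \sum_j ptan anti' l k j = 0.
Proof.
move=> k0 nd x0 Vx; have [anti' hj] := pcoef_neq0 l k x0; exists anti'.
have [] := inU_structure (pcos2psin2 anti' l k) (no_double_pcos (anti' := anti') nd)
  (vertex_conditions_pcoef anti' k0 Vx) hj.
by [].
Qed.

(** Each parity admits at most one eigenvector up to scalars. Two independent eigenvectors cannot
    both belong to the other parity, so some eigenvector has a nonzero part of parity [anti']. *)
Lemma nonsimple_structure l k x y (anti' : bool) : 0 < k -> no_double l k ->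
  vertex_conditions l k x -> vertex_conditions l k y -> free [:: x; y] ->
  (forall j, pcos anti' l k j != 0) /\ \sum_j ptan anti' l k j = 0.
Proof.
move=> k0 nd Vx Vy /free_pair[y0 xy].
suff [z Vz hz] : exists2 z, vertex_conditions l k z & exists j, pcoef anti' l k z j != 0.
  by have [] := inU_structure (pcos2psin2 anti' l k) (no_double_pcos (anti' := anti') nd)
  (vertex_conditions_pcoef anti' k0 Vz) hz.
apply: contrapT => H.
have H0 z j : vertex_conditions l k z -> pcoef anti' l k z j = 0.
  by move=> Vz; apply/eqP/negP => /negP h; apply: H; exists z => //; exists j.
have x0 : x != 0 by apply/eqP => x0; apply: (xy 0); rewrite scale0r.
have nz z : z != 0 -> vertex_conditions l k z -> exists j, pcoef (~~ anti') l k z j != 0.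
  move=> z0 Vz; have [b [j hj]] := pcoef_neq0 l k z0.
  have [bE|bE] := eqVneq b anti'; first by rewrite bE H0 ?eqxx in hj.
  by exists j; move: hj; rewrite (_ : b = ~~ anti') //; move: bE; case: b; case: (anti').
have [a0 _ [kx kx0 hx]] := inU_structure (pcos2psin2 (~~ anti') l k) (no_double_pcos (anti' := ~~ anti') nd)
  (vertex_conditions_pcoef (~~ anti') k0 Vx) (nz _ x0 Vx).
have [_ _ [ky ky0 hy]] := inU_structure (pcos2psin2 (~~ anti') l k) (no_double_pcos (anti' := ~~ anti') nd)
  (vertex_conditions_pcoef (~~ anti') k0 Vy) (nz _ y0 Vy).
have hb b j : pcoef b l k x j = pcoef b l k (kx / ky *: y) j.
  rewrite pcoefZ; have [->|bE] := eqVneq b anti'; first by rewrite !H0 // mulr0.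
  have -> : b = ~~ anti' by move: bE; case: b; case: (anti').
  by rewrite hx hy mulrA divfK.
apply: (xy (kx / ky)); apply: (@mid_eqP _ _ l k) => j.
  exact: (hb false j).
by apply: oppr_inj; exact: (hb true j).
Qed.

Lemma ptan_not l k j : ptan (~~ anti) l k j = (ptan anti l k j)^-1.
Proof. by rewrite /ptan /psin /pcos; case: anti; rewrite /= invf_div. Qed.

Lemma esym_inv (t : 'I_N -> R) : (forall j, t j != 0) ->
  esymN1 t = (\prod_j t j) * \sum_j (t j)^-1.
Proof.
move=> t0; rewrite mulr_sumr; apply: eq_bigr => j _.
by rewrite [in RHS](bigD1 j) //= mulrAC mulfV ?mul1r.
Qed.

(** Dividing the trace by the common amplitude kap leaves 1 and t_j in the places of [A] and [T]. *)
Lemma Qfun_pcoef l k x v : 0 < k -> pos_lengths l -> homog_in_trace q ->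
  has_parity anti l k x -> is_trace l k x v ->
  (forall j, pcos anti l k j != 0) ->
  (exists2 kap, kap != 0 & forall j, pcoef anti l k x j = kap / cR (pcos anti l k j)) ->
  (qeval q l k v == 0) = (Qfun (ptan anti l k) == 0).
Proof.
move=> k0 lp hq px tx a0 [kap kap0 hx].
have [d hd] := meval_mandarin_pt_scale anti hq.
rewrite /qeval (mpoly.meval_eq (v2 := mandarin_pt anti (fun=> 1) (ptan anti l k)
  (fun=> kap * 1) (fun j => kap * cR (ptan anti l k j)))).
  by rewrite hd mulf_eq0 expf_eq0 (negbTE kap0) andbF.
move=> i; rewrite (qpoint_parity k0 lp px tx) (mandarin_pt_ratio _ _ _ _ a0).
have a0' j : cR (pcos anti l k j) != 0 by rewrite cR_eq0.
congr mandarin_pt; apply/funext => j; rewrite hx; first by rewrite divfK ?mulr1.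
by rewrite /ptan cRM cRV mulrA mulrAC.
Qed.

Lemma bad_structure l k x : 0 < k -> pos_lengths l -> no_double l k ->
  homog_in_trace q -> eigenpair l k x -> ~ propP anti q l k x ->
  [/\ forall j, pcos anti l k j != 0, \sum_j ptan anti l k j = 0 &
      esymN1 (ptan anti l k) = 0 \/ Qfun (ptan anti l k) = 0].
Proof.
move=> k0 lp nd hq [_ [x0 Vx]] /not_andP[/(nonsimpleP x0 Vx)[y [z [Vy Vz fyz]]]|].
  have [a0 s0] := nonsimple_structure anti k0 nd Vy Vz fyz.
  have [b0 r0] := nonsimple_structure (~~ anti) k0 nd Vy Vz fyz.
  split=> //; left; rewrite esym_inv.
    rewrite [X in _ * X](eq_bigr (ptan (~~ anti) l k)) ?r0 ?mulr0 // => j _.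
    by rewrite ptan_not.
  move=> j; rewrite /ptan mulf_neq0 ?invr_eq0 //.
  by have := b0 j; rewrite /pcos /psin; case: anti.
move=> /not_implyP[px /existsNP[v /not_implyP[tx /negP]]]; rewrite negbK => qv.
have hz : exists j, pcoef anti l k x j != 0.
  have /(parity_pcoef anti _ k0 lp) := px; case: (mid_neq0 l k x0) => -[j hj];
    rewrite /pcoef; case: anti => h; exists j; rewrite ?oppr_eq0 //;
    by move: hj; rewrite h eqxx.
have [a0 s0 hk] := inU_structure (pcos2psin2 anti l k) (no_double_pcos (anti' := anti) nd)
  (vertex_conditions_pcoef anti k0 Vx) hz.
split=> //; right; apply/eqP; rewrite -(Qfun_pcoef k0 lp hq px tx a0) //.
Qed.

End BadStructure.

(** * The polynomial Q does not vanish on the hyperplane *)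

Section ContinuousAt0.
Variable R : realType.
Implicit Types f g : R -> R.

Definition cont0 f := f @ 0 --> f 0.

Lemma cont0_cst c : cont0 (fun=> c).
Proof. exact: cvg_cst. Qed.
Lemma cont0_id : cont0 id.
Proof. exact: cvg_id. Qed.
Lemma cont0D f g : cont0 f -> cont0 g -> cont0 (fun w => f w + g w).
Proof. exact: cvgD. Qed.
Lemma cont0N f : cont0 f -> cont0 (fun w => - f w).
Proof. exact: cvgN. Qed.
Lemma cont0M f g : cont0 f -> cont0 g -> cont0 (fun w => f w * g w).
Proof. exact: cvgM. Qed.
Lemma cont0V f : f 0 != 0 -> cont0 f -> cont0 (fun w => (f w)^-1).
Proof. by move=> f0 cf; exact: cvgV. Qed.

Definition ccont0 (f : R -> R[i]) :=
  cont0 (fun w => complex.Re (f w)) /\ cont0 (fun w => complex.Im (f w)).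

Lemma ccont0_eq (f g : R -> R[i]) : f =1 g -> ccont0 f -> ccont0 g.
Proof. by move=> /funext ->. Qed.
Lemma ccont0_cst c : ccont0 (fun=> c).
Proof. by split; exact: cont0_cst. Qed.
Lemma ccont0D (f g : R -> R[i]) : ccont0 f -> ccont0 g -> ccont0 (fun w => f w + g w).
Proof.
move=> [fr fi] [gr gi]; split.
  rewrite (_ : (fun w => _) = (fun w => complex.Re (f w) + complex.Re (g w))).
    exact: cont0D.
  by apply/funext => w; rewrite ReD.
rewrite (_ : (fun w => _) = (fun w => complex.Im (f w) + complex.Im (g w))).
  exact: cont0D.
by apply/funext => w; rewrite ImD.
Qed.
Lemma ccont0M (f g : R -> R[i]) : ccont0 f -> ccont0 g -> ccont0 (fun w => f w * g w).
Proof.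
move=> [fr fi] [gr gi]; split.
  rewrite (_ : (fun w => _) = (fun w => complex.Re (f w) * complex.Re (g w) +
                                - (complex.Im (f w) * complex.Im (g w)))).
    by apply: cont0D; [|apply: cont0N]; exact: cont0M.
  by apply/funext => w; rewrite ReM.
rewrite (_ : (fun w => _) = (fun w => complex.Re (f w) * complex.Im (g w) +
                                complex.Im (f w) * complex.Re (g w))).
  by apply: cont0D; exact: cont0M.
by apply/funext => w; rewrite ImM.
Qed.
Lemma ccont0_real f : cont0 f -> ccont0 (fun w => cR (f w)).
Proof. by move=> cf; split=> //; exact: cont0_cst. Qed.

Lemma ccont0_meval n (p : mpoly.mpoly n R[i]) (v : R -> 'I_n -> R[i]) :
  (forall i, ccont0 (fun w => v w i)) -> ccont0 (fun w => mpoly.meval (v w) p).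
Proof.
move=> cv; apply: (@ccont0_eq (fun w => \sum_(m <- mpoly.msupp p)
  mpoly.mcoeff m p * \prod_i v w i ^+ mpoly.fun_of_multinom m i)).
  by move=> w; rewrite mpoly.mevalE.
elim: (mpoly.msupp p) => [|m s IHs].
  by apply: (@ccont0_eq (fun=> 0)) (ccont0_cst 0) => w; rewrite big_nil.
apply: ccont0_eq; first by move=> w; rewrite big_cons.
apply: ccont0D IHs; apply: ccont0M; first exact: ccont0_cst.
elim: (index_enum _) => [|i r IHr].
  by apply: (@ccont0_eq (fun=> 1)) (ccont0_cst 1) => w; rewrite big_nil.
apply: ccont0_eq; first by move=> w; rewrite big_cons.
apply: ccont0M IHr; elim: (mpoly.fun_of_multinom m i) => [|e IHe].
  exact: (ccont0_cst 1).
apply: ccont0_eq; first by move=> w; rewrite exprS.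
exact: ccont0M.
Qed.

Lemma ccont0_neq0 (f : R -> R[i]) : ccont0 f -> f 0 != 0 -> exists2 w, w != 0 & f w != 0.
Proof.
move=> [fr fi] f0.
have H (h : R -> R) : cont0 h -> h 0 != 0 -> exists2 w, w != 0 & h w != 0.
  move=> ch h0; have h0' : 0 < `|h 0| by rewrite normr_gt0.
  have /cvgrPdist_lt/(_ _ h0')/nbhs_normP[r /= r0 hr] := ch.
  exists (r / 2); first by rewrite gt_eqF // divr_gt0.
  have : `|h 0 - h (r / 2)| < `|h 0|.
    by apply: hr; rewrite /ball_ /= sub0r normrN gtr0_norm ?divr_gt0 //; lra.
  by apply: contraTneq => ->; rewrite subr0 ltxx.
have [Re0|Re0] := eqVneq (complex.Re (f 0)) 0; last first.
  have [w w0 hw] := H _ fr Re0; exists w => //.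
  by apply: contraNneq hw => ->.
have Im0 : complex.Im (f 0) != 0.
  by apply: contraNneq f0 => Im0; apply/eqP/complex_eq.
have [w w0 hw] := H _ fi Im0; exists w => //.
by apply: contraNneq hw => ->.
Qed.

End ContinuousAt0.

Section Witness.
Variables (R : realType) (N : nat) (anti : bool).
Variable q : mpoly.mpoly (N + (N + N + N + N)) R[i].
Implicit Types (l : 'rV[R]_N) (k : R) (x y : 'rV[R[i]]_(N + N)).

Definition of_pcoef l k (F : 'I_N -> R[i]) : 'rV[R[i]]_(N + N) :=
  if anti then of_mid l k (fun=> 0) (fun j => - F j) else of_mid l k F (fun=> 0).

Lemma pcoef_of_pcoef l k F j : pcoef anti l k (of_pcoef l k F) j = F j.
Proof.
rewrite /pcoef /of_pcoef; case: anti; first by rewrite midO_of_mid opprK.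
by rewrite midE_of_mid.
Qed.

Lemma vertex_conditions_of_pcoef l k F : 0 < k ->
  inU (pcos anti l k) (psin anti l k) F -> vertex_conditions l k (of_pcoef l k F).
Proof.
move=> k0 [h1 h2]; apply/vertex_conditions_mid => //.
move: h1 h2; rewrite /of_pcoef /pcos /psin; case: anti => h1 h2; split; split.
- by move=> i j; rewrite !midE_of_mid !mul0r.
- by rewrite big1 // => j _; rewrite midE_of_mid mul0r.
- by move=> i j; rewrite !midO_of_mid !mulNr (h1 i j).
- under eq_bigr do rewrite midO_of_mid mulNr.
  by rewrite sumrN h2 oppr0.
- by move=> i j; rewrite !midE_of_mid (h1 i j).
- by rewrite -[RHS]h2; apply: eq_bigr => j _; rewrite midE_of_mid.
- by move=> i j; rewrite !midO_of_mid !mul0r.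
- by rewrite big1 // => j _; rewrite midO_of_mid mul0r.
Qed.

(** Two poles carry an eigenvector supported on their two edges; three poles give two independent
    ones. *)
Lemma three_zeros_nonsimple l k x (i j r : 'I_N) : 0 < k -> x != 0 ->
  vertex_conditions l k x -> i != j -> i != r -> j != r ->
  pcos anti l k i = 0 -> pcos anti l k j = 0 -> pcos anti l k r = 0 ->
  ~ simple_eigenvalue l k.
Proof.
move=> k0 x0 Vx ij ir jr ai aj ar; apply/(nonsimpleP x0 Vx).
have bn s : pcos anti l k s = 0 -> psin anti l k s ^+ 2 = 1.
  by move=> as0; rewrite -(pcos2psin2 anti l k s) as0 expr0n add0r.
pose F (u v : 'I_N) (s : 'I_N) : R[i] := cR (if s == u then psin anti l k u
   else if s == v then - psin anti l k v else 0).
have FU u v : u != v -> pcos anti l k u = 0 -> pcos anti l k v = 0 ->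
    vertex_conditions l k (of_pcoef l k (F u v)).
  move=> uv au av; apply: vertex_conditions_of_pcoef => //.
  have F0 s : F u v s * cR (pcos anti l k s) = 0.
    rewrite /F -cRM; case: eqP => [->|_]; first by rewrite au mulr0.
    by case: eqP => [->|_]; rewrite ?av ?mulr0 ?mul0r.
  split=> [s s'|]; first by rewrite !F0.
  rewrite (bigD1 u) //= (bigD1 v) 1?eq_sym //= big1.
    rewrite addr0 /F eqxx eq_sym (negbTE uv) eqxx -!cRM -cRD mulNr -!expr2 !bn //.
    by rewrite subrr.
  by move=> s /andP[su sv]; rewrite /F (negbTE su) (negbTE sv) mul0r.
exists (of_pcoef l k (F i j)), (of_pcoef l k (F i r)); split; [exact: FU|exact: FU|].
have bn0 s : pcos anti l k s = 0 -> psin anti l k s != 0.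
  by move=> /bn; apply: contra_eqN => /eqP ->; rewrite expr0n eq_sym oner_eq0.
apply/free_pair; split.
  apply/eqP => E; have := pcoef_of_pcoef l k (F i r) i; rewrite E /F eqxx.
  rewrite -(scale0r 0) pcoefZ mul0r => /eqP; rewrite eq_sym cR_eq0.
  by apply/negP; exact: bn0.
move=> c E; have := pcoef_of_pcoef l k (F i j) j; rewrite E pcoefZ pcoef_of_pcoef /F.
rewrite eq_sym (negbTE ij) (negbTE jr) eqxx mulr0 => /eqP; rewrite eq_sym cR_eq0 oppr_eq0.
by apply/negP; exact: bn0.
Qed.

Lemma mandarin_pt_cont0 (al be : R -> 'I_N -> R) (A T : R -> 'I_N -> R[i]) :
  (forall j, cont0 (fun w => al w j)) -> (forall j, cont0 (fun w => be w j)) ->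
  (forall j, al 0 j ^+ 2 + be 0 j ^+ 2 != 0) ->
  (forall j, ccont0 (fun w => A w j)) -> (forall j, ccont0 (fun w => T w j)) ->
  forall i, ccont0 (fun w => mandarin_pt anti (al w) (be w) (A w) (T w) i).
Proof.
move=> cal cbe n0 cA cT i; rewrite /mandarin_pt; case: (fintype.split i) => [j|m].
  have hd : cont0 (fun w => (al w j ^+ 2 + be w j ^+ 2)^-1).
    apply: (@cont0V R (fun w => al w j ^+ 2 + be w j ^+ 2)) => //.
    by apply: cont0D; apply: cont0M.
  split; apply: cont0M => //; apply: cont0M => //.
  - exact: cont0_cst.
  - by apply: cont0D; [|apply: cont0N]; exact: cont0M.
  - by apply: cont0M => //; exact: cont0_cst.
case: (fintype.split m) => [m1|j] //; case: (fintype.split m1) => [m2|j].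
  case: (fintype.split m2) => [//|j].
  by apply: ccont0M => //; exact: ccont0_cst.
by apply: ccont0M => //; exact: ccont0_cst.
Qed.

(** If every t_j is finite, t itself is the witness. Otherwise exactly two edges i, j have a pole:
    one alone would force f = 0, and three contradict simplicity. Then f lives on these two edges
    and is a limit, as w tends to 0, of points with t_i = 1 / w, t_j = -1 / w - tau and the other
    t_r kept. With the trace rescaled by w, the value of q is continuous at w = 0, hence nonzero for
    some w != 0. *)
Lemma witness_Qfun l k x v : pos_lengths l -> eigenpair l k x ->
  simple_eigenvalue l k -> homog_in_trace q -> has_parity anti l k x ->
  is_trace l k x v -> qeval q l k v != 0 ->
  exists2 t : 'I_N -> R, \sum_j t j = 0 & Qfun anti q t != 0.
Proof.
move=> lp [k0 [x0 Vx]] sk hq px tx qv.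
have FU := vertex_conditions_pcoef anti k0 Vx.
have [j0 Fj0] : exists j, pcoef anti l k x j != 0.
  have /(parity_pcoef anti _ k0 lp) := px; case: (mid_neq0 l k x0) => -[j hj];
    rewrite /pcoef; case: anti => h; exists j; rewrite ?oppr_eq0 //;
    by move: hj; rewrite h eqxx.
have [a0|/existsNP[i /negP]] := pselect (forall j, pcos anti l k j != 0).
  have nd i j : i != j -> ~ (pcos anti l k i = 0 /\ pcos anti l k j = 0).
    by move=> _ [ai _]; have := a0 i; rewrite ai eqxx.
  have [_ s0 hk] := inU_structure (pcos2psin2 anti l k) nd FU (ex_intro _ j0 Fj0).
  by exists (ptan anti l k) => //; rewrite -(Qfun_pcoef k0 lp hq px tx a0 hk).
rewrite negbK => /eqP ai; have [Fa Fb] := FU.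
have F0 r : pcoef anti l k x r * cR (pcos anti l k r) = 0.
  by rewrite (Fa r i) ai cR0 mulr0.
have Fr r : pcos anti l k r != 0 -> pcoef anti l k x r = 0.
  by move=> ar; have /eqP := F0 r; rewrite mulf_eq0 cR_eq0 (negbTE ar) orbF => /eqP.
have bn s : pcos anti l k s = 0 -> psin anti l k s ^+ 2 = 1.
  by move=> as0; rewrite -(pcos2psin2 anti l k s) as0 expr0n add0r.
have bn0 s : pcos anti l k s = 0 -> psin anti l k s != 0.
  by move=> /bn; apply: contra_eqN => /eqP ->; rewrite expr0n eq_sym oner_eq0.
have [j ij aj] : exists2 j, i != j & pcos anti l k j = 0.
  apply: contrapT => H; have a0 r : r != i -> pcos anti l k r != 0.
    by move=> ri; apply/eqP => ar; apply: H; exists r => //; rewrite eq_sym.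
  move/eqP: Fb; rewrite (bigD1 i) //= big1 ?addr0; last first.
    by move=> r ri; rewrite Fr ?mul0r // a0.
  rewrite mulf_eq0 cR_eq0 (negbTE (bn0 i ai)) orbF => /eqP Fi.
  move: Fj0; have [->|/a0/Fr ->] := eqVneq j0 i; by rewrite ?Fi eqxx.
have ar r : r != i -> r != j -> pcos anti l k r != 0.
  move=> ri rj; apply/eqP => ar.
  by apply: (@three_zeros_nonsimple l k x i j r) => //; rewrite eq_sym.
have Fij : pcoef anti l k x i * cR (psin anti l k i) = - (pcoef anti l k x j * cR (psin anti l k j)).
  apply/eqP; rewrite -subr_eq0 opprK; apply/eqP; rewrite -[RHS]Fb.
  rewrite [RHS](bigD1 i) //= (bigD1 j) 1?eq_sym //= big1 ?addr0 //.
  by move=> r /andP[ri rj]; rewrite Fr ?mul0r // ar.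
set kap := pcoef anti l k x i * cR (psin anti l k i).
have kap0 : kap != 0.
  apply/eqP => kE; move: Fj0; suff -> : pcoef anti l k x j0 = 0 by rewrite eqxx.
  have [->|ji] := eqVneq j0 i.
    by apply/eqP; move/eqP: kE; rewrite mulf_eq0 cR_eq0 (negbTE (bn0 i ai)) orbF.
  have [->|jj] := eqVneq j0 j; last by apply: Fr; exact: ar.
  apply/eqP; move/eqP: kE; rewrite /kap Fij oppr_eq0 mulf_eq0 cR_eq0.
  by rewrite (negbTE (bn0 j aj)) orbF.
pose tau := \sum_(r | (r != i) && (r != j)) ptan anti l k r.
(* A curve of admissible t escaping to infinity; w = 1 / t_i. *)
pose al w r := if r == i then w else if r == j then w else pcos anti l k r.
pose be w r := if r == i then 1 else if r == j then - (1 + w * tau) else psin anti l k r.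
pose T w r := cR (if r == i then 1 else if r == j then - (1 + w * tau) else w * ptan anti l k r).
pose f w := mpoly.meval (mandarin_pt anti (al w) (be w) (fun=> cR w) (T w)) q.
have [d hd] := meval_mandarin_pt_scale anti hq.
(* At w = 0 the point is that of the given eigenfunction, its trace divided by kap. *)
have f0 : f 0 != 0.
  move: qv; rewrite /qeval (mpoly.meval_eq (v2 := mandarin_pt anti (al 0) (be 0)
    (fun=> kap * cR 0) (fun r => kap * T 0 r))).
    by rewrite hd mulf_eq0 negb_or => /andP[].
  move=> u; rewrite (qpoint_parity k0 lp px tx) /mandarin_pt.
  case: (fintype.split u) => [r|m].
    rewrite /al /be; case: eqP => [->|_].
      by rewrite ai !bn // !(expr0n, expr1n) /= !(mulr0, mul0r, mulr1).
    case: eqP => [->|_] //.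
    by rewrite aj !bn // !mul0r addr0 sqrrN !(expr0n, expr1n) /= !(mulr0, mul0r, mulr1).
  have TE r : pcoef anti l k x r * cR (psin anti l k r) = kap * T 0 r.
    rewrite /T; case: eqP => [->|/eqP ri]; first by rewrite cR1 mulr1.
    case: eqP => [->|/eqP rj].
      by rewrite mul0r addr0 cRN cR1 mulrN1 /kap Fij opprK.
    by rewrite Fr ?ar // !mul0r cR0 mulr0.
  have AE r : pcoef anti l k x r * cR (pcos anti l k r) = kap * cR 0.
    by rewrite F0 cR0 mulr0.
  case: (fintype.split m) => [m1|r] //; case: (fintype.split m1) => [m2|r].
    by case: (fintype.split m2) => [r|r]; rewrite ?AE ?TE.
  by rewrite AE.
have cf : ccont0 f.
  apply: ccont0_meval; apply: mandarin_pt_cont0.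
  - move=> r; rewrite /al; case: eqP => _; first exact: cont0_id.
    by case: eqP => _; [exact: cont0_id|exact: cont0_cst].
  - move=> r; rewrite /be; case: eqP => _; first exact: cont0_cst.
    case: eqP => _; last exact: cont0_cst.
    apply: cont0N; apply: cont0D; first exact: cont0_cst.
    by apply: cont0M; [exact: cont0_id|exact: cont0_cst].
  - move=> r; rewrite /al /be; case: (r =P i) => _.
      by rewrite expr0n expr1n add0r oner_eq0.
    case: (r =P j) => _; last by rewrite pcos2psin2 oner_eq0.
    by rewrite mul0r addr0 expr0n sqrrN expr1n add0r oner_eq0.
  - by move=> r; apply: ccont0_real; exact: cont0_id.
  - move=> r; apply: ccont0_real; case: eqP => _; first exact: cont0_cst.
    case: eqP => _.
      apply: cont0N; apply: cont0D; first exact: cont0_cst.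
      by apply: cont0M; [exact: cont0_id|exact: cont0_cst].
    by apply: cont0M; [exact: cont0_id|exact: cont0_cst].
have [w w0 fw] := ccont0_neq0 cf f0.
have alw r : al w r != 0.
  by rewrite /al; case: (r =P i) => // /eqP ri; case: (r =P j) => // /eqP rj; exact: ar.
exists (fun r => be w r / al w r).
  rewrite (bigD1 i) //= (bigD1 j) 1?eq_sym //= {1 2}/be {1 2}/al eqxx eq_sym (negbTE ij) eqxx.
  rewrite (eq_bigr (ptan anti l k)); last first.
    by move=> r /andP[ri rj]; rewrite /be /al (negbTE ri) (negbTE rj).
  by rewrite -/tau; field.
apply: contraNneq fw => Q0; rewrite /f.
rewrite (mpoly.meval_eq (v2 := mandarin_pt anti (fun=> 1) (fun r => be w r / al w r)
  (fun=> cR w * 1) (fun r => cR w * cR (be w r / al w r)))).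
  by rewrite hd [X in _ * X]Q0 mulr0.
move=> u; rewrite (mandarin_pt_ratio _ _ _ _ alw); congr mandarin_pt.
  by apply/funext => r; rewrite mulr1.
apply/funext => r; rewrite -cRM /T /be /al; congr cR; case: (r =P i) => _; first by field.
by case: (r =P j) => _; first by field.
Qed.

End Witness.

(** * Polynomial equations on the hyperplane *)

Section PolyFractions.
Variables (R : realType) (n : nat).
Implicit Types (f g : (nat -> R) -> R[i]).

(** A common denominator without real zeros accommodates the factors 1 + t_j^2 in the first block of
    [mandarin_pt]. *)
Definition polyfrac f := exists h g1 g2 : (nat -> R) -> R,
  [/\ polyfun n h, polyfun n g1, polyfun n g2, forall x, h x != 0 &
   forall x, complex.Re (f x) * h x = g1 x /\ complex.Im (f x) * h x = g2 x].

Lemma polyfrac_ext f g : f =1 g -> polyfrac f -> polyfrac g.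
Proof. by move=> /funext ->. Qed.

Lemma polyfrac_cst c : polyfrac (fun=> c).
Proof.
exists (fun=> 1), (fun=> complex.Re c), (fun=> complex.Im c).
by split; try exact: polyfun_cst; move=> x; rewrite ?oner_eq0 ?mulr1.
Qed.

Lemma polyfrac_real (f : (nat -> R) -> R) : polyfun n f -> polyfrac (fun x => cR (f x)).
Proof.
move=> pf; exists (fun=> 1), f, (fun=> 0).
by split => //; try exact: polyfun_cst; move=> x; rewrite ?oner_eq0 ?mulr1.
Qed.

Lemma polyfracD f g : polyfrac f -> polyfrac g -> polyfrac (fun x => f x + g x).
Proof.
move=> [h [a [b [ph pa pb h0 hE]]]] [h' [a' [b' [ph' pa' pb' h0' hE']]]].
exists (fun x => h x * h' x), (fun x => a x * h' x + a' x * h x),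
  (fun x => b x * h' x + b' x * h x); split.
- exact: polyfunM.
- by apply: polyfunD; exact: polyfunM.
- by apply: polyfunD; exact: polyfunM.
- by move=> x; rewrite mulf_neq0.
- move=> x; have [<- <-] := hE x; have [<- <-] := hE' x; rewrite ReD ImD.
  by split; ring.
Qed.

Lemma polyfracM f g : polyfrac f -> polyfrac g -> polyfrac (fun x => f x * g x).
Proof.
move=> [h [a [b [ph pa pb h0 hE]]]] [h' [a' [b' [ph' pa' pb' h0' hE']]]].
exists (fun x => h x * h' x), (fun x => a x * a' x + (-1) * (b x * b' x)),
  (fun x => a x * b' x + b x * a' x); split.
- exact: polyfunM.
- apply: polyfunD; first exact: polyfunM.
  by apply: polyfunM; [exact: polyfun_cst | exact: polyfunM].
- by apply: polyfunD; exact: polyfunM.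
- by move=> x; rewrite mulf_neq0.
- move=> x; have [<- <-] := hE x; have [<- <-] := hE' x; rewrite ReM ImM.
  by split; ring.
Qed.

Lemma polyfrac_meval m (p : mpoly.mpoly m R[i]) (v : (nat -> R) -> 'I_m -> R[i]) :
  (forall i, polyfrac (fun x => v x i)) -> polyfrac (fun x => mpoly.meval (v x) p).
Proof.
move=> cv; apply: (@polyfrac_ext (fun w => \sum_(m <- mpoly.msupp p)
  mpoly.mcoeff m p * \prod_i v w i ^+ mpoly.fun_of_multinom m i)).
  by move=> w; rewrite mpoly.mevalE.
elim: (mpoly.msupp p) => [|mm s IHs].
  by apply: (@polyfrac_ext (fun=> 0)) (polyfrac_cst 0) => w; rewrite big_nil.
apply: polyfrac_ext; first by move=> w; rewrite big_cons.
apply: polyfracD IHs; apply: polyfracM; first exact: polyfrac_cst.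
elim: (index_enum _) => [|i r IHr].
  by apply: (@polyfrac_ext (fun=> 1)) (polyfrac_cst 1) => w; rewrite big_nil.
apply: polyfrac_ext; first by move=> w; rewrite big_cons.
apply: polyfracM IHr; elim: (mpoly.fun_of_multinom mm i) => [|e IHe].
  exact: (polyfrac_cst 1).
apply: polyfrac_ext; first by move=> w; rewrite exprS.
exact: polyfracM.
Qed.

(** The sum of the squares of the two real numerators vanishes exactly where the complex value
    does. *)
Lemma polyfrac_zero f : polyfrac f -> exists2 W, polyfun n W & forall x, W x = 0 <-> f x = 0.
Proof.
move=> [h [a [b [ph pa pb h0 hE]]]].
exists (fun x => a x * a x + b x * b x).
  by apply: polyfunD; exact: polyfunM.
move=> x; have [<- <-] := hE x; split=> [|->]; last by rewrite /= !mul0r addr0.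
move/eqP; rewrite -!expr2 paddr_eq0 ?sqr_ge0 // !sqrf_eq0 !mulf_eq0 (negbTE (h0 x)) !orbF.
by move=> /andP[/eqP hr /eqP hi]; apply: complex_eq.
Qed.

End PolyFractions.

Section HyperplanePolynomials.
Variables (R : realType) (N : nat) (anti : bool).
Variable q : mpoly.mpoly (N + (N + N + N + N)) R[i].

(* The hyperplane sum_j t_j = 0, parametrised by its first N - 1 coordinates. *)
Definition tvec (x : nat -> R) (j : 'I_N) : R :=
  if (j < N.-1)%N then x j else - \sum_(i < N.-1) x i.

Lemma polyfun_tvec j : polyfun N.-1 (fun x => tvec x j).
Proof.
rewrite /tvec; case: (ltnP j N.-1) => jN; first exact: polyfun_coord.
apply: (@polyfun_ext _ _ (fun x => (-1) * \sum_(i < N.-1) x i)).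
  by move=> x; rewrite mulN1r.
apply: polyfunM; first exact: polyfun_cst.
by apply: polyfun_sum => i _; exact: polyfun_coord.
Qed.

Lemma tvecP (t : 'I_N -> R) : \sum_j t j = 0 ->
  tvec (fun i => if insub i is Some j then t j else 0) = t.
Proof.
move=> t0; apply/funext => j; rewrite /tvec; case: ifP => jN.
  by rewrite insubT //= => lt; congr t; exact: val_inj.
have N0 : (0 < N)%N by rewrite (leq_ltn_trans _ (ltn_ord j)).
have jE : nat_of_ord j = N.-1 by have := ltn_ord j; lia.
have N1 : (N.-1 < N)%N by lia.
move/eqP: t0; rewrite (bigD1 j) //= addr_eq0 => /eqP ->; congr (- _).
rewrite (@big_ord_widen _ _ _ N.-1 N (fun i => if insub i is Some j then t j else 0)) ?leq_pred //.
apply: eq_big => i; first by rewrite -val_eqE /= jE; have := ltn_ord i; lia.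
by move=> _; rewrite insubT //= => lt; congr t; exact: val_inj.
Qed.

Lemma esym_tvec_polyfun : polyfun N.-1 (fun x => esymN1 (tvec x)).
Proof. by apply: polyfun_sum => j _; apply: polyfun_prod => i _; exact: polyfun_tvec. Qed.

Lemma Qfun_tvec_polyfun : exists2 W, polyfun N.-1 W &
  forall x, W x = 0 <-> Qfun anti q (tvec x) = 0.
Proof.
apply: polyfrac_zero; apply: polyfrac_meval => i; rewrite /mandarin_pt.
case: (fintype.split i) => [j|m].
  exists (fun x => 1 + tvec x j * tvec x j),
    (fun x => psign R anti * (1 + (-1) * (tvec x j * tvec x j))),
    (fun x => 2 * tvec x j); split.
  - apply: polyfunD; first exact: polyfun_cst.
    by apply: polyfunM; exact: polyfun_tvec.
  - apply: polyfunM; first exact: polyfun_cst.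
    apply: polyfunD; first exact: polyfun_cst.
    apply: polyfunM; first exact: polyfun_cst.
    by apply: polyfunM; exact: polyfun_tvec.
  - by apply: polyfunM; [exact: polyfun_cst|exact: polyfun_tvec].
  - by move=> x; rewrite gt_eqF // ltr_pwDl // -expr2 sqr_ge0.
  - move=> x /=; have h : 1 + tvec x j * tvec x j != 0.
      by rewrite gt_eqF // ltr_pwDl // -expr2 sqr_ge0.
    by rewrite !expr1n !mulr1 -!expr2 in h *; rewrite !divfK //; split=> //; ring.
case: (fintype.split m) => [m1|j]; last by apply: polyfrac_real; exact: polyfun_tvec.
case: (fintype.split m1) => [m2|j]; last exact: polyfrac_cst.
case: (fintype.split m2) => [j|j]; first exact: polyfrac_cst.
apply: polyfracM; first exact: polyfrac_cst.
by apply: polyfrac_real; exact: polyfun_tvec.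
Qed.

Lemma esym_neq0 : (3 <= N)%N -> exists x, esymN1 (tvec x) != 0.
Proof.
move=> N3.
have l0 : (0 < N)%N by lia.
(* At (0, 1, ..., 1, 2 - N) only the product omitting the zero coordinate survives, with value 2 -
   N. For N = 2 the polynomial e_1 is the sum itself and vanishes on the hyperplane. *)
pose t (j : 'I_N) : R := if j == 0%N :> nat then 0
  else if j == N.-1 :> nat then - (N - 2)%:R else 1.
have st : \sum_j t j = 0.
  rewrite (bigD1 (Ordinal l0)) //= /t /= add0r.
  have l1 : (N.-1 < N)%N by lia.
  rewrite (bigD1 (Ordinal l1)) /=; last by rewrite -val_eqE /=; lia.
  rewrite eqxx (_ : (N.-1 == 0)%N = false); last by lia.
  rewrite (eq_bigr (fun=> 1)); last first.
    move=> i /andP[i0 i1]; rewrite -!val_eqE /= in i0 i1.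
    by rewrite (negbTE i0) (negbTE i1).
  rewrite sumr_const -[X in X + _ = _]mulN1r.
  suff -> : #|[pred i | (i != Ordinal l0) && (i != Ordinal l1)]| = (N - 2)%N by rewrite mulN1r addNr.
  have := cardC (pred2 (Ordinal l0) (Ordinal l1)).
  rewrite card2 card_ord (_ : Ordinal l0 != Ordinal l1); last by rewrite -val_eqE /=; lia.
  rewrite (eq_card (B := [pred i | (i != Ordinal l0) && (i != Ordinal l1)])); last first.
    by move=> i; rewrite !inE negb_or.
  by move=> /(congr1 (subn^~ 2)) <-; rewrite addKn.
exists (fun i => if insub i is Some j then t j else 0); rewrite tvecP //.
rewrite /esymN1 (bigD1 (Ordinal l0)) //= [X in _ + X]big1 ?addr0.
  apply/prodf_neq0 => i i0; rewrite /t; rewrite -val_eqE /= in i0; rewrite (negbTE i0).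
  case: (nat_of_ord i =P N.-1) => _; last exact: oner_neq0.
  by rewrite oppr_eq0 pnatr_eq0; lia.
move=> j j0; rewrite (bigD1 (Ordinal l0)) 1?eq_sym //=.
by rewrite {1}/t /= mul0r.
Qed.

End HyperplanePolynomials.

(** * Dimension of the failure set *)

Section TrigZeros.
Variable R : realType.
Implicit Types x y : R.

Lemma sin_eq0_int x : sin x = 0 -> exists m : int, x = m%:~R * pi.
Proof.
wlog x0 : x / 0 <= x => [H sx|sx].
  have [x0|x0] := lerP 0 x; first exact: H.
  have [||m mE] := H (- x); [lra|by rewrite sinN sx oppr0|].
  by exists (- m); rewrite mulrNz mulNr -mE opprK.
have xp : 0 <= x / pi by rewrite divr_ge0 // pi_ge0.
set n := Num.truncn (x / pi).
have /andP[n1 n2] : n%:R <= x / pi < n.+1%:R by exact: truncn_itv.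
rewrite ler_pdivlMr ?pi_gt0 // ltr_pdivrMr ?pi_gt0 // -natr1 mulrDl mul1r in n1 n2.
exists n%:Z; rewrite -pmulrn; pose r := x - n%:R * pi.
have xE : x = r + pi *+ n by rewrite /r -(mulr_natl pi n) subrK.
have sr : sin r = 0.
  move: sx; rewrite xE (alternatingn (@sinDpi R)) => /eqP.
  by rewrite mulf_eq0 signr_eq0 => /eqP.
have [r0|r0|r0] := ltgtP r 0.
- by rewrite /r in r0; lra.
- have := sin_gt0_pi (x := r); rewrite sr ltxx => h; have : false by apply: h; rewrite r0 /=; rewrite /r; lra.
  by [].
- by rewrite /r in r0; lra.
Qed.

Lemma tan_eq_int x t : cos x != 0 -> sin x / cos x = t ->
  exists m : int, x = atan t + m%:~R * pi.
Proof.
move=> cx xt; have ct : 0 < cos (atan t).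
  by apply: cos_gt0_pihalf; rewrite atan_gtNpi2 atan_ltpi2.
have st : sin (atan t) = t * cos (atan t).
  by have := atanK t; rewrite /tan => {2}<-; rewrite divfK // gt_eqF.
have : sin (x - atan t) = 0.
  by rewrite sinB st -xt; field.
move=> /sin_eq0_int[m mE]; exists m; lra.
Qed.

Lemma atan_lipschitz x y : `|atan x - atan y| <= `|x - y|.
Proof.
wlog xy : x y / y <= x => [H|].
  case/orP: (le_total y x) => [yx|xy]; first exact: (H x y yx).
  by rewrite (distrC x) (distrC (atan x)); exact: (H y x xy).
have dat (z : R) : z \in `]y, x[ -> is_derive z 1 atan (1 + z ^+ 2)^-1.
  by move=> _; exact: is_derive1_atan.
have cat' : {within `[y, x], continuous (@atan R)}.
  by apply: continuous_subspaceT => z; exact: continuous_atan.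
have [c _ ->] := MVT_segment xy dat cat'.
rewrite normrM ler_piMl // gtr0_norm; last first.
  by rewrite invr_gt0 ltr_pwDl // sqr_ge0.
by rewrite invf_le1 ?lerDl ?sqr_ge0 // ltr_pwDl // sqr_ge0.
Qed.

End TrigZeros.

Section RatIndependent.
Variables (R : realType) (N : nat).
Implicit Types (l : 'rV[R]_N) (k : R).

Definition rat_indep l := forall i j : 'I_N, i != j ->
  forall c : rat, l 0 j <> ratr c * l 0 i.

(** Two simultaneous zeros place phi_i and phi_j at integer multiples of pi, or of pi / 2, and make
    l_j / l_i rational. *)
Lemma no_double_rat_indep l k : 0 < k -> pos_lengths l -> rat_indep l -> no_double l k.
Proof.
move=> k0 lp il i j ij.
have H (mi mj : int) (p : R) : p != 0 -> hphase l k i = mi%:~R * p ->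
    hphase l k j = mj%:~R * p -> False.
  move=> p0 hi hj; apply: (il i j ij (mj%:~R / mi%:~R)).
  have hi0 : 0 < hphase l k i by rewrite divr_gt0 // mulr_gt0 //; exact: lp.
  have mi0 : mi%:~R != 0 :> R.
    by move: hi0; rewrite hi; apply: contraTneq => ->; rewrite mul0r ltxx.
  rewrite fmorph_div !rmorph_int; apply: (@mulfI _ (k / 2)); first by rewrite mulf_neq0 ?invr_eq0 // gt_eqF.
  move: hi hj; rewrite /hphase => hi hj.
  rewrite [LHS]mulrAC hj mulrCA [k / 2 * _]mulrAC hi; field; exact: mi0.
split=> [[ci cj]|[/sin_eq0_int[mi hi] /sin_eq0_int[mj hj]]]; last first.
  by apply: (H mi mj pi) => //; rewrite gt_eqF // pi_gt0.
move: ci cj; rewrite -!sinDpihalf => /sin_eq0_int[mi hi] /sin_eq0_int[mj hj].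
apply: (H (mi *+ 2 - 1) (mj *+ 2 - 1) (pi / 2)).
- by rewrite mulf_neq0 // gt_eqF // ?pi_gt0 // invr_gt0.
- by rewrite rmorphB rmorphMn /= mulr2n; lra.
- by rewrite rmorphB rmorphMn /= mulr2n; lra.
Qed.

End RatIndependent.

(* The library has no canonical completeNormedModType on matrices. *)
Definition row_complete (R : realType) n : completeNormedModType R :=
  HB.pack 'rV[R]_n (Uniform_isComplete.Build 'rV[R]_n (@mx_complete (R : completeType) 1 n)).

(** * Null pieces and Baire category *)

Section NullPieces.
Variables (R : realType) (N : nat).
Hypothesis N0 : (0 < N)%N.

(** Jordan content zero, with cubes of one common size. Unlike measure zero it passes to closures,
    which is what Baire's theorem needs. *)
Definition content_zero (D : set (nat -> R)) := forall eta : R, 0 < eta ->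
  exists2 dl, 0 < dl & exists2 L : seq (nat -> R), (size L)%:R * dl ^+ N <= eta &
    forall x, D x -> exists2 c, List.In c L & box_close N dl x c.

Definition lipschitz_on (D : set (nat -> R)) (G : (nat -> R) -> 'rV[R]_N) (K : R) :=
  0 <= K /\ forall x y, D x -> D y -> forall r, 0 <= r -> box_close N r x y ->
    `|G x - G y| <= K * r.

Lemma In_index (T : Type) (a d : T) (s : seq T) :
  List.In a s -> exists k : 'I_(size s), nth d s k = a.
Proof.
elim: s => //= b s IHs [->|/IHs[k kE]].
  by have h : (0 < (size s).+1)%N by []; exists (Ordinal h).
have h : (k.+1 < (size s).+1)%N by rewrite ltnS.
by exists (Ordinal h).
Qed.

(** A counting form of volume. If the closure filled a ball, each of m^N grid points of step
    [C * dl] in it would lie near the image of a cube of the cover. Distinct grid points need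
    distinct cubes, so m^N <= size L, while the cover has too small a volume for that. *)
Lemma closure_null_dense D G K : content_zero D -> lipschitz_on D G K ->
  dense (~` closure (G @` D)).
Proof.
move=> cD [K0 hG] O [c0 Oc0] oO; apply: contrapT => H.
have OS p : O p -> closure (G @` D) p.
  by move=> Op; apply: contrapT => h; apply: H; exists p.
have /nbhs_normP[a /= a0 ha] : nbhs c0 O by exact: open_nbhs_nbhs.
have a20 : 0 < a / 2 by rewrite divr_gt0.
(* Two points of [D] near the same centre are at most 2 dl apart, their images 2 K dl, and each grid
   point is within dl of its image point: (2 K + 2) dl in all. *)
pose C := 2 * K + 2; have C0 : 0 < C by rewrite /C; lra.
have eta0 : 0 < (a / 2 / C) ^+ N / 2 by rewrite divr_gt0 // exprn_gt0 // divr_gt0.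
have [dl dl0 [L sL hL]] := cD _ eta0.
pose s := C * dl; have s0 : 0 < s by exact: mulr_gt0.
set m := (Num.truncn (a / 2 / s)).+1.
have as0 : 0 <= a / 2 / s by rewrite divr_ge0 // ltW.
have /andP[m1 m2] := truncn_itv as0.
pose p (g : {ffun 'I_N -> 'I_m}) : 'rV[R]_N := \row_i (c0 0 i + s * (g i)%:R).
have pO g : O (p g).
  apply: ha; rewrite /ball_ /=; apply: (@le_lt_trans _ _ (a / 2)); last by lra.
  apply: row_norm_le => [|i]; first exact: ltW.
  rewrite !mxE opprD addrA subrr sub0r normrN ger0_norm; last by rewrite mulr_ge0 // ltW.
  rewrite mulrC -ler_pdivlMr //; apply: le_trans m1; rewrite ler_nat -ltnS.
  exact: ltn_ord.
have pick g : exists k : 'I_(size L), exists x, [/\ D x,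
    box_close N dl x (nth (fun=> 0) L k) & `|p g - G x| < dl].
  have [|_ [[x Dx <-] px]] := OS _ (pO g) (ball (p g) dl); first exact: nbhsx_ballx.
  have [c cL xc] := hL x Dx; have [k kE] := In_index (fun=> 0) cL.
  exists k, x; split=> //; first by rewrite kE.
  by rewrite -ball_normE in px.
have [f hf] := choice pick.
have finj : injective f.
  move=> g g' fg; apply: contrapT => /eqP gg'.
  have [x [Dx xc px]] := hf g; have [x' [Dx' xc' px']] := hf g'.
  have xx' : box_close N (dl + dl) x x'.
    move=> i iN; apply: le_trans (ler_distD (nth (fun=> 0) L (f g) i) _ _) _.
    by apply: lerD; [exact: xc | rewrite fg distrC; exact: xc'].
  have dd0 : 0 <= dl + dl by rewrite addr_ge0 // ltW.
  have hx := hG x x' Dx Dx' _ dd0 xx'.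
  have pp : `|p g - p g'| < s.
    apply: le_lt_trans (ler_distD (G x) _ _) _.
    have : `|G x - p g'| <= `|G x - G x'| + `|G x' - p g'| by exact: ler_distD.
    by rewrite (distrC (G x')) /s /C; lra.
  move/negP: gg'; apply; apply/eqP/ffunP => i; apply/val_inj/eqP.
  have := le_lt_trans (row_coord_le_norm _ i) pp; rewrite !mxE.
  rewrite opprD addrACA subrr add0r -mulrBr normrM gtr0_norm // gtr_pMr //.
  rewrite ltr_norml => /andP[h1 h2].
  by rewrite eqn_leq -(ltnS (g i)) -(ltnS (g' i)) -!(ltr_nat R) -!natr1; apply/andP; split; lra.
have : (m ^ N <= size L)%N.
  have := leq_card f finj; rewrite card_ffun !card_ord //.
move=> mL; move: sL; apply/negP; rewrite -ltNge.
apply: (@lt_le_trans _ _ ((a / 2 / C) ^+ N)).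
  by rewrite ltr_pdivrMr // ltr_pMr ?ltr1n // exprn_gt0 // divr_gt0.
apply: (@le_trans _ _ ((m ^ N)%:R * dl ^+ N)); last first.
  by rewrite ler_pM2r ?exprn_gt0 // ler_nat.
have mC : a / 2 / C < m%:R * dl.
  by move: m2; rewrite -/m /s invfM mulrA ltr_pdivrMr.
rewrite natrX -exprMn lerXn2r //; last exact: ltW.
  by rewrite nnegrE ltW // divr_gt0.
by rewrite nnegrE mulr_ge0 // ltW.
Qed.

(** The images of the pieces under a Lipschitz map have closures with dense complement; by Baire's
    theorem their union misses a point of every nonempty open set, as [dim_le_of_lipschitz_null]
    requires. *)
Lemma dim_le_pieces (S : set 'rV[R]_N) (T : countType)
    (D : T -> set (nat -> R)) (G : T -> (nat -> R) -> 'rV[R]_N) :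
  (forall t, content_zero (D t)) -> (forall t, exists K, lipschitz_on (D t) (G t) K) ->
  (forall s, S s -> exists t, (G t @` D t) s) -> dim_le S (N - 1).
Proof.
move=> cD hG cover; apply: dim_le_of_lipschitz_null => // P L hP O O0 oO.
pose F (n : nat) : set 'rV[R]_N :=
  if unpickle n is Some t then ~` closure ((P \o G t) @` D t) else setT.
have L0 : 0 <= Num.max L 0 by rewrite le_max lexx orbT.
have hF n : open (F n) /\ dense (F n).
  rewrite /F; case: unpickle => [t|]; last first.
    by split; [exact: openT | move=> U [u Uu] _; exists u].
  split; first by apply: closed_openC; exact: closed_closure.
  have [K [K0 hK]] := hG t.
  apply: (closure_null_dense (K := Num.max L 0 * K)) => //; split.
    exact: mulr_ge0.
  move=> x y Dx Dy r r0 xy; apply: le_trans (hP _ _) _; rewrite -mulrA.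
  apply: (@le_trans _ _ (Num.max L 0 * `|G t x - G t y|)).
    by rewrite ler_wpM2r // le_max lexx.
  by rewrite ler_wpM2l // hK.
have [c [Oc Fc]] := @Baire R (row_complete R N) F hF O O0 oO.
exists c => // s /cover[t [x Dx <-]] Ps.
have := Fc (pickle t) I; rewrite /F pickleK; apply.
by apply: subset_closure; exists x.
Qed.

Lemma content_zero_polyfun f M : polyfun N f -> (exists x, f x != 0) -> 0 < M ->
  content_zero [set x | in_box N M x /\ f x = 0].
Proof.
move=> pf f0 M0 eta eta0; have [d0 d00 H] := polyfun_zero_cover pf f0 M0 eta0.
have [] := H (d0 / 2); [by rewrite divr_gt0|by lra|].
move=> L sL hL; exists (d0 / 2); first by rewrite divr_gt0.
by exists L => // x [bx fx]; exact: hL.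
Qed.

Lemma lipschitz_on_coords (M : R) (D : set (nat -> R)) (G : (nat -> R) -> 'rV[R]_N) :
  (forall j, box_lipschitz N M (fun x => G x 0 j)) -> (forall x, D x -> in_box N M x) ->
  exists K, lipschitz_on D G K.
Proof.
move=> /choice[K hK] DM; exists (\sum_j K j).
have K0 j : 0 <= K j by have [] := hK j.
split; first by rewrite sumr_ge0.
move=> x y Dx Dy r r0 xy; apply: row_norm_le => [|i].
  by rewrite mulr_ge0 // sumr_ge0.
have [_ /(_ x y (DM x Dx) (DM y Dy))[_ /(_ r r0 xy)]] := hK i.
rewrite !mxE => /le_trans; apply; rewrite ler_wpM2r //.
by rewrite (bigD1 i) //= lerDl sumr_ge0.
Qed.

Lemma box_lipschitz_atan M (f : (nat -> R) -> R) : box_lipschitz N M f -> box_lipschitz N M (fun x => atan (f x)).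
Proof.
move=> [L [L0 H]]; exists L; split=> // x y bx bY; have [h1 h2] := H x y bx bY.
split; first by have := atan_lipschitz (f x) 0; rewrite atan0 !subr0 => /le_trans; apply.
by move=> r r0 xy; apply: le_trans (atan_lipschitz _ _) _; exact: h2.
Qed.

End NullPieces.

Section BadSetDimension.
Variables (R : realType) (N : nat) (anti : bool).
Variable q : mpoly.mpoly (N + (N + N + N + N)) R[i].
Hypotheses (N3 : (3 <= N)%N) (hq : homog_in_trace q).
Hypothesis Qwit : exists x, Qfun anti q (tvec x) != 0.

(** Lengths with a rational ratio form countably many hyperplanes. Any other failing l is recovered,
    as l_j = 2 phi_j / k, from t, from 1 / k and from the branches z of the arctangent; and t is
    confined to the zeros of a polynomial in N - 1 variables. *)
Theorem dim_le_bad (S : set 'rV[R]_N) :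
  (forall l, S l -> pos_lengths l /\ ~ good_set (propP anti q) l) -> dim_le S (N - 1).
Proof.
move=> hS; have N0 : (0 < N)%N by lia.
have NE : N = N.-1.+1 by rewrite prednK.
have [W pW hW] := Qfun_tvec_polyfun anti q.
pose T : countType := (('I_N * 'I_N * rat * nat) + (bool * {ffun 'I_N -> int} * nat))%type.
(* A pair with i = j yields the empty piece, its equation being 1 = 0; [M] exhausts the space by
   boxes. *)
pose D (t : T) : set (nat -> R) := match t with
  | inl (i, j, c, M) => [set x | in_box N M.+1%:R x /\
      (if i == j then 1 else x j + (- ratr c) * x i) = 0]
  | inr (b, z, M) => [set x | in_box N M.+1%:R x /\
      (if b then esymN1 (@tvec R N x) else W x) = 0]
  end.
(* Coordinate N - 1 stands for 1 / k rather than k, which keeps the map Lipschitz on boxes. *)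
pose G (t : T) (x : nat -> R) : 'rV[R]_N := match t with
  | inl _ => \row_j x j
  | inr (b, z, M) => \row_j (2 * x N.-1 *
      (if anti then pi / 2 + (-1) * (atan (tvec x j) + (z j)%:~R * pi)
       else atan (tvec x j) + (z j)%:~R * pi))
  end.
apply: (@dim_le_pieces R N N0 S T D G).
- move=> [[[[i j] c] M]|[[b z] M]]; apply: content_zero_polyfun => //.
  + case: eqP => ij; first exact: polyfun_cst.
    apply: polyfunD; first exact: polyfun_coord.
    by apply: polyfunM; [exact: polyfun_cst|exact: polyfun_coord].
  + case: (i =P j) => ij; first by exists (fun=> 0); exact: oner_neq0.
    exists (fun n : nat => if n == nat_of_ord j then 1 else 0); rewrite eqxx (_ : (i == j :> nat) = false).
      by rewrite mulr0 addr0 oner_neq0.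
    by apply/negP => /eqP/val_inj.
  + rewrite NE; apply: polyfun_widen; case: b; last exact: pW.
    exact: esym_tvec_polyfun.
  + case: b; first exact: esym_neq0.
    by case: Qwit => x hx; exists x; apply: contra hx => /eqP/hW ->.
- have tl M j : box_lipschitz N M (fun x : nat -> R => tvec x (j : 'I_N)).
    by apply: polyfun_lipschitz; rewrite {1}NE; apply: polyfun_widen; exact: polyfun_tvec.
  move=> [[[[i j] c] M]|[[b z] M]]; apply: (@lipschitz_on_coords _ _ M.+1%:R).
  + move=> u; have [K [K0 H]] := @box_lipschitz_coord R N M.+1%:R u (ltn_ord u).
    by exists K; split=> // x y; rewrite !mxE; exact: H.
  + by move=> x [].
  + move=> u; have [K [K0 H]] : box_lipschitz N M.+1%:R (fun x : nat -> R => 2 * x N.-1 *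
      (if anti then pi / 2 + (-1) * (atan (tvec x u) + (z u)%:~R * pi)
       else atan (tvec x u) + (z u)%:~R * pi)).
      have c1 : box_lipschitz N M.+1%:R (fun x : nat -> R => atan (tvec x u) + (z u)%:~R * pi).
        by apply: box_lipschitzD; [exact: box_lipschitz_atan|exact: box_lipschitz_cst].
      apply: box_lipschitzM.
        apply: box_lipschitzM; first exact: box_lipschitz_cst.
        by apply: box_lipschitz_coord; lia.
      case: anti => //; apply: box_lipschitzD; first exact: box_lipschitz_cst.
      by apply: box_lipschitzM; first exact: box_lipschitz_cst.
    by exists K; split=> // x y; rewrite !mxE; exact: H.
  + by move=> x [].
move=> l /hS[lp /existsNP[k /existsNP[x /not_implyP[ex bad]]]].
have bnd (y : nat -> R) : exists M : nat, in_box N M.+1%:R y.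
  exists (Num.truncn (\sum_(i < N) `|y i|)) => i iN; apply: le_trans (ltW (truncnS_gt _)).
  rewrite (bigD1 (Ordinal iN)) //= lerDl; exact: sumr_ge0.
have [il|/existsNP[i /existsNP[j /not_implyP[ij /existsNP[c /contrapT lc]]]]] := pselect (rat_indep l); last first.
  pose y n := if insub n is Some j then l 0 j else 0 : R.
  have yE u : y (nat_of_ord u) = l 0 u.
    by rewrite /y insubT //= => lt; congr (l 0 _); exact: val_inj.
  have [M bM] := bnd y; exists (inl (i, j, c, M)), y.
    by split=> //; rewrite (negbTE ij) !yE lc mulNr subrr.
  by apply/rowP => u; rewrite mxE yE.
have [k0 [x0 Vx]] := ex.
have nd := no_double_rat_indep k0 lp il.
have [a0 s0 bad'] := bad_structure k0 lp nd hq ex bad.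
pose t := ptan anti l k.
have /choice[z hz] j : exists m : int, (if anti then pi / 2 - hphase l k j else hphase l k j) = atan (t j) + m%:~R * pi.
  apply: tan_eq_int; have := a0 j; rewrite /t /ptan /pcos /psin; case: anti => //.
    by rewrite cosB cos_pihalf sin_pihalf mul0r mul1r add0r.
  by rewrite cosB sinB cos_pihalf sin_pihalf !mul0r !mul1r add0r subr0.
pose y0 : nat -> R := fun i => if insub i is Some j then t j else 0.
pose y n := if n == N.-1 then k^-1 else y0 n.
have ty : tvec y = t.
  transitivity (@tvec R N y0); last exact: tvecP s0.
  apply/funext => j; rewrite /tvec; case: ifP => jN.
    by rewrite /y ltn_eqF.
  by congr (- _); apply: eq_bigr => i _; rewrite /y ltn_eqF.
have Wy : W y = 0 <-> Qfun anti q t = 0 by rewrite hW ty.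
have [M bM] := bnd y.
exists (inr (`[<esymN1 t = 0>], finfun z, M)), y.
  split=> //; case: asboolP => et; first by rewrite ty.
  by apply/Wy; case: bad'.
apply/rowP => j; rewrite mxE ty ffunE -hz /y eqxx.
have -> : (if anti then pi / 2 + -1 * (if anti then pi / 2 - hphase l k j else hphase l k j)
  else (if anti then pi / 2 - hphase l k j else hphase l k j)) = hphase l k j.
  by case: anti => //; ring.
by rewrite /hphase; field; rewrite gt_eqF.
Qed.

End BadSetDimension.

(** * Sets defined by analytic equations *)

Section Analytic.
Variables (R : realType) (n : nat).
Implicit Types (f g : 'rV[R]_n -> R) (a y : 'rV[R]_n).

Lemma analytic_atD f g a : analytic_at f a -> analytic_at g a ->
  analytic_at (fun y => f y + g y) a.
Proof.
move=> [c [r [r0 hf]]] [c' [r' [r0' hg]]].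
exists (fun al => c al + c' al), (Num.min r r'); split; first by rewrite lt_min r0.
move=> y; rewrite lt_min => /andP[/hf[[M hM] fl] /hg[[M' hM'] gl]]; split.
  exists (M + M') => d; apply: le_trans (lerD (hM d) (hM' d)).
  rewrite -big_split /=; apply: ler_sum => al _; rewrite -mulrDl ler_wpM2r //.
    by apply: prodr_ge0 => i _; rewrite exprn_ge0.
  exact: ler_normD.
under eq_fun do under eq_bigr do rewrite mulrDl.
under eq_fun do rewrite big_split /=.
exact: cvgD.
Qed.

Lemma analytic_atN f a : analytic_at f a -> analytic_at (fun y => - f y) a.
Proof.
move=> [c [r [r0 hf]]]; exists (fun al => - c al), r; split=> // y /hf[[M hM] fl]; split.
  by exists M => d; under eq_bigr do rewrite normrN; exact: hM.
under eq_fun do under eq_bigr do rewrite mulNr.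
under eq_fun do rewrite sumrN.
exact: cvgN.
Qed.

Definition ispoly f := exists p : mpoly.mpoly n R, forall z, f z = mpoly.meval (z 0) p.

(** [analytic_at] sums over cubes of exponents, a polynomial over its support; this converts one sum
    into the other. *)
Lemma cube_sum (G : mpoly.multinom n -> R) (s : seq (mpoly.multinom n)) d : uniq s ->
  (forall m, m \notin s -> G m = 0) ->
  \sum_(al : {ffun 'I_n -> 'I_d.+1}) G (mpoly.Multinom [tuple nat_of_ord (al i) | i < n]) =
  \sum_(m <- s | [forall i, mpoly.fun_of_multinom m i <= d]%N) G m.
Proof.
move=> us G0.
pose mn (al : {ffun 'I_n -> 'I_d.+1}) := mpoly.Multinom [tuple nat_of_ord (al i) | i < n].
have mnE al i : mpoly.fun_of_multinom (mn al) i = al i by exact: mpoly.mnmE.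
transitivity (\sum_(al : {ffun 'I_n -> 'I_d.+1}) \sum_(m <- s | m == mn al) G m).
  apply: eq_bigr => al _; rewrite -/(mn al); case: (boolP (mn al \in s)) => ms.
    by rewrite -big_filter (filter_pred1_uniq us ms) big_seq1.
  rewrite G0 // big_seq_cond big1 // => m /andP[mS /eqP mE].
  by rewrite mE (negbTE ms) in mS.
under eq_bigr do rewrite big_mkcond.
rewrite exchange_big [RHS]big_mkcond /=; apply: eq_bigr => m _.
case: ifP => [/forallP md|md].
  pose al0 : {ffun 'I_n -> 'I_d.+1} := [ffun i => inord (mpoly.fun_of_multinom m i)].
  have al0E : mn al0 = m.
    by apply/mpoly.mnmP => i; rewrite mnE ffunE inordK // ltnS.
  rewrite (bigD1 al0) //= al0E eqxx -[RHS]addr0; congr (_ + _).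
  rewrite big1 // => al al_al0; case: eqP => // mE; case/eqP: al_al0.
  apply/ffunP => i; apply/val_inj; rewrite ffunE /= inordK ?ltnS //.
  by rewrite mE mnE.
rewrite big1 // => al _; case: eqP => // mE; case/negP: md; apply/forallP => i.
by rewrite mE mnE -ltnS.
Qed.

(** The expansion at [a] comes from substituting X_i + a_i; its partial sums are constant once the
    cube contains the support. *)
Lemma analytic_poly f a : ispoly f -> analytic_at f a.
Proof.
move=> [p fE].
pose p' := mpoly.comp_mpoly [tuple mpoly.mpolyX R (mpoly.mnm1 i) + mpoly.mpolyC n (a 0 i) | i < n] p.
have fE' y : f y = mpoly.meval (fun i => y 0 i - a 0 i) p'.
  rewrite mpoly.comp_mpoly_meval fE; apply: mpoly.meval_eq => i.
  by rewrite tnth_mktuple mpoly.mevalD mpoly.mevalXU mpoly.mevalC subrK.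
pose mk (al : 'I_n -> nat) := mpoly.Multinom [tuple al i | i < n].
exists (fun al => mpoly.mcoeff (mk al) p'), 1; split=> // y _.
have uS : uniq (mpoly.msupp p') by exact: mpoly.msupp_uniq.
have S0 m : m \notin mpoly.msupp p' -> mpoly.mcoeff m p' = 0.
  exact: mpoly.memN_msupp_eq0.
have mkE al i : mpoly.fun_of_multinom (mk al) i = al i by exact: mpoly.mnmE.
have key (h : R -> R) (t : 'I_n -> R) : h 0 = 0 -> forall d,
    \sum_(al : {ffun 'I_n -> 'I_d.+1}) h (mpoly.mcoeff (mk (fun i => nat_of_ord (al i))) p') *
       \prod_(i < n) t i ^+ al i =
    \sum_(m <- mpoly.msupp p' | [forall i, mpoly.fun_of_multinom m i <= d]%N)
       h (mpoly.mcoeff m p') * \prod_(i < n) t i ^+ mpoly.fun_of_multinom m i.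
  move=> h0 d; rewrite -(@cube_sum (fun m => h (mpoly.mcoeff m p') *
     \prod_(i < n) t i ^+ mpoly.fun_of_multinom m i)) //.
    apply: eq_bigr => al _; congr (_ * _); apply: eq_bigr => i _.
    by rewrite [mpoly.fun_of_multinom _ _]mkE.
  by move=> m /S0 ->; rewrite h0 mul0r.
split.
  exists (\sum_(m <- mpoly.msupp p') `|mpoly.mcoeff m p'| *
    \prod_(i < n) `|y 0 i - a 0 i| ^+ mpoly.fun_of_multinom m i) => d.
  rewrite (key Num.norm (fun i => `|y 0 i - a 0 i|)) ?normr0 //.
  rewrite [leRHS](bigID (fun m : mpoly.multinom n => [forall i, mpoly.fun_of_multinom m i <= d]%N)) /=.
  rewrite lerDl sumr_ge0 // => m _; rewrite mulr_ge0 //.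
  by apply: prodr_ge0 => i _; rewrite exprn_ge0.
apply: cvg_near_cst.
exists (\max_(m <- mpoly.msupp p') \max_(i < n) mpoly.fun_of_multinom m i)%N => // d /= hd.
rewrite (key id (fun i => y 0 i - a 0 i)) // fE' mpoly.mevalE.
rewrite [RHS]big_seq [LHS]big_seq_cond; apply: eq_bigl => m.
case: (boolP (m \in _)) => //= ms; apply/forallP => i. refine (@leq_trans _ _ _ _ hd).
apply: (leq_trans (leq_bigmax i)).
exact: (@leq_bigmax_seq _ (mpoly.msupp p') xpredT (fun m => \max_(i < n) mpoly.fun_of_multinom m i)%N).
Qed.

Lemma cube_sum_single (v : 'I_n) (e : nat -> R) (t : 'I_n -> R) d :
  \sum_(al : {ffun 'I_n -> 'I_d.+1})
     (if [forall i, (i != v) ==> (nat_of_ord (al i) == 0%N)] then e (al v) else 0) *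
     \prod_(i < n) t i ^+ al i = \sum_(k < d.+1) e k * t v ^+ k.
Proof.
transitivity (\sum_(al : {ffun 'I_n -> 'I_d.+1} | [forall i, (i != v) ==> (nat_of_ord (al i) == 0%N)])
   e (al v) * t v ^+ al v).
  rewrite [RHS]big_mkcond; apply: eq_bigr => al _; case: ifP; rewrite ?mul0r // => /forallP h.
  rewrite (bigD1 v) //= big1 ?mulr1 // => i iv.
  by have := h i; rewrite iv => /eqP ->; rewrite expr0.
pose h (k : 'I_d.+1) : {ffun 'I_n -> 'I_d.+1} := [ffun i => if i == v then k else ord0].
rewrite (reindex h) /=; last first.
  exists (fun al : {ffun 'I_n -> 'I_d.+1} => al v) => [k _|al]; first by rewrite ffunE eqxx.
  rewrite inE => /forallP hal; apply/ffunP => i; rewrite ffunE.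
  case: (i =P v) => [->//|/eqP iv]; apply/val_inj.
  by have := hal i; rewrite iv => /eqP /= <-.
apply: eq_big => [k|k _]; last by rewrite ffunE eqxx.
by apply/forallP => i; apply/implyP => /negbTE iv; rewrite ffunE iv.
Qed.

Lemma exp_partial_le (t : R) d : 0 <= t -> \sum_(k < d.+1) t ^+ k / k`!%:R <= expR t.
Proof.
move=> t0; have cv : series (exp_coeff t) @ \oo --> expR t.
  exact: (is_cvg_series_exp_coeff t).
rewrite -(big_mkord xpredT (fun k => t ^+ k / k`!%:R)).
apply: (@nondecreasing_cvgn_le R (series (exp_coeff t))) cv _ => //.
by apply: nondecreasing_series => k _ _; rewrite divr_ge0 // exprn_ge0.
Qed.

(** The series involves the single variable y_v - a_v, and a multiple of exp|y_v - a_v| bounds its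
    absolute partial sums. The addition formulas then give cos y_v and sin y_v at every centre. *)
Lemma analytic_trig (v : 'I_n) (al be : R) a :
  analytic_at (fun y => al * cos (y 0 v - a 0 v) + be * sin (y 0 v - a 0 v)) a.
Proof.
pose e k : R := al * cos_coeff 1 k + be * sin_coeff 1 k.
exists (fun u => if [forall i, (i != v) ==> (u i == 0%N)] then e (u v) else 0), 1.
split=> // y _.
have eb k : `|e k| <= (`|al| + `|be|) / k`!%:R.
  have b1 (b : bool) (j : nat) : `|b%:R * (-1) ^+ j * 1 ^+ k / k`!%:R| <= k`!%:R^-1 :> R.
    rewrite expr1n mulr1 !normrM normrX normrN1 expr1n mulr1 normfV [X in _ / X]ger0_norm //.
    by rewrite ler_piMl ?invr_ge0 //; case: b; rewrite ?normr1 ?normr0.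
  rewrite /e mulrDl; apply: le_trans (ler_normD _ _) _.
  by apply: lerD; rewrite normrM ler_wpM2l //; exact: b1.
split.
  exists ((`|al| + `|be|) * expR `|y 0 v - a 0 v|) => d.
  rewrite (eq_bigr (fun u : {ffun 'I_n -> 'I_d.+1} =>
     (if [forall i, (i != v) ==> (nat_of_ord (u i) == 0%N)] then `|e (u v)| else 0) *
     \prod_(i < n) `|y 0 i - a 0 i| ^+ u i)); last first.
    by move=> u _; case: ifP; rewrite ?normr0.
  rewrite (cube_sum_single v (fun k => `|e k|) (fun i => `|y 0 i - a 0 i|)).
  apply: le_trans (ler_wpM2l _ (exp_partial_le d (normr_ge0 (y 0 v - a 0 v)))); last exact: addr_ge0.
  rewrite mulr_sumr; apply: ler_sum => k _; rewrite [leRHS]mulrCA [leRHS]mulrC.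
  by rewrite ler_wpM2r // exprn_ge0.
under eq_fun do rewrite (cube_sum_single v e (fun i => y 0 i - a 0 i)).
set t := y 0 v - a 0 v.
have cc k (x : R) : cos_coeff x k = cos_coeff 1 k * x ^+ k.
  by rewrite /cos_coeff /= expr1n; ring.
have sc k (x : R) : sin_coeff x k = sin_coeff 1 k * x ^+ k.
  by rewrite /sin_coeff /= expr1n; ring.
have h1 : series (cos_coeff t) @ \oo --> cos t.
  have -> : cos t = lim (series (cos_coeff t) @ \oo) by rewrite unlock.
  exact: is_cvg_series_cos_coeff.
have h2 : series (sin_coeff t) @ \oo --> sin t.
  have -> : sin t = lim (series (sin_coeff t) @ \oo) by rewrite unlock.
  exact: is_cvg_series_sin_coeff.
have h3 : (fun d => al * series (cos_coeff t) d + be * series (sin_coeff t) d) @ \oo -->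
    al * cos t + be * sin t.
  by apply: cvgD; apply: cvgM => //; exact: cvg_cst.
(* Exponents at most [d] make d + 1 terms, while [series] at [d] has d terms. *)
rewrite -(cvg_shiftS _) in h3; apply: cvg_trans h3; apply: near_eq_cvg; near=> d.
rewrite /series /= !big_mkord !mulr_sumr -big_split /=; apply: eq_bigr => k _.
by rewrite (cc k t) (sc k t) /e; ring.
Unshelve. all: by end_near. Qed.

Lemma analytic_cos (v : 'I_n) a : analytic_at (fun y => cos (y 0 v)) a.
Proof.
have := analytic_trig v (cos (a 0 v)) (- sin (a 0 v)) a.
rewrite (_ : (fun y => _) = (fun y => cos (y 0 v))) //; apply/funext => y.
by rewrite mulNr -cosD addrC subrK.
Qed.

Lemma analytic_sin (v : 'I_n) a : analytic_at (fun y => sin (y 0 v)) a.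
Proof.
have := analytic_trig v (sin (a 0 v)) (cos (a 0 v)) a.
rewrite (_ : (fun y => _) = (fun y => sin (y 0 v))) //; apply/funext => y.
by rewrite -sinD addrC subrK.
Qed.

Lemma ispoly_cst c : ispoly (fun=> c).
Proof. by exists (mpoly.mpolyC n c) => z; rewrite mpoly.mevalC. Qed.
Lemma ispoly_coord i : ispoly (fun z => z 0 i).
Proof. by exists (mpoly.mpolyX R (mpoly.mnm1 i)) => z; rewrite mpoly.mevalXU. Qed.
Lemma ispolyD f g : ispoly f -> ispoly g -> ispoly (fun z => f z + g z).
Proof. by move=> [p fE] [r gE]; exists (p + r) => z; rewrite mpoly.mevalD fE gE. Qed.
Lemma ispolyM f g : ispoly f -> ispoly g -> ispoly (fun z => f z * g z).
Proof. by move=> [p fE] [r gE]; exists (p * r) => z; rewrite mpoly.mevalM fE gE. Qed.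
Lemma ispolyN f : ispoly f -> ispoly (fun z => - f z).
Proof. by move=> [p fE]; exists (- p) => z; rewrite mpoly.mevalN fE. Qed.
Lemma ispoly_sum (I : Type) (r : seq I) (F : I -> 'rV[R]_n -> R) :
  (forall i, ispoly (F i)) -> ispoly (fun z => \sum_(i <- r) F i z).
Proof.
move=> pF; elim: r => [|i r [p pE]].
  by exists 0 => z; rewrite big_nil mpoly.meval0.
by have [p' p'E] := pF i; exists (p' + p) => z; rewrite big_cons mpoly.mevalD pE p'E.
Qed.


End Analytic.

Section EquationSets.
Variables (R : realType) (n : nat).
Implicit Types (f g : 'rV[R]_n -> R) (S T : 'rV[R]_n -> Prop).

Lemma continuous_eq f g : f =1 g -> continuous f -> continuous g.
Proof. by move=> /funext ->. Qed.

Lemma ispoly_continuous f : ispoly f -> continuous f.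
Proof.
move=> [p fE]; apply: (@continuous_eq (fun z : 'rV[R]_n => \sum_(m <- mpoly.msupp p)
    mpoly.mcoeff m p * \prod_i z 0 i ^+ mpoly.fun_of_multinom m i)).
  by move=> z; rewrite fE mpoly.mevalE.
have cst (c : R) : continuous (fun _ : 'rV[R]_n => c) by exact: cst_continuous.
elim: (mpoly.msupp p) => [|m s IHs].
  by apply: continuous_eq (cst 0) => z; rewrite big_nil.
apply: continuous_eq; first by move=> z; rewrite big_cons.
move=> z; apply: cvgD (IHs z); apply: cvgM; first exact: cst.
move: z; elim: (index_enum _) => [|i r IHr].
  by apply: continuous_eq (cst 1) => z; rewrite big_nil.
apply: continuous_eq; first by move=> z; rewrite big_cons.
move=> z; apply: cvgM (IHr z).
move: z; elim: (mpoly.fun_of_multinom m i) => [|e IHe].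
  by apply: continuous_eq (cst 1) => z; rewrite expr0.
apply: continuous_eq; first by move=> z; rewrite exprS.
move=> z; apply: cvgM (IHe z); exact: coord_continuous.
Qed.

Definition eqfun f := (forall a, analytic_at f a) /\ continuous f.

Lemma eqfun_poly f : ispoly f -> eqfun f.
Proof. by move=> pf; split; [move=> a; exact: analytic_poly|exact: ispoly_continuous]. Qed.

Lemma eqfunB f g : eqfun f -> eqfun g -> eqfun (fun z => f z - g z).
Proof.
move=> [af cf] [ag cg]; split=> [a|z]; last exact: (cvgB (cf z) (cg z)).
by apply: analytic_atD; last exact: analytic_atN.
Qed.

Lemma eqfun_cos i : eqfun (fun z => cos (z 0 i)).
Proof.
split=> [a|z]; first exact: analytic_cos.
apply: (@continuous_comp _ _ _ (fun z : 'rV[R]_n => z 0 i) cos).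
  exact: coord_continuous.
exact: continuous_cos.
Qed.

Lemma eqfun_sin i : eqfun (fun z => sin (z 0 i)).
Proof.
split=> [a|z]; first exact: analytic_sin.
apply: (@continuous_comp _ _ _ (fun z : 'rV[R]_n => z 0 i) sin).
  exact: coord_continuous.
exact: continuous_sin.
Qed.

(** Only equations, with functions analytic on the whole space: such sets are closed, and
    semianalytic with a single neighbourhood. *)
Definition eqset S := exists (J : finType) (f : J -> 'rV[R]_n -> R),
  (forall j, eqfun (f j)) /\ forall z, S z <-> forall j, f j z = 0.

Lemma eqset_forall (J : finType) (f : J -> 'rV[R]_n -> R) :
  (forall j, eqfun (f j)) -> eqset (fun z => forall j, f j z = 0).
Proof. by move=> hf; exists J, f. Qed.

Lemma eqset1 f : eqfun f -> eqset (fun z => f z = 0).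
Proof. by move=> hf; exists unit, (fun=> f); split=> // z; split=> // /(_ tt). Qed.

Lemma eqsetI S T : eqset S -> eqset T -> eqset (fun z => S z /\ T z).
Proof.
move=> [J [f [hf SE]]] [K [g [hg TE]]].
exists (J + K)%type, (fun u => match u with inl j => f j | inr k => g k end); split.
  by case.
move=> z; split=> [[/SE h /TE h'] [j|k] //|h].
by split; [apply/SE => j; exact: (h (inl j))|apply/TE => k; exact: (h (inr k))].
Qed.

Lemma eqset_closed S : eqset S -> closed [set z | S z].
Proof.
move=> [J [f [hf SE]]].
have -> : [set z | S z] = \bigcap_(j in [set: J]) (f j @^-1` [set 0]).
  by apply/seteqP; split=> z; [move=> /SE h j _; exact: h|move=> h; apply/SE => j; exact: h].
apply: closed_bigI => j _; apply: closed_comp => // z _; exact: (hf j).2.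
Qed.

Lemma eqset_semianalytic S : eqset S -> semianalytic [set z | S z].
Proof.
move=> [J [f [hf SE]]] a; exists setT; split; first exact: openT.
split=> //; exists 1%N, #|J|, (fun _ j => f (enum_val j)), (fun _ _ _ => 1); split.
  move=> _ j; split=> u _; first exact: (hf _).1.
  by apply: analytic_poly; exact: ispoly_cst.
rewrite setIT setTI; apply/seteqP; split=> z /=.
  by move=> /SE h; exists ord0 => j.
by move=> [_ h]; apply/SE => j; have [] := h (enum_rank j); rewrite enum_rankK.
Qed.

Definition cpoly (f : 'rV[R]_n -> R[i]) :=
  ispoly (fun z => complex.Re (f z)) /\ ispoly (fun z => complex.Im (f z)).

Lemma cpoly_ext (f g : 'rV[R]_n -> R[i]) : f =1 g -> cpoly f -> cpoly g.
Proof. by move=> /funext ->. Qed.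
Lemma cpoly_cst c : cpoly (fun=> c).
Proof. by split; exact: ispoly_cst. Qed.
Lemma cpoly_real f : ispoly f -> cpoly (fun z => cR (f z)).
Proof. by move=> pf; split=> //; exact: ispoly_cst. Qed.
Lemma cpolyD (f g : 'rV[R]_n -> R[i]) : cpoly f -> cpoly g -> cpoly (fun z => f z + g z).
Proof.
move=> [fr fi] [gr gi]; split.
  by under eq_fun do rewrite ReD; exact: ispolyD.
by under eq_fun do rewrite ImD; exact: ispolyD.
Qed.
Lemma cpolyM (f g : 'rV[R]_n -> R[i]) : cpoly f -> cpoly g -> cpoly (fun z => f z * g z).
Proof.
move=> [fr fi] [gr gi]; split.
  under eq_fun do rewrite ReM; apply: ispolyD; last apply: ispolyN; exact: ispolyM.
by under eq_fun do rewrite ImM; apply: ispolyD; exact: ispolyM.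
Qed.
Lemma cpolyB (f g : 'rV[R]_n -> R[i]) : cpoly f -> cpoly g -> cpoly (fun z => f z - g z).
Proof.
move=> pf pg; apply: (@cpoly_ext (fun z => f z + (-1) * g z)).
  by move=> z; rewrite mulN1r.
by apply: cpolyD => //; apply: cpolyM => //; exact: cpoly_cst.
Qed.
Lemma cpoly_sum (I : Type) (r : seq I) (F : I -> 'rV[R]_n -> R[i]) :
  (forall i, cpoly (F i)) -> cpoly (fun z => \sum_(i <- r) F i z).
Proof.
move=> pF; elim: r => [|i r IHr].
  by apply: cpoly_ext (cpoly_cst 0) => z; rewrite big_nil.
by apply: cpoly_ext (cpolyD (pF i) IHr) => z; rewrite big_cons.
Qed.
Lemma cpoly_meval m (p : mpoly.mpoly m R[i]) (v : 'rV[R]_n -> 'I_m -> R[i]) :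
  (forall i, cpoly (fun x => v x i)) -> cpoly (fun x => mpoly.meval (v x) p).
Proof.
move=> cv; apply: (@cpoly_ext (fun w => \sum_(m <- mpoly.msupp p)
  mpoly.mcoeff m p * \prod_i v w i ^+ mpoly.fun_of_multinom m i)).
  by move=> w; rewrite mpoly.mevalE.
apply: cpoly_sum => mm; apply: cpolyM; first exact: cpoly_cst.
elim: (index_enum _) => [|i r IHr].
  by apply: (@cpoly_ext (fun=> 1)) (cpoly_cst 1) => w; rewrite big_nil.
apply: cpoly_ext; first by move=> w; rewrite big_cons.
apply: cpolyM IHr; elim: (mpoly.fun_of_multinom mm i) => [|e IHe].
  exact: (cpoly_cst 1).
apply: cpoly_ext; first by move=> w; rewrite exprS.
exact: cpolyM.
Qed.

Lemma eqset_cpoly (J : finType) (g : J -> 'rV[R]_n -> R[i]) :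
  (forall j, cpoly (g j)) -> eqset (fun z => forall j, g j z = 0).
Proof.
move=> hg; exists (J * bool)%type, (fun u => if u.2 then fun z => complex.Re (g u.1 z)
  else fun z => complex.Im (g u.1 z)); split.
  by case=> j [] /=; apply: eqfun_poly; have [] := hg j.
move=> z; split=> [h [j []] /=|h j]; rewrite ?h //.
by apply: complex_eq; [exact: (h (j, true))|exact: (h (j, false))].
Qed.

Lemma eqset_cpoly1 (g : 'rV[R]_n -> R[i]) : cpoly g -> eqset (fun z => g z = 0).
Proof.
move=> hg; have [J [f [hf SE]]] := @eqset_cpoly unit (fun=> g) (fun=> hg).
exists J, f; split=> // z; rewrite -SE; split=> [h []//|]; exact.
Qed.

End EquationSets.

Section Projection.
Variables (R : realType) (n m : nat).

(** A bounded [eqset] is compact, so its projection is closed; the set itself exhibits the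
    projection as subanalytic. *)
Lemma eqset_projection (S : 'rV[R]_(n + m) -> Prop) : eqset S ->
  (exists M : R, forall z, S z -> `|z| <= M) ->
  closed [set lsubmx z | z in [set z | S z]] /\
  subanalytic [set lsubmx z | z in [set z | S z]].
Proof.
move=> eS [M hM]; have cS : compact [set z | S z].
  apply: bounded_closed_compact; last exact: eqset_closed.
  exists M; split; first exact: num_real.
  by move=> x Mx z /hM; move=> /le_trans; apply; exact: ltW.
split; last first.
  move=> a; exists setT; split; first exact: openT.
  split=> //; exists m, [set z | S z]; split; first exact: eqset_semianalytic.
  by split; [exists M|rewrite setIT].
apply: compact_closed; first exact: norm_hausdorff.
apply: continuous_compact => //; apply: continuous_subspaceT => z.
apply: continuous_row_mk => i; rewrite [X in _ --> X]mxE.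
under eq_fun do rewrite mxE.
exact: coord_continuous.
Qed.

End Projection.

(** * Strong genericity *)

Section AlgebraicConditions.
Variables (R : realType) (N : nat).
Implicit Types (l : 'rV[R]_N) (k : R) (x y : 'rV[R[i]]_(N + N)).

(** The vertex conditions with cos(k l_j) and sin(k l_j) as separate unknowns and the factor k
    cancelled: finitely many polynomial equations. *)
Definition alg_vertex (c s : 'I_N -> R[i]) (A B : 'I_N -> R[i]) : Prop :=
  ((forall p : 'I_N * 'I_N, A p.1 - A p.2 = 0) /\
   (forall p : 'I_N * 'I_N, (A p.1 * c p.1 + B p.1 * s p.1) - (A p.2 * c p.2 + B p.2 * s p.2) = 0)) /\
  (\sum_j B j = 0 /\ \sum_j (A j * s j - B j * c j) = 0).

Lemma cos_kl l k j : cos (k * l 0 j) = cos (hphase l k j) ^+ 2 - sin (hphase l k j) ^+ 2.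
Proof.
have -> : k * l 0 j = hphase l k j + hphase l k j by rewrite /hphase; field.
by rewrite cosD -!expr2.
Qed.

Lemma sin_kl l k j : sin (k * l 0 j) = 2 * cos (hphase l k j) * sin (hphase l k j).
Proof.
have -> : k * l 0 j = hphase l k j + hphase l k j by rewrite /hphase; field.
by rewrite sinD; ring.
Qed.

Definition ckl l k j : R[i] := cR (cos (k * l 0 j)).
Definition skl l k j : R[i] := cR (sin (k * l 0 j)).

Lemma end_value l k x j : coefA x j * ckl l k j + coefB x j * skl l k j =
  midE l k x j * cR (cos (hphase l k j)) + midO l k x j * cR (sin (hphase l k j)).
Proof.
rewrite /ckl /skl cos_kl sin_kl !(cRB, cRM, cRX) /midE /midO.
have -> : cR 2 = 2 :> R[i] by rewrite (_ : 2 = 1 + 1) ?cRD ?cR1.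
ring.
Qed.

Lemma end_slope l k x j : coefA x j * skl l k j - coefB x j * ckl l k j =
  midE l k x j * cR (sin (hphase l k j)) - midO l k x j * cR (cos (hphase l k j)).
Proof.
rewrite /ckl /skl cos_kl sin_kl !(cRB, cRM, cRX) /midE /midO.
have -> : cR 2 = 2 :> R[i] by rewrite (_ : 2 = 1 + 1) ?cRD ?cR1.
ring.
Qed.

Lemma vertex_conditions_alg l k x : 0 < k -> vertex_conditions l k x <->
  alg_vertex (ckl l k) (skl l k) (coefA x) (coefB x).
Proof.
move=> k0; have k0' : cR k != 0 by rewrite cR_eq0 gt_eqF.
have e0 j : efun k x j 0 = coefA x j by rewrite (efun0 l) (coefA_mid l k).
have el j : efun k x j (l 0 j) = coefA x j * ckl l k j + coefB x j * skl l k j.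
  by rewrite efun_end end_value.
have d0 : \sum_(j < N) cderiv (efun k x j) 0 = cR k * \sum_j coefB x j.
  rewrite mulr_sumr; apply: eq_bigr => j _; rewrite (cderiv_efun0 l) (coefB_mid l k); ring.
have dl : \sum_(j < N) - cderiv (efun k x j) (l 0 j) =
    cR k * \sum_j (coefA x j * skl l k j - coefB x j * ckl l k j).
  rewrite mulr_sumr; apply: eq_bigr => j _; rewrite cderiv_efun_end end_slope; ring.
rewrite /vertex_conditions d0 dl /alg_vertex; split.
  move=> [h0 [hl [/eqP s0 /eqP s1]]]; move: s0 s1.
  rewrite !mulf_eq0 (negbTE k0') /= => /eqP s0 /eqP s1; split=> //; split=> -[i j] /=.
    by apply/eqP; rewrite subr_eq0 -!e0; apply/eqP; exact: h0.
  by apply/eqP; rewrite subr_eq0 -!el; apply/eqP; exact: hl.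
move=> [[h0 hl] [s0 s1]]; rewrite s0 s1 mulr0; split; [|split=> //] => i j.
  by rewrite !e0; apply/eqP; rewrite -subr_eq0; apply/eqP; exact: (h0 (i, j)).
by rewrite !el; apply/eqP; rewrite -subr_eq0; apply/eqP; exact: (hl (i, j)).
Qed.

Lemma vertex_conditions_lin l k (a : R[i]) x y : 0 < k ->
  vertex_conditions l k x -> vertex_conditions l k y -> vertex_conditions l k (x + a *: y).
Proof.
move=> k0 /(vertex_conditions_mid l x k0)[[xE xE0] [xO xO0]].
move=> /(vertex_conditions_mid l y k0)[[yE yE0] [yO yO0]].
have EE j : midE l k (x + a *: y) j = midE l k x j + a * midE l k y j.
  by rewrite /midE /Defs.coefA /Defs.coefB !mxE; ring.
have OO j : midO l k (x + a *: y) j = midO l k x j + a * midO l k y j.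
  by rewrite /midO /Defs.coefA /Defs.coefB !mxE; ring.
apply/(vertex_conditions_mid _ _ k0); split; split.
- move=> i j; rewrite /= !EE (mulrDl (midE l k x i)) (mulrDl (midE l k x j)) (xE i j).
  by rewrite -[X in _ + X = _]mulrA (yE i j) mulrA.
- rewrite (eq_bigr (fun j => midE l k x j * cR (sin (hphase l k j)) + a * (midE l k y j * cR (sin (hphase l k j))))); last first.
    by move=> j _; rewrite EE (mulrDl (midE l k x j)) mulrA.
  by rewrite big_split -mulr_sumr /= xE0 yE0 mulr0 addr0.
- move=> i j; rewrite /= !OO (mulrDl (midO l k x i)) (mulrDl (midO l k x j)) (xO i j).
  by rewrite -[X in _ + X = _]mulrA (yO i j) mulrA.
- rewrite (eq_bigr (fun j => midO l k x j * cR (cos (hphase l k j)) + a * (midO l k y j * cR (cos (hphase l k j))))); last first.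
    by move=> j _; rewrite OO (mulrDl (midO l k x j)) mulrA.
  by rewrite big_split -mulr_sumr /= xO0 yO0 mulr0 addr0.
Qed.

Definition hdot x y : R[i] := \sum_i x 0 i * (y 0 i)^*%C.
Definition hnorm2 x : R := \sum_i (complex.Re (x 0 i) ^+ 2 + complex.Im (x 0 i) ^+ 2).

Lemma hdotxx x : hdot x x = cR (hnorm2 x).
Proof.
rewrite /hdot /hnorm2 cR_sum; apply: eq_bigr => i _.
by apply: complex_eq; case: (x 0 i) => a b /=; ring.
Qed.

Lemma hnorm2_ge0 x : 0 <= hnorm2 x.
Proof. by apply: sumr_ge0 => i _; rewrite addr_ge0 ?sqr_ge0. Qed.

Lemma hnorm2_gt0 x : x != 0 -> 0 < hnorm2 x.
Proof.
move=> x0; rewrite lt_neqAle hnorm2_ge0 andbT eq_sym; apply: contra x0 => /eqP h.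
apply/eqP/rowP => i; rewrite mxE; move/eqP: h; rewrite /hnorm2 psumr_eq0; last first.
  by move=> j _; rewrite addr_ge0 ?sqr_ge0.
move=> /allP/(_ i); rewrite mem_index_enum => /(_ isT) /=.
rewrite paddr_eq0 ?sqr_ge0 // !sqrf_eq0 => /andP[/eqP a /eqP b].
exact: complex_eq.
Qed.

Lemma hnorm2Z (c : R[i]) x : hnorm2 (c *: x) =
  (complex.Re c ^+ 2 + complex.Im c ^+ 2) * hnorm2 x.
Proof.
rewrite /hnorm2 mulr_sumr; apply: eq_bigr => i _; rewrite mxE.
by case: c => a b; case: (x 0 i) => u v /=; ring.
Qed.

Lemma normalize x : x != 0 -> exists2 c : R[i], c != 0 & hnorm2 (c *: x) = 1.
Proof.
move=> x0; have h0 := hnorm2_gt0 x0; exists (cR (Num.sqrt (hnorm2 x))^-1).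
  by rewrite cR_eq0 invr_eq0 gt_eqF // sqrtr_gt0.
rewrite hnorm2Z /= expr0n addr0 exprVn sqr_sqrtr ?hnorm2_ge0 //.
by rewrite mulVf // gt_eqF.
Qed.

Lemma hdotZl (c : R[i]) x y : hdot (c *: x) y = c * hdot x y.
Proof. by rewrite /hdot mulr_sumr; apply: eq_bigr => i _; rewrite mxE mulrA. Qed.
Lemma hdotDl x y z : hdot (x + y) z = hdot x z + hdot y z.
Proof. by rewrite /hdot -big_split; apply: eq_bigr => i _; rewrite mxE mulrDl. Qed.

Lemma vertex_conditionsZ l k (a : R[i]) x : 0 < k ->
  vertex_conditions l k x -> vertex_conditions l k (a *: x).
Proof.
move=> k0 Vx; have := vertex_conditions_lin (a - 1) k0 Vx Vx.
by rewrite -{1}(scale1r x) -scalerDl addrC subrK.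
Qed.

(** Gram-Schmidt. Linear independence is an open condition; orthonormality is given by equations and
    keeps the model bounded. *)
Lemma nonsimple_orthonormal l k x : 0 < k -> x != 0 -> vertex_conditions l k x ->
  ~ simple_eigenvalue l k <-> exists x y, [/\ vertex_conditions l k x,
   vertex_conditions l k y, hnorm2 x = 1, hnorm2 y = 1 & hdot x y = 0].
Proof.
move=> k0 x0 Vx; split; last first.
  move=> [y [z [Vy Vz y1 z1 yz]]]; apply/(nonsimpleP x0 Vx); exists y, z; split=> //.
  have nz w : hnorm2 w = 1 -> w != 0.
    move=> w1; apply/eqP => w0; move: w1; rewrite w0 /hnorm2 big1.
      by move/eqP; rewrite eq_sym oner_eq0.
    by move=> i _; rewrite mxE /= expr0n addr0.
  apply/free_pair; split; first exact: nz.
  move=> c yE; move/eqP: (nz y y1); apply; rewrite yE.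
  by move: yz; rewrite yE hdotZl hdotxx z1 cR1 mulr1 => ->; rewrite scale0r.
move=> /(nonsimpleP x0 Vx)[y [z [Vy Vz /free_pair[z0 yz]]]].
have [c c0 cz] := normalize z0.
pose z' := c *: z; have Vz' : vertex_conditions l k z' by exact: vertex_conditionsZ.
pose y' := y + (- hdot y z') *: z'.
have y'0 : y' != 0.
  apply/eqP => y'E; apply: (yz (hdot y z' * c)); rewrite -scalerA -/z'.
  by apply/eqP; rewrite -subr_eq0 -scaleNr; apply/eqP.
have Vy' : vertex_conditions l k y' by exact: vertex_conditions_lin.
have [d d0 dy] := normalize y'0.
exists (d *: y'), z'; split=> //; first exact: vertex_conditionsZ.
by rewrite hdotZl hdotDl hdotZl hdotxx cz cR1 mulr1 subrr mulr0.
Qed.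

End AlgebraicConditions.

(** * The failure set as a projection *)

Section SemianalyticModel.
Variables (R : realType) (N : nat) (anti : bool).
Variable q : mpoly.mpoly (N + (N + N + N + N)) R[i].

(* Auxiliary coordinates: per edge theta, cos theta, sin theta and two slack
   variables; real and imaginary parts of two vectors of C^2N; k and two slack
   variables.  Slack variables turn the bounds on l and k into equations. *)
Local Notation I := (('I_N * 'I_5) + (('I_(N + N) * 'I_4) + 'I_3))%type.
Local Notation m := #|{: I}|.

Definition aux (z : 'rV[R]_(N + m)) (u : I) : R := z 0 (rshift N (enum_rank u)).
Definition len (z : 'rV[R]_(N + m)) (j : 'I_N) : R := z 0 (lshift m j).
Definition edge_aux z (t : nat) (j : 'I_N) : R := aux z (inl (j, inord t)).
Definition vec_aux z (t : nat) (i : 'I_(N + N)) : R := aux z (inr (inl (i, inord t))).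
Definition k_aux z (t : nat) : R := aux z (inr (inr (inord t))).
Definition cvec z (b : bool) (i : 'I_(N + N)) : R[i] :=
  (vec_aux z (if b then 2 else 0) i +i* vec_aux z (if b then 3 else 1) i)%C.

Definition mk_point (l : 'rV[R]_N) (w : I -> R) : 'rV[R]_(N + m) :=
  row_mx l (\row_r w (enum_val r)).

Lemma aux_mk l w u : aux (mk_point l w) u = w u.
Proof. by rewrite /aux /mk_point row_mxEr mxE enum_rankK. Qed.

Variable M : nat.
Let b : R := M.+1%:R.

Definition base z : Prop :=
  (((forall j, k_aux z 0 * len z j - edge_aux z 0 j = 0) /\
    (forall j, edge_aux z 1 j - cos (edge_aux z 0 j) = 0)) /\
   ((forall j, edge_aux z 2 j - sin (edge_aux z 0 j) = 0) /\
    (forall j, len z j - b^-1 - edge_aux z 3 j * edge_aux z 3 j = 0))) /\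
  ((forall j, b - len z j - edge_aux z 4 j * edge_aux z 4 j = 0) /\
   ((k_aux z 0 - b^-1 - k_aux z 1 * k_aux z 1 = 0) /\
    (b - k_aux z 0 - k_aux z 2 * k_aux z 2 = 0))).

Lemma ispoly_aux u : ispoly (fun z => aux z u). Proof. exact: ispoly_coord. Qed.
Lemma ispoly_len j : ispoly (fun z => len z j). Proof. exact: ispoly_coord. Qed.

Ltac poly := repeat first [exact: ispoly_aux | exact: ispoly_len | exact: ispoly_cst
  | apply: ispolyD | apply: ispolyN | apply: ispolyM].

Lemma base_eqset : eqset base.
Proof.
apply: eqsetI; apply: eqsetI; [apply: eqsetI|apply: eqsetI| |apply: eqsetI].
- by apply: eqset_forall => j; apply: eqfun_poly; poly.
- by apply: eqset_forall => j; apply: eqfunB; [apply: eqfun_poly; poly|exact: eqfun_cos].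
- by apply: eqset_forall => j; apply: eqfunB; [apply: eqfun_poly; poly|exact: eqfun_sin].
- by apply: eqset_forall => j; apply: eqfun_poly; poly.
- by apply: eqset_forall => j; apply: eqfun_poly; poly.
- by apply: eqset1; apply: eqfun_poly; poly.
- by apply: eqset1; apply: eqfun_poly; poly.
Qed.

Definition zc z j : R[i] := cR (edge_aux z 1 j).
Definition zs z j : R[i] := cR (edge_aux z 2 j).
Definition zA z v j : R[i] := cvec z v (lshift N j).
Definition zB z v j : R[i] := cvec z v (rshift N j).
Definition vec_unit z v : Prop :=
  \sum_i (vec_aux z (if v then 2 else 0) i * vec_aux z (if v then 2 else 0) i +
          vec_aux z (if v then 3 else 1) i * vec_aux z (if v then 3 else 1) i) - 1 = 0.

Lemma cpoly_cvec v i : cpoly (fun z => cvec z v i).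
Proof. by split; exact: ispoly_aux. Qed.
Lemma cpoly_zc j : cpoly (fun z => zc z j).
Proof. by apply: cpoly_real; exact: ispoly_aux. Qed.
Lemma cpoly_zs j : cpoly (fun z => zs z j).
Proof. by apply: cpoly_real; exact: ispoly_aux. Qed.

Ltac cpoly := repeat first [exact: cpoly_cvec | exact: cpoly_zc | exact: cpoly_zs
  | exact: cpoly_cst | apply: cpolyB | apply: cpolyD | apply: cpolyM].

Lemma vertex_eqset v : eqset (fun z => alg_vertex (zc z) (zs z) (zA z v) (zB z v)).
Proof.
apply: eqsetI; apply: eqsetI.
- by apply: eqset_cpoly => p; cpoly.
- by apply: eqset_cpoly => p; cpoly.
- by apply: eqset_cpoly1; apply: cpoly_sum => j; cpoly.
- by apply: eqset_cpoly1; apply: cpoly_sum => j; cpoly.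
Qed.

Lemma unit_eqset v : eqset (fun z => vec_unit z v).
Proof.
apply: eqset1; apply: eqfun_poly; apply: ispolyD; last exact: ispoly_cst.
by apply: ispoly_sum => i; poly.
Qed.

Definition dot0 z : Prop := \sum_i cvec z false i * (cvec z true i)^*%C = 0.

Lemma dot0_eqset : eqset dot0.
Proof.
apply: eqset_cpoly1; apply: cpoly_sum => i; apply: cpolyM; first exact: cpoly_cvec.
by split; [exact: ispoly_aux|apply: ispolyN; exact: ispoly_aux].
Qed.

Definition zC z j := zA z false j * zc z j + zB z false j * zs z j.
Definition zD z j := zA z false j * zs z j - zB z false j * zc z j.

Definition zpoint z : 'I_(N + (N + N + N + N)) -> R[i] := fun i =>
  match fintype.split i with
  | inl j => zc z j + 'i%C * zs z j
  | inr mm => match fintype.split mm with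
    | inl m1 => match fintype.split m1 with
      | inl m2 => match fintype.split m2 with
        | inl j => zA z false j
        | inr j => zB z false j
        end
      | inr j => zC z j
      end
    | inr j => zD z j
    end
  end.

(** Parity as equations on the trace: C = A and D = B, or C = -A and D = -B. The second vector is
    fixed at 0, which keeps the model bounded. *)
Definition parity_zero z : Prop :=
  (forall j, zC z j - cR (psign R anti) * zA z false j = 0) /\
  ((forall j, zD z j - cR (psign R anti) * zB z false j = 0) /\
   (mpoly.meval (zpoint z) q = 0 /\ (forall i, cvec z true i = 0))).

Lemma parity_zero_eqset : eqset parity_zero.
Proof.
have pC j : cpoly (fun z => zC z j) by cpoly.
have pD j : cpoly (fun z => zD z j) by cpoly.
apply: eqsetI; [|apply: eqsetI; [|apply: eqsetI]].
- by apply: eqset_cpoly => j; apply: cpolyB => //; cpoly.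
- by apply: eqset_cpoly => j; apply: cpolyB => //; cpoly.
- apply: eqset_cpoly1; apply: cpoly_meval => i; rewrite /zpoint.
  case: (fintype.split i) => [j|mm]; first by cpoly.
  case: (fintype.split mm) => [m1|j] //; case: (fintype.split m1) => [m2|j] //.
  by case: (fintype.split m2) => j; exact: cpoly_cvec.
- by apply: eqset_cpoly => i; cpoly.
Qed.

(* [model1]: two orthonormal eigenvectors.  [model2]: a unit eigenvector of the given parity
   at which q vanishes. *)
Definition model1 z : Prop := base z /\
  ((alg_vertex (zc z) (zs z) (zA z false) (zB z false) /\ vec_unit z false) /\
   ((alg_vertex (zc z) (zs z) (zA z true) (zB z true) /\ vec_unit z true) /\ dot0 z)).

Definition model2 z : Prop := base z /\
  ((alg_vertex (zc z) (zs z) (zA z false) (zB z false) /\ vec_unit z false) /\ parity_zero z).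

Lemma model1_eqset : eqset model1.
Proof.
apply: eqsetI; first exact: base_eqset.
apply: eqsetI; [|apply: eqsetI].
- by apply: eqsetI; [exact: vertex_eqset|exact: unit_eqset].
- by apply: eqsetI; [exact: vertex_eqset|exact: unit_eqset].
- exact: dot0_eqset.
Qed.

Lemma model2_eqset : eqset model2.
Proof.
apply: eqsetI; first exact: base_eqset.
apply: eqsetI; [|exact: parity_zero_eqset].
by apply: eqsetI; [exact: vertex_eqset|exact: unit_eqset].
Qed.

End SemianalyticModel.

Section StronglyGeneric.
Variables (R : realType) (N : nat) (anti : bool).
Variable q : mpoly.mpoly (N + (N + N + N + N)) R[i].
Implicit Types (l : 'rV[R]_N) (k : R) (x y : 'rV[R[i]]_(N + N)).
Hypothesis hq : homog_in_trace q.

Local Notation I := (('I_N * 'I_5) + (('I_(N + N) * 'I_4) + 'I_3))%type.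
Local Notation m := #|{: I}|.
Implicit Types z : 'rV[R]_(N + m).

Definition xof (z : 'rV[R]_(N + m)) (v : bool) : 'rV[R[i]]_(N + N) := \row_i cvec z v i.

Lemma coefA_xof z v j : coefA (xof z v) j = zA z v j.
Proof. by rewrite /Defs.coefA mxE. Qed.
Lemma coefB_xof z v j : coefB (xof z v) j = zB z v j.
Proof. by rewrite /Defs.coefB mxE. Qed.

Lemma lsubmx_len (z : 'rV[R]_(N + m)) j : lsubmx z 0 j = len z j.
Proof. by rewrite mxE. Qed.

Lemma base_spec M z : base M z ->
  [/\ M.+1%:R^-1 <= k_aux z 0 <= M.+1%:R,
      forall j, M.+1%:R^-1 <= lsubmx z 0 j <= M.+1%:R,
      (forall j, edge_aux z 0 j = k_aux z 0 * lsubmx z 0 j),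
      (forall j, zc z j = ckl (lsubmx z) (k_aux z 0) j) &
      forall j, zs z j = skl (lsubmx z) (k_aux z 0) j].
Proof.
move=> [[[th hc] [hs hl]] [hl' [hk hk']]].
have kl j : edge_aux z 0 j = k_aux z 0 * lsubmx z 0 j.
  by have := th j; rewrite lsubmx_len; lra.
move: hl hl' hk hk' => /=; move: (M.+1%:R^-1 : R) (M.+1%:R : R) => ib bb hl hl' hk hk'.
split=> //.
- have := sqr_ge0 (k_aux z 1); have := sqr_ge0 (k_aux z 2); rewrite !expr2.
  by move=> h1 h2; apply/andP; split; lra.
- move=> j; rewrite lsubmx_len; have := hl j; have := hl' j.
  have := sqr_ge0 (edge_aux z 3 j); have := sqr_ge0 (edge_aux z 4 j); rewrite !expr2.
  by move=> h1 h2 h3 h4; apply/andP; split; lra.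
- by move=> j; rewrite /zc /ckl -kl; congr cR; have := hc j; lra.
- by move=> j; rewrite /zs /skl -kl; congr cR; have := hs j; lra.
Qed.

Lemma vertex_xof M z v : base M z ->
  alg_vertex (zc z) (zs z) (zA z v) (zB z v) <->
  vertex_conditions (lsubmx z) (k_aux z 0) (xof z v).
Proof.
move=> /base_spec[/andP[k1 _] _ _ hc hs].
have k0 : 0 < k_aux z 0 by apply: lt_le_trans k1; rewrite invr_gt0.
rewrite (vertex_conditions_alg _ _ k0).
have -> : zc z = ckl (lsubmx z) (k_aux z 0) by apply/funext.
have -> : zs z = skl (lsubmx z) (k_aux z 0) by apply/funext.
have -> : zA z v = coefA (xof z v) by apply/funext => j; rewrite coefA_xof.
have -> : zB z v = coefB (xof z v) by apply/funext => j; rewrite coefB_xof.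
by [].
Qed.

Lemma vec_unit_xof z v : vec_unit z v <-> hnorm2 (xof z v) = 1.
Proof.
rewrite /vec_unit /hnorm2; under [in X in _ <-> X]eq_bigr do rewrite mxE /= !expr2.
by split=> h; apply/eqP; [rewrite -subr_eq0; apply/eqP | rewrite subr_eq0; apply/eqP].
Qed.

Lemma hnorm2_neq0 x : hnorm2 x = 1 -> x != 0.
Proof.
move=> x1; apply/eqP => x0; move: x1; rewrite x0 /hnorm2 big1.
  by move/eqP; rewrite eq_sym oner_eq0.
by move=> i _; rewrite mxE /= expr0n addr0.
Qed.

Lemma base_pos M z : base M z -> 0 < k_aux z 0 /\ pos_lengths (lsubmx z).
Proof.
move=> /base_spec[/andP[k1 _] hl _ _ _].
have i0 : 0 < M.+1%:R^-1 :> R by rewrite invr_gt0.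
split; first exact: lt_le_trans k1.
by move=> j; have /andP[+ _] := hl j; exact: lt_le_trans.
Qed.

Lemma model1_bad M z : model1 M z ->
  pos_lengths (lsubmx z) /\ ~ good_set (propP anti q) (lsubmx z).
Proof.
move=> [bz [[vx ux] [[vy uy] xy]]]; have [k0 lp] := base_pos bz; split=> // G.
move/(vertex_xof _ bz): vx => vx; move/(vertex_xof _ bz): vy => vy.
move/vec_unit_xof: ux => ux; move/vec_unit_xof: uy => uy.
have x0 := hnorm2_neq0 ux.
have [s1 _] := G (k_aux z 0) (xof z false) (conj k0 (conj x0 vx)).
have /(nonsimple_orthonormal k0 x0 vx) : exists x y, [/\ vertex_conditions (lsubmx z) (k_aux z 0) x,
   vertex_conditions (lsubmx z) (k_aux z 0) y, hnorm2 x = 1, hnorm2 y = 1 & hdot x y = 0].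
  exists (xof z false), (xof z true); split=> //.
  by rewrite -[RHS]xy /hdot; apply: eq_bigr => i _; rewrite !mxE.
by apply.
Qed.

Lemma qpoint_zpoint M z : base M z ->
  qpoint (lsubmx z) (k_aux z 0) (trace_vec (lsubmx z) (k_aux z 0) (xof z false)) =1 zpoint z.
Proof.
move=> bz i; have [_ _ _ hc hs] := base_spec bz.
rewrite /qpoint /zpoint; case: (fintype.split i) => [j|mm].
  by rewrite expi_real hc hs.
have hA j := coefA_xof z false j; have hB j := coefB_xof z false j.
rewrite /trace_vec; case: (fintype.split mm) => [m1|j]; last first.
  by rewrite -end_slope /zD hA hB hc hs.
case: (fintype.split m1) => [m2|j]; last by rewrite -end_value /zC hA hB hc hs.
by case: (fintype.split m2) => j; rewrite -?coefA_mid -?coefB_mid ?hA ?hB.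
Qed.

(** C_j = A_j reads O_j sin phi_j = 0 and D_j = B_j reads O_j cos phi_j = 0, hence O_j = 0; the
    opposite signs give E_j = 0 in the same way. *)
Lemma parity_alg l k x : 0 < k -> pos_lengths l ->
  has_parity anti l k x <-> forall j,
   coefA x j * ckl l k j + coefB x j * skl l k j = cR (psign R anti) * coefA x j /\
   coefA x j * skl l k j - coefB x j * ckl l k j = cR (psign R anti) * coefB x j.
Proof.
move=> k0 lp; rewrite (parity_pcoef _ _ k0 lp).
have n2 : (2 : R[i]) != 0 by [].
have hc j := cR_cos2sin2 (hphase l k j).
rewrite /psign; case: anti; split=> h j.
- rewrite end_value end_slope (coefA_mid l k) (coefB_mid l k) h cRN cR1.
  by split; ring.
- have [h1 h2] := h j; move: h1 h2.
  rewrite end_value end_slope [in X in _ = X -> _](coefA_mid l k) [in X in _ -> _ = X -> _](coefB_mid l k) cRN cR1.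
  set c := cR (cos _); set s := cR (sin _); set E := midE l k x j; set O := midO l k x j => h1 h2.
  have Ec : 2 * (E * c) = 0 by transitivity (E * c + O * s - -1 * (E * c - O * s)); [ring|rewrite h1 subrr].
  have Es : 2 * (E * s) = 0 by transitivity (E * s - O * c - -1 * (E * s + O * c)); [ring|rewrite h2 subrr].
  apply: (@mulfI _ 2) => //; rewrite mulr0.
  transitivity (2 * E * (c * c + s * s)); first by rewrite hc mulr1.
  by transitivity (2 * (E * c) * c + 2 * (E * s) * s); [ring|rewrite Ec Es !mul0r addr0].
- rewrite end_value end_slope (coefA_mid l k) (coefB_mid l k) h cR1.
  by split; ring.
- have [h1 h2] := h j; move: h1 h2.
  rewrite end_value end_slope [in X in _ = X -> _](coefA_mid l k) [in X in _ -> _ = X -> _](coefB_mid l k) cR1.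
  set c := cR (cos _); set s := cR (sin _); set E := midE l k x j; set O := midO l k x j => h1 h2.
  have Os : 2 * (O * s) = 0 by transitivity (E * c + O * s - 1 * (E * c - O * s)); [ring|rewrite h1 subrr].
  have Oc : 2 * (O * c) = 0 by transitivity (1 * (E * s + O * c) - (E * s - O * c)); [ring|rewrite h2 subrr].
  apply: (@mulfI _ 2) => //; rewrite mulr0.
  transitivity (2 * O * (c * c + s * s)); first by rewrite hc mulr1.
  by transitivity (2 * (O * c) * c + 2 * (O * s) * s); [ring|rewrite Oc Os !mul0r addr0].
Qed.

Lemma model2_bad M z : model2 anti q M z ->
  pos_lengths (lsubmx z) /\ ~ good_set (propP anti q) (lsubmx z).
Proof.
move=> [bz [[vx ux] [hC [hD [hm _]]]]]; have [k0 lp] := base_pos bz; split=> // G.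
have [_ _ _ hc hs] := base_spec bz.
move/(vertex_xof _ bz): vx => vx; move/vec_unit_xof: ux => ux.
have x0 := hnorm2_neq0 ux.
have [_] := G (k_aux z 0) (xof z false) (conj k0 (conj x0 vx)).
have px : has_parity anti (lsubmx z) (k_aux z 0) (xof z false).
  apply/parity_alg => // j; rewrite -hc -hs coefA_xof coefB_xof.
  by split; apply/eqP; rewrite -subr_eq0; apply/eqP; [exact: hC|exact: hD].
move=> /(_ px _ (trace_vecP _ _ k0)) /negP; apply; rewrite /qeval.
by rewrite (mpoly.meval_eq (v2 := zpoint z)) ?hm //; exact: qpoint_zpoint bz.
Qed.

Definition witness_coord l k x y (u : I) : R :=
  match u with
  | inl (j, t) => nth 0 [:: k * l 0 j; cos (k * l 0 j); sin (k * l 0 j); 0; 0] t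
  | inr (inl (i, t)) => nth 0 [:: complex.Re (x 0 i); complex.Im (x 0 i);
                                 complex.Re (y 0 i); complex.Im (y 0 i)] t
  | inr (inr t) => nth 0 [:: k; 0; 0] t
  end.

Definition witness_slack (M : nat) l k (u : I) : R :=
  match u with
  | inl (j, t) => nth 0 [:: 0; 0; 0; Num.sqrt (l 0 j - M.+1%:R^-1); Num.sqrt (M.+1%:R - l 0 j)] t
  | inr (inl (i, t)) => 0
  | inr (inr t) => nth 0 [:: 0; Num.sqrt (k - M.+1%:R^-1); Num.sqrt (M.+1%:R - k)] t
  end.

Definition witness M l k x y : 'rV[R]_(N + m) :=
  mk_point l (fun u => witness_coord l k x y u + witness_slack M l k u).

Lemma witness_spec M l k x y :
  let z := witness M l k x y in
  [/\ (forall j, edge_aux z 0 j = k * l 0 j) /\ (forall j, edge_aux z 1 j = cos (k * l 0 j)),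
      (forall j, edge_aux z 2 j = sin (k * l 0 j)) /\
      ((forall j, edge_aux z 3 j = Num.sqrt (l 0 j - M.+1%:R^-1)) /\
      (forall j, edge_aux z 4 j = Num.sqrt (M.+1%:R - l 0 j))),
      k_aux z 0 = k /\ (k_aux z 1 = Num.sqrt (k - M.+1%:R^-1) /\
      k_aux z 2 = Num.sqrt (M.+1%:R - k)), xof z false = x /\ xof z true = y & lsubmx z = l].
Proof.
rewrite /edge_aux /k_aux /=; split; last by rewrite /witness /mk_point row_mxKl.
- by split=> j; rewrite aux_mk /= inordK //= ?addr0 ?add0r.
- by split; [|split] => j; rewrite aux_mk /= inordK //= ?addr0 ?add0r.
- by split; [|split]; rewrite aux_mk /= inordK //= ?addr0 ?add0r.
- split; apply/rowP => i; rewrite mxE /cvec /vec_aux !aux_mk /= !inordK //= !addr0;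
  exact: complex_eq.
Qed.

Lemma witness_base M l k x y : M.+1%:R^-1 <= k <= M.+1%:R ->
  (forall j, M.+1%:R^-1 <= l 0 j <= M.+1%:R) -> base M (witness M l k x y).
Proof.
move=> /andP[k1 k2] hl; have [[h0 h1] [h2 [h3 h4]] [g0 [g1 g2]] _ hz] := witness_spec M l k x y.
have lenE j : len (witness M l k x y) j = l 0 j by rewrite -lsubmx_len hz.
rewrite /base; split; [split; split|split; [|split]] => [j|j|j|j|j||].
- by rewrite g0 lenE h0 subrr.
- by rewrite h1 h0 subrr.
- by rewrite h2 h0 subrr.
- by have /andP[a b] := hl j; rewrite lenE h3 -expr2 sqr_sqrtr ?subr_ge0 // subrr.
- by have /andP[a b] := hl j; rewrite lenE h4 -expr2 sqr_sqrtr ?subr_ge0 // subrr.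
- by rewrite g0 g1 -expr2 sqr_sqrtr ?subr_ge0 // subrr.
- by rewrite g0 g2 -expr2 sqr_sqrtr ?subr_ge0 // subrr.
Qed.

Lemma trace_vecZ l k (c : R[i]) x mm : trace_vec l k (c *: x) mm = c * trace_vec l k x mm.
Proof.
rewrite /trace_vec; case: (fintype.split mm) => [m1|j].
  case: (fintype.split m1) => [m2|j].
    by case: (fintype.split m2) => j; rewrite midEZ midOZ; ring.
  by rewrite midEZ midOZ; ring.
by rewrite midEZ midOZ; ring.
Qed.

Lemma bad_model M l : (forall j, M.+1%:R^-1 <= l 0 j <= M.+1%:R) -> pos_lengths l ->
  forall k x, M.+1%:R^-1 <= k <= M.+1%:R -> eigenpair l k x -> ~ propP anti q l k x ->
  (exists2 z, model1 M z & lsubmx z = l) \/ (exists2 z, model2 anti q M z & lsubmx z = l).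
Proof.
move=> hl lp k x hk [k0 [x0 Vx]] bad.
have vz z : base M z -> lsubmx z = l -> k_aux z 0 = k -> forall v, vertex_conditions l k (xof z v) ->
    hnorm2 (xof z v) = 1 ->
    alg_vertex (zc z) (zs z) (zA z v) (zB z v) /\ vec_unit z v.
  by move=> bz <- <- v hv hn; split; [exact/(vertex_xof _ bz)|exact/vec_unit_xof].
have [s1|ns] := pselect (simple_eigenvalue l k); last first.
  have /(nonsimple_orthonormal k0 x0 Vx)[u [v [Vu Vv u1 v1 uv]]] := ns.
  left; exists (witness M l k u v); last by have [] := witness_spec M l k u v.
  have bz := witness_base u v hk hl.
  have [_ _ [g0 _] [hu hv] hz] := witness_spec M l k u v.
  split=> //; split; first by apply: vz; rewrite ?hu.
  split; first by apply: vz; rewrite ?hv.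
  rewrite /dot0 -[RHS]uv; apply: eq_bigr => i _.
  have := congr1 (fun w : 'rV[R[i]]_(N + N) => w 0 i) hu; rewrite mxE => ->.
  by have := congr1 (fun w : 'rV[R[i]]_(N + N) => w 0 i) hv; rewrite mxE => ->.
have [px [v [tv qv]]] : has_parity anti l k x /\ exists v, is_trace l k x v /\ qeval q l k v = 0.
  apply: contrapT => H; apply: bad; split=> // px v tv; apply/eqP => qv.
  by apply: H; split=> //; exists v.
have [c c0 cx] := normalize x0.
right; exists (witness M l k (c *: x) 0); last by have [] := witness_spec M l k (c *: x) 0.
have bz := witness_base (c *: x) 0 hk hl.
have [_ _ [g0 _] [hu hv] hz] := witness_spec M l k (c *: x) 0.
set z := witness _ _ _ _ _ in bz g0 hu hv hz *.
have [_ _ _ hc hs] := base_spec bz; rewrite hz g0 in hc hs.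
have Vcx : vertex_conditions l k (c *: x) by exact: vertex_conditionsZ.
have pcx : has_parity anti l k (c *: x).
  move: px; rewrite !(parity_pcoef _ _ k0 lp); case: anti => h j.
    by rewrite midEZ h mulr0.
  by rewrite midOZ h mulr0.
split=> //; split; first by apply: vz; rewrite ?hu.
have hA j : zA z false j = coefA (c *: x) j by rewrite -hu coefA_xof.
have hB j : zB z false j = coefB (c *: x) j by rewrite -hu coefB_xof.
have /(parity_alg _ k0 lp) par := pcx.
split; [|split; [|split]].
- by move=> j; have [h _] := par j; rewrite /zC hA hB hc hs h subrr.
- by move=> j; have [_ h] := par j; rewrite /zD hA hB hc hs h subrr.
- rewrite -(mpoly.meval_eq (v1 := qpoint (lsubmx z) (k_aux z 0) (trace_vec (lsubmx z) (k_aux z 0) (xof z false)))); last exact: qpoint_zpoint bz.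
  rewrite hz g0 hu; have [d hd] := hq.
  rewrite (meval_homog hd (p' := qpoint l k (trace_vec l k x)) (kap := c)).
  + rewrite [X in _ * X](_ : _ = 0) ?mulr0 // -[RHS]qv; apply: mpoly.meval_eq => i.
    by rewrite /qpoint; case: (fintype.split i) => // mm; have /is_traceP -> := tv.
  + by move=> j; rewrite /qpoint !split_lshift.
  + by move=> mm; rewrite /qpoint !split_rshift trace_vecZ.
- by move=> i; have := congr1 (fun w : 'rV[R[i]]_(N + N) => w 0 i) hv; rewrite !mxE.
Qed.

Lemma model_bounded M (S : 'rV[R]_(N + m) -> Prop) :
  (forall z, S z -> [/\ base M z, vec_unit z false &
     (vec_unit z true \/ forall i, cvec z true i = 0)]) ->
  exists B : R, forall z, S z -> `|z| <= B.
Proof.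
move=> hS; have [b bE] : exists b, b = M.+1%:R :> R by exists M.+1%:R.
(* b^2 bounds k l_j; a squared slack variable is at most b; cosines, sines and coordinates of unit
   vectors are at most 1 in modulus. *)
exists (b ^+ 2 + b + 1) => z /hS[bz ux uy].
have b1 : 1 <= b by rewrite bE ler1n.
have b2 : b <= b ^+ 2 by rewrite expr2 ler_peMl // (le_trans _ b1).
have bi : 0 < b^-1 by rewrite invr_gt0 (lt_le_trans _ b1).
have sq (a : R) : a * a <= b -> `|a| <= b ^+ 2 + b + 1.
  move=> ab; have [a1|a1] := lerP `|a| 1; first by lra.
  have : `|a| <= `|a| * `|a| by rewrite ler_peMl // ltW.
  by rewrite -normrM ger0_norm -?expr2 ?sqr_ge0 // expr2 => ?; lra.
have [hk hl hth hc hs] := base_spec bz.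
have [[[_ ec] [es el]] [el' [ek ek']]] := bz; rewrite /= -bE in hk hl el el' ek ek'.
apply: row_norm_le => [|i]; first by lra.
rewrite -(splitK i); case: (fintype.split i) => [j|r] /=.
  have := hl j; rewrite lsubmx_len /len => /andP[h1 h2].
  by rewrite ger0_norm; lra.
rewrite -[r](enum_valK r); rewrite -/(aux z (enum_val r)).
have vecb v : vec_unit z v -> forall u, vec_aux z (if v then 2 else 0) u * vec_aux z (if v then 2 else 0) u <= b /\
    vec_aux z (if v then 3 else 1) u * vec_aux z (if v then 3 else 1) u <= b.
  rewrite /vec_unit => hv u; move: hv; rewrite (bigD1 u) //=.
  set T := \sum_(w < _ | _) _; have T0 : 0 <= T.
    by apply: sumr_ge0 => w _; rewrite addr_ge0 // -expr2 sqr_ge0.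
  have := sqr_ge0 (vec_aux z (if v then 2 else 0) u).
  have := sqr_ge0 (vec_aux z (if v then 3 else 1) u).
  by rewrite !expr2 => *; split; lra.
case: (enum_val r) => [[j t]|[[w t]|t]].
- have -> : aux z (inl (j, t)) = edge_aux z t j by rewrite /edge_aux inord_val.
  case: t => -[|[|[|[|[|//]]]]] lt /=; rewrite ?[nat_of_ord _]/=.
  + rewrite hth; have /andP[k1 k2] := hk; have /andP[l1 l2] := hl j.
    rewrite ger0_norm ?mulr_ge0 //; try lra.
    have : k_aux z 0 * lsubmx z 0 j <= b * b by apply: ler_pM => //; lra.
    by rewrite expr2; lra.
  + have := ec j => /eqP; rewrite subr_eq0 => /eqP ->.
    by have := cos_max (edge_aux z 0 j); lra.
  + have := es j => /eqP; rewrite subr_eq0 => /eqP ->.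
    by have := sin_max (edge_aux z 0 j); lra.
  + by apply: sq; have := el j; have := hl j; rewrite lsubmx_len => /andP[] *; lra.
  + by apply: sq; have := el' j; have := hl j; rewrite lsubmx_len => /andP[] *; lra.
- have -> : aux z (inr (inl (w, t))) = vec_aux z t w by rewrite /vec_aux inord_val.
  have hx := vecb false ux w.
  have hy : vec_aux z 2 w * vec_aux z 2 w <= b /\ vec_aux z 3 w * vec_aux z 3 w <= b.
    case: uy => [/vecb/(_ w)//|/(_ w)]; rewrite /cvec /= => -[-> ->].
    by rewrite mul0r; split; lra.
  case: t => -[|[|[|[|//]]]] lt /=; apply: sq; [exact: hx.1|exact: hx.2|exact: hy.1|exact: hy.2].
- have -> : aux z (inr (inr t)) = k_aux z t by rewrite /k_aux inord_val.
  have /andP[k1 k2] := hk.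
  case: t => -[|[|[|//]]] lt /=.
  + by rewrite ger0_norm; lra.
  + by apply: sq; lra.
  + by apply: sq; lra.
Qed.

Hypothesis N3 : (3 <= N)%N.
Hypothesis Qwit : exists t, Qfun anti q (tvec t) != 0.

Theorem strongly_generic_propP : strongly_generic (propP anti q).
Proof.
(* Odd indices run through the first model and even ones through the second, both with bound n /
   2. *)
pose mdl (n : nat) : 'rV[R]_(N + m) -> Prop := if odd n then model1 n./2 else model2 anti q n./2.
exists (fun n => [set lsubmx z | z in [set z | mdl n z]]).
have bad n l : [set lsubmx z | z in [set z | mdl n z]] l ->
    pos_lengths l /\ ~ good_set (propP anti q) l.
  by move=> [z /= hz <-]; move: hz; rewrite /mdl; case: odd; [exact: model1_bad|exact: model2_bad].
split=> [n|]; last first.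
  apply/seteqP; split=> [l [lp /= ng]|l [n _ /bad[lp ng]]]; last by split.
  have [k [x [ex px]]] : exists k x, eigenpair l k x /\ ~ propP anti q l k x.
    apply: contrapT => H; apply: ng => k x ex; apply: contrapT => px; apply: H.
    by exists k, x.
  have [k0 _] := ex.
  (* [B] dominates k, all l_j and their inverses, so all of these lie in [1 / (M + 1), M + 1]. *)
  pose B := k + k^-1 + \sum_j (l 0 j + (l 0 j)^-1).
  have lp' j : 0 < (l 0 j)^-1 by rewrite invr_gt0; exact: lp.
  have ki : 0 < k^-1 by rewrite invr_gt0.
  have s0 (P : pred 'I_N) : 0 <= \sum_(j | P j) (l 0 j + (l 0 j)^-1).
    by apply: sumr_ge0 => j _; rewrite addr_ge0 // ltW //; exact: lp.
  have BM := truncnS_gt B; set M := Num.truncn B in BM.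
  have bnd (a : R) : 0 < a -> a <= B -> a^-1 <= B -> M.+1%:R^-1 <= a <= M.+1%:R.
    move=> a0 aB aiB; rewrite (le_trans aB (ltW BM)) andbT.
    rewrite -[leRHS]invrK lef_pV2 ?posrE ?invr_gt0 //; exact: le_trans (ltW BM).
  have hl j : M.+1%:R^-1 <= l 0 j <= M.+1%:R.
    have lj : 0 < l 0 j by exact: lp.
    apply: bnd => //; rewrite /B (bigD1 j) //=.
      by have := s0 (fun i => i != j); have := lp' j; lra.
    by have := s0 (fun i => i != j); have := lp' j; lra.
  have hk : M.+1%:R^-1 <= k <= M.+1%:R.
    by apply: bnd => //; rewrite /B; have := s0 xpredT; lra.
  have [[z mz <-]|[z mz <-]] := bad_model hl lp hk ex px.
    exists (M.*2.+1)%N => //; exists z => //=.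
    by rewrite /mdl /= odd_double /= uphalf_double.
  by exists M.*2 => //; exists z => //=; rewrite /mdl odd_double doubleK.
have em : eqset (mdl n).
  by rewrite /mdl; case: odd; [exact: model1_eqset|exact: model2_eqset].
have [|cF sF] := eqset_projection em.
  apply: (@model_bounded n./2) => z; rewrite /mdl; case: odd.
    by move=> [bz [[_ ux] [[_ uy] _]]]; split=> //; left.
  by move=> [bz [[_ ux] [_ [_ [_ y0]]]]]; split=> //; right.
split=> //; split=> //.
by apply: (dim_le_bad N3 hq Qwit) => l /bad.
Qed.

End StronglyGeneric.

(** * Equidistribution *)

Section BoundedSequences.
Variable R : realType.
Implicit Types S T : nat -> R[i].

Definition cbounded S := exists B : R, forall n,
  `|complex.Re (S n)| <= B /\ `|complex.Im (S n)| <= B.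

Lemma cbounded_eq S T : S =1 T -> cbounded S -> cbounded T.
Proof. by move=> /funext ->. Qed.

Lemma cboundedD S T : cbounded S -> cbounded T -> cbounded (fun n => S n + T n).
Proof.
move=> [B hB] [C hC]; exists (B + C) => n; rewrite ReD ImD.
have [h1 h2] := hB n; have [h3 h4] := hC n.
by split; apply: le_trans (ler_normD _ _) _; exact: lerD.
Qed.

Lemma cboundedZ c S : cbounded S -> cbounded (fun n => c * S n).
Proof.
move=> [B hB]; exists (`|complex.Re c| * B + `|complex.Im c| * B) => n.
have [h1 h2] := hB n; rewrite ReM ImM; split.
  apply: le_trans (ler_normB _ _) _; rewrite !normrM.
  by apply: lerD; exact: ler_wpM2l.
apply: le_trans (ler_normD _ _) _; rewrite !normrM.
by apply: lerD; exact: ler_wpM2l.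
Qed.

Lemma cbounded0 : cbounded (fun=> 0).
Proof. by exists 0 => n /=; rewrite normr0. Qed.

Lemma cbounded_sum (I : Type) (r : seq I) (P : pred I) (F : I -> nat -> R[i]) :
  (forall i, P i -> cbounded (F i)) -> cbounded (fun n => \sum_(i <- r | P i) F i n).
Proof.
move=> hF; elim: r => [|i r IHr].
  by apply: cbounded_eq cbounded0 => n; rewrite big_nil.
case Pi : (P i).
  by apply: cbounded_eq (cboundedD (hF i Pi) IHr) => n; rewrite big_cons Pi.
by apply: cbounded_eq IHr => n; rewrite big_cons Pi.
Qed.

End BoundedSequences.

Section Expi.
Variable R : realType.
Implicit Types x y t : R.

Lemma expiD x y : expi (x + y) = expi x * expi y.
Proof. by rewrite /expi cosD sinD; apply: complex_eq => /=; ring. Qed.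
Lemma expi0 : expi (0 : R) = 1.
Proof. by rewrite /expi cos0 sin0. Qed.
Lemma expi_natM x n : expi (n%:R * x) = expi x ^+ n.
Proof.
elim: n => [|n IHn]; first by rewrite mul0r expi0.
by rewrite -natr1 mulrDl mul1r expiD IHn exprSr.
Qed.
Lemma expi_sum (I : Type) (r : seq I) (F : I -> R) :
  expi (\sum_(i <- r) F i) = \prod_(i <- r) expi (F i).
Proof.
by elim: r => [|i r IHr]; rewrite ?big_nil ?expi0 // !big_cons expiD IHr.
Qed.
Lemma cos_expi x : cR (cos x) = 2^-1 * (expi x + expi (- x)).
Proof.
have -> : expi x + expi (- x) = 2 * cR (cos x).
  by rewrite /expi cosN sinN; apply: complex_eq => /=; ring.
by rewrite mulKf.
Qed.

(** The sum is (z^n - 1) / (z - 1) with z = exp(ix), and the numerator is bounded. *)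
Lemma cbounded_geometric x : (forall m : int, x <> m%:~R * pi) ->
  cbounded (fun n => \sum_(m < n) expi (m%:R * x)).
Proof.
move=> hx; have z1 : expi x != 1.
  apply/eqP => /(congr1 (@complex.Im R)) /= /sin_eq0_int[m]; exact: hx.
have z0 : expi x - 1 != 0 by rewrite subr_eq0.
apply: (@cbounded_eq _ (fun n => (expi x - 1)^-1 * (expi (n%:R * x) + -1))).
  move=> n; rewrite expi_natM -[_ + -1]/(_ - 1) subrX1 mulKf //.
  by apply: eq_bigr => i _; rewrite expi_natM.
apply: cboundedZ; apply: cboundedD.
  by exists 1 => n; split; [exact: cos_max|exact: sin_max].
by exists 1 => n; rewrite /= normrN1 oppr0 normr0.
Qed.

(** Binomial expansion of (e^(it) + e^(-it))^(2M) / 4^M. The range is widened to a common [K], with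
    binomial coefficients 0, so that a product over j expands over one function type. *)
Lemma cos_power_expand t (M K : nat) : (2 * M < K)%N ->
  cR (cos t) ^+ (2 * M) = \sum_(i < K) (4^-1 ^+ M * 'C(2 * M, i)%:R) *
     expi (((M%:Z - i%:Z) *+ 2)%:~R * t).
Proof.
move=> MK; rewrite cos_expi exprMn exprDn.
rewrite (big_ord_widen K (fun i => (expi t ^+ (2 * M - i) * expi (- t) ^+ i) *+ 'C(2 * M, i))) //.
rewrite big_mkcond mulr_sumr; apply: eq_bigr => i _.
have -> : 2^-1 ^+ (2 * M) = 4^-1 ^+ M :> R[i].
  by rewrite exprM; congr (_ ^+ M); rewrite exprVn -natrX.
case: ifP => iM; last first.
  by rewrite bin_small 1?ltnNge ?mulr0 ?mul0r //; rewrite ltnS in iM; rewrite iM.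
rewrite -[RHS]mulrA -[X in _ * X = _]mulr_natl; congr (_ * (_ * _)).
rewrite -!expi_natM -expiD; congr expi.
by rewrite ltnS in iM; rewrite natrB // natrM rmorphMn rmorphB /= -!pmulrn; ring.
Qed.

End Expi.

Section Visits.
Variables (R : realType) (N : nat).
Implicit Types (om al : 'I_N -> R) (M : nat).

(** Non-resonance of the rotation by [om] modulo pi, the hypothesis of the Kronecker-Weyl
    theorem. *)
Definition freq_free om := forall r : 'I_N -> int, (exists j, r j != 0) ->
  forall m : int, \sum_j (r j)%:~R * om j <> m%:~R * pi.

(* The average of cos^(2M). *)
Definition wallis (M : nat) : R := 4^-1 ^+ M * 'C(2 * M, M)%:R.

(** In the expansion into exponentials only the constant frequency has a nonzero mean, the product
    of the [wallis] factors; every other term is a geometric sum and stays bounded. *)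
Lemma cos_product_average om al (M : 'I_N -> nat) : freq_free om -> exists B : R, forall n,
  \sum_(m < n) \prod_j cos (m%:R * om j - al j) ^+ (2 * M j) <=
    n%:R * \prod_j wallis (M j) + B.
Proof.
move=> ff; pose K := (2 * \sum_j M j).+1.
have MK j : (2 * M j < K)%N by rewrite ltnS leq_mul2l /= (bigD1 j) //= leq_addr.
pose fr (phi : {ffun 'I_N -> 'I_K}) j : int := ((M j)%:Z - (phi j)%:Z) *+ 2.
pose co (phi : {ffun 'I_N -> 'I_K}) : R[i] :=
  (\prod_j (4^-1 ^+ M j * 'C(2 * M j, phi j)%:R)) * expi (- \sum_j (fr phi j)%:~R * al j).
pose Om phi := \sum_j (fr phi j)%:~R * om j.
have expand m : cR (\prod_j cos (m%:R * om j - al j) ^+ (2 * M j)) =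
    \sum_phi co phi * expi (m%:R * Om phi).
  rewrite cRE rmorph_prod /=.
  under eq_bigr do rewrite rmorphXn /= -/(cR _) (cos_power_expand _ (MK _)).
  rewrite bigA_distr_bigA /=; apply: eq_bigr => phi _.
  rewrite big_split /= -expi_sum /co -mulrA; congr (_ * _); rewrite -expiD.
  congr expi; rewrite /Om mulr_sumr -sumrN -big_split /=; apply: eq_bigr => j _.
  by rewrite /fr; ring.
have phi0K j : (M j < K)%N by have := MK j; lia.
pose phi0 : {ffun 'I_N -> 'I_K} := [ffun j => Ordinal (phi0K j)].
have fr0 j : fr phi0 j = 0 by rewrite /fr ffunE /= subrr mul0rn.
have cb : cbounded (fun n => \sum_(phi | phi != phi0) co phi * \sum_(m < n) expi (m%:R * Om phi)).
  apply: cbounded_sum => phi pp; apply: cboundedZ; apply: cbounded_geometric.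
  apply: ff; apply: contrapT => H; move/eqP: pp; apply; apply/ffunP => j.
  rewrite ffunE; apply/val_inj => /=.
  have : fr phi j = 0 by apply/eqP/negP => /negP h; apply: H; exists j.
  by rewrite /fr => /eqP; rewrite mulrn_eq0 /= subr_eq0 => /eqP [].
have [B hB] := cb; exists B => n.
have : cR (\sum_(m < n) \prod_j cos (m%:R * om j - al j) ^+ (2 * M j)) =
    cR (n%:R * \prod_j wallis (M j)) +
    \sum_(phi | phi != phi0) co phi * \sum_(m < n) expi (m%:R * Om phi).
  transitivity (\sum_(m < n) \sum_phi co phi * expi (m%:R * Om phi)).
    by rewrite cR_sum; apply: eq_bigr => m _; exact: expand.
  rewrite exchange_big /= (bigD1 phi0) //=; congr (_ + _); last first.
    by apply: eq_bigr => phi _; rewrite mulr_sumr.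
  have -> : Om phi0 = 0 by rewrite /Om big1 // => j _; rewrite fr0 mul0r.
  under eq_bigr do rewrite mulr0 expi0 mulr1.
  rewrite sumr_const card_ord -[LHS]mulr_natl cRM; congr (_ * _).
    by rewrite cRE rmorph_nat.
  rewrite /co [X in expi (- X)]big1 ?oppr0 ?expi0 ?mulr1; last by move=> j _; rewrite fr0 mul0r.
  rewrite cRE rmorph_prod /=; apply: eq_bigr => j _.
  by rewrite /wallis ffunE /= rmorphM rmorphXn /= fmorphV !rmorph_nat.
move=> /(congr1 (@complex.Re R)); rewrite ReD /= => ->.
by rewrite lerD2l; have [+ _] := hB n; apply: le_trans; exact: ler_norm.
Qed.

Lemma wallis_ge0 M : 0 <= wallis M.
Proof. by rewrite mulr_ge0 // exprn_ge0 // invr_ge0. Qed.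

Lemma wallisS M : wallis M.+1 = wallis M * (2 * M%:R + 1) / (2 * M%:R + 2).
Proof.
have h : ((M.+1 * M.+1) * 'C(2 * M.+1, M.+1) = (2 * M.+1) * ((2 * M).+1 * 'C(2 * M, M)))%N.
  have e1 : ((2 * M).+2 * 'C((2 * M).+1, M) = M.+1 * 'C((2 * M).+2, M.+1))%N.
    exact: mul_bin_diag (2 * M).+2 M.
  have e2 : ((2 * M).+1 * 'C(2 * M, M) = ((2 * M).+1 - M) * 'C((2 * M).+1, M))%N.
    exact: mul_bin_down (2 * M).+1 M.
  have e3 : ((2 * M).+1 - M = M.+1)%N by lia.
  have e4 : (2 * M.+1 = (2 * M).+2)%N by lia.
  by rewrite e4 -mulnA -e1 e2 e3 !mulnA [(M.+1 * _)%N]mulnC.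
have hR : (M.+1%:R * M.+1%:R) * 'C(2 * M.+1, M.+1)%:R =
   (2 * M.+1%:R) * ((2 * M%:R + 1) * 'C(2 * M, M)%:R) :> R.
  have := congr1 (fun j => j%:R : R) h; rewrite /= !natrM => ->.
  by rewrite -[X in _ * (X * _) = _]natr1 natrM.
have M0 : M.+1%:R != 0 :> R by [].
have -> : 2 * M%:R + 2 = 2 * M.+1%:R :> R by rewrite -natr1; ring.
apply: (mulfI (mulf_neq0 M0 M0)); rewrite /wallis exprSr.
transitivity (4^-1 ^+ M * 4^-1 * (M.+1%:R * M.+1%:R * 'C(2 * M.+1, M.+1)%:R) : R); first by ring.
rewrite hR; field; rewrite gt_eqF //; have := ler0n R M; lra.
Qed.

(** By [wallisS] the left side does not increase with M, since (2M + 1)(2M + 3) <= (2M + 2)^2. *)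
Lemma wallis_bound M : wallis M ^+ 2 * (2 * M%:R + 1) <= 1.
Proof.
elim: M => [|M IHM]; first by rewrite /wallis expr0 bin0 !mul1r expr1n mulr0 add0r mulr1.
rewrite wallisS; set w := wallis M in IHM *.
have m0 : 0 <= M%:R :> R by [].
have m2 : 0 < 2 * M%:R + 2 :> R by lra.
rewrite (_ : _ * _ = (w ^+ 2 * (2 * M%:R + 1)) * ((2 * M%:R + 1) * (2 * M%:R + 3) / (2 * M%:R + 2) ^+ 2)); last first.
  by rewrite -natr1; field; rewrite gt_eqF.
set B := _ / _; have B1 : B <= 1 by rewrite ler_pdivrMr ?exprn_gt0 // mul1r; nra.
apply: le_trans IHM; rewrite ler_piMr // mulr_ge0 ?sqr_ge0 //; lra.
Qed.

Lemma wallis_le (d : R) M : 0 < d -> d <= 1 / 2 -> (2 * d ^+ 2)^-1 < M.+1%:R -> wallis M <= 2 * d.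
Proof.
move=> d0 d1 hM; have wb := wallis_bound M.
have d20 : 0 < 2 * d ^+ 2 by rewrite mulr_gt0 // exprn_gt0.
have hM' : 1 < M.+1%:R * (2 * d ^+ 2) by move: hM; rewrite -[X in X < _]div1r ltr_pdivrMr.
rewrite -natr1 in hM'.
have h2 : 1 <= (2 * d) ^+ 2 * (2 * M%:R + 1).
  have : d ^+ 2 <= (1 / 2) ^+ 2 by rewrite lerXn2r // nnegrE; lra.
  rewrite exprMn; nra.
rewrite -(@ler_pXn2r _ 2) ?nnegrE ?wallis_ge0 //; last by lra.
have p : 0 < 2 * M%:R + 1 :> R by rewrite ltr_wpDl // mulr_ge0.
rewrite -(ler_pM2r p); exact: le_trans wb h2.
Qed.

(* The trigonometric polynomial prod_j cos^(2M) (M ~ 1 / (2 d^2)) is at least 2^-N on the set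
   visited, and has average at most (2d)^#|J|. *)
Lemma visits_bound om al (J : pred 'I_N) (d : R) : freq_free om -> 0 < d -> d <= 1 / 2 ->
  exists B : R, forall n,
  \sum_(m < n) (`[<forall j, J j -> `|sin (m%:R * om j - al j)| <= d>])%:R <=
    2 ^+ N * ((2 * d) ^+ #|J| * n%:R + B).
Proof.
(* M0 d^2 <= 1/2 lets Bernoulli's inequality give (1 - d^2)^M0 >= 1/2, while M0 + 1 > 1 / (2 d^2) is
   what [wallis_le] needs. *)
move=> ff d0 d1; pose M0 := Num.truncn (2 * d ^+ 2)^-1.
pose M j := if J j then M0 else 0%N.
have [B hB] := cos_product_average al M ff; exists B => n.
have d20 : 0 < 2 * d ^+ 2 by rewrite mulr_gt0 // exprn_gt0.
have w0 := wallis_le d0 d1 (truncnS_gt (2 * d ^+ 2)^-1).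
apply: (@le_trans _ _ (2 ^+ N * \sum_(m < n) \prod_j cos (m%:R * om j - al j) ^+ (2 * M j))); last first.
  rewrite ler_wpM2l ?exprn_ge0 //; apply: le_trans (hB n) _; rewrite lerD2r mulrC.
  rewrite ler_wpM2r //.
  rewrite (bigID J) /= [X in _ * X]big1 ?mulr1; last first.
    by move=> j /negbTE Jj; rewrite /M Jj /wallis expr0 bin0 mulr1.
  rewrite -prodr_const; apply: ler_prod => j Jj.
  by rewrite wallis_ge0 /= /M Jj.
rewrite mulr_sumr; apply: ler_sum => m _.
have c0 (x : R) k : 0 <= cos x ^+ (2 * k) by rewrite exprM exprn_ge0 // sqr_ge0.
case: asboolP => hm; last by rewrite mulr_ge0 ?exprn_ge0 // prodr_ge0 // => j _; exact: c0.
rewrite -[X in X ^+ N](invrK 2) exprVn mulrC ler_pdivlMr ?exprn_gt0 // mul1r.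
rewrite -{1}[N]card_ord -prodr_const; apply: ler_prod => j _.
rewrite invr_ge0 ler0n /= /M; case: ifP => Jj; last by rewrite muln0 expr0; lra.
rewrite exprM cos2sin2; set s := sin _.
have s2 : s ^+ 2 <= d ^+ 2.
  have sd : `|s| <= d by exact: hm.
  by rewrite -(real_normK (num_real s)) lerXn2r ?nnegrE // ltW.
have bern (x : R) k : 0 <= x <= 1 -> 1 - k%:R * x <= (1 - x) ^+ k.
  move=> /andP[x0 x1]; elim: k => [|k IHk]; first by rewrite mul0r subr0 expr0.
  rewrite exprSr; apply: (@le_trans _ _ ((1 - k%:R * x) * (1 - x))).
    have : 0 <= k%:R * x * x by rewrite !mulr_ge0.
    by rewrite -natr1; lra.
  by rewrite ler_wpM2r // subr_ge0.
have d21 : d ^+ 2 <= (1 / 2) ^+ 2 by rewrite lerXn2r // nnegrE; lra.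
apply: le_trans (bern _ M0 _); last by rewrite sqr_ge0 /=; lra.
have : M0%:R <= (2 * d ^+ 2)^-1.
  by have /truncn_itv/andP[] : 0 <= (2 * d ^+ 2)^-1 by rewrite invr_ge0 ltW.
rewrite -[X in _ <= X]div1r ler_pdivlMr // => h.
have : M0%:R * s ^+ 2 <= M0%:R * d ^+ 2 by rewrite ler_wpM2l.
lra.
Qed.

End Visits.

Section StepChoice.
Variables (R : realType) (N : nat).
Implicit Types l : 'rV[R]_N.

(** A resonant step has the form 2 m pi / sum_j r_j l_j with integers m and r_j. There are countably
    many of them, while an interval has positive measure. *)
Lemma freq_free_step l (h0 : R) : Q_independent l -> 0 < h0 ->
  exists2 h, 0 < h < h0 & freq_free (fun j => h * l 0 j / 2).
Proof.
move=> ql h00; apply: contrapT => H.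
pose g (t : {ffun 'I_N -> int} * int) : R :=
  2 * (t.2%:~R * pi) / \sum_j (t.1 j)%:~R * l 0 j.
have sub : `]0, h0[%classic `<=` range g.
  move=> h; rewrite /= in_itv /= => hh; apply: contrapT => ng; apply: H; exists h => //.
  move=> r [j rj] m rm; apply: ng; exists (finfun r, m) => //.
  have s0 : \sum_j (r j)%:~R * l 0 j != 0.
    apply/eqP => s0; move/eqP: rj; apply; apply/eqP; rewrite -(intr_eq0 rat); apply/eqP.
    apply: (ql (fun j => (r j)%:~R)); rewrite -[RHS]s0.
    by apply: eq_bigr => i _; rewrite rmorph_int.
  rewrite /g /=; under eq_bigr do rewrite ffunE.
  rewrite -rm mulr_sumr (eq_bigr (fun j => h * ((r j)%:~R * l 0 j))).
    by rewrite -mulr_sumr mulfK.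
  by move=> i _; field.
have cg : countable (range g) by apply: card_le_trans (card_image_le _ _) _; exact: countableP.
have := countable_lebesgue_measure0 (sub_countable (subset_card_le sub) cg).
rewrite lebesgue_measure_itv /= lte_fin h00 sube0 => /eqP.
by rewrite eqe gt_eqF.
Qed.

Lemma Q_independent_rat_indep l : Q_independent l -> rat_indep l.
Proof.
move=> ql i j ij c lj.
have := ql (fun u => if u == j then -1 else if u == i then c else 0) _ j.
rewrite eqxx; suff h : forall P : Prop, P -> (P -> (-1 : rat) = 0) -> False.
  by apply: h; rewrite (bigD1 j) //= (bigD1 i) //= eqxx (negbTE ij) eqxx big1 ?addr0;
    [rewrite rmorphN rmorph1 mulN1r lj addNr|
     move=> u /andP[/negbTE -> /negbTE ->]; rewrite rmorph0 mul0r].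
by move=> P p hP; have /eqP := hP p; rewrite oppr_eq0 oner_eq0.
Qed.

End StepChoice.

(** * Ergodic genericity *)

Section ZeroWindows.
Variables (R : realType) (N : nat).
Implicit Types (l : 'rV[R]_N) (k : R) (anti : bool).

Definition gzero anti l k : Prop :=
  (forall j : 'I_N, pcos anti l k j != 0) /\ \sum_(j < N) ptan anti l k j = 0.

(** The complement of phi_j in the anti-symmetric case, so that t_j is the tangent of [ang] for both
    parities. *)
Definition ang anti l k (j : 'I_N) : R := if anti then pi / 2 - hphase l k j else hphase l k j.

Lemma cos_ang anti l k j : cos (ang anti l k j) = pcos anti l k j.
Proof.
by rewrite /ang /pcos; case: anti; rewrite // cosB cos_pihalf sin_pihalf mul0r mul1r add0r.
Qed.

Lemma sin_ang anti l k j : sin (ang anti l k j) = psin anti l k j.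
Proof.
by rewrite /ang /psin; case: anti; rewrite // sinB cos_pihalf sin_pihalf mul0r mul1r subr0.
Qed.

Lemma tan_ang anti l k j : tan (ang anti l k j) = ptan anti l k j.
Proof. by rewrite /tan cos_ang sin_ang. Qed.

Lemma is_derive_ang anti l k j :
  is_derive k (1 : R) (fun k => ang anti l k j) (psign R anti * (l 0 j / 2)).
Proof.
have h1 : is_derive k (1 : R) (fun k => (l 0 j / 2) * k) (l 0 j / 2).
  by apply: is_derive_eq; rewrite ?scaler0 ?add0r ?addr0 // /GRing.scale /= mulr1.
rewrite /psign /ang; case: anti.
  have -> : (fun k => pi / 2 - hphase l k j) = (cst (pi / 2) - (fun k => (l 0 j / 2) * k)).
    by apply/funext => u; rewrite /cst /= /hphase !fctE; field.
  by apply: is_derive_eq; rewrite sub0r mulN1r.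
rewrite mul1r; have -> // : (fun k => hphase l k j) = (fun k => (l 0 j / 2) * k).
by apply/funext => u; rewrite /hphase; field.
Qed.

Lemma is_derive_sum_ptan anti l k : (forall j : 'I_N, pcos anti l k j != 0) ->
  is_derive k (1 : R) (fun k => \sum_(j < N) ptan anti l k j)
    (psign R anti * \sum_(j < N) (l 0 j / 2) * (pcos anti l k j) ^- 2).
Proof.
move=> c0.
have h (j : 'I_N) : is_derive k (1 : R) (fun k => ptan anti l k j)
    (psign R anti * ((l 0 j / 2) * (pcos anti l k j) ^- 2)).
  have -> : (fun k => ptan anti l k j) = tan \o (fun k => ang anti l k j).
    by apply/funext => u; rewrite /= tan_ang.
  have ca : cos (ang anti l k j) != 0 by rewrite cos_ang.
  apply: is_derive_eq; first exact: (is_derive1_comp (is_derive_tan ca) (is_derive_ang anti l k j)).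
  by rewrite cos_ang; ring.
have := @is_derive_sum R R R N (fun j k => ptan anti l k j) k 1 _ h.
rewrite mulr_sumr (_ : \sum_(j < N) (fun k => _) = (fun k => \sum_(j < N) ptan anti l k j)) //.
by apply/funext => u; rewrite fct_sumE.
Qed.

Lemma pcos_zero_between anti l k1 k2 : (0 < N)%N -> pos_lengths l -> k1 < k2 ->
  gzero anti l k1 -> gzero anti l k2 ->
  exists j, exists2 k, k1 < k < k2 & pcos anti l k j = 0.
Proof.
move=> N0 lp k12 [a1 s1] [a2 s2]; apply: contrapT => H.
have c0 k : k \in `[k1, k2] -> forall j, pcos anti l k j != 0.
  rewrite in_itv /= => /andP[h1 h2] j; apply/eqP => cj; apply: H; exists j, k => //.
  rewrite !lt_neqAle h1 h2 !andbT; apply/andP; split; apply/eqP => kE.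
    by have := a1 j; rewrite kE cj eqxx.
  by have := a2 j; rewrite -kE cj eqxx.
pose G k := \sum_(j < N) ptan anti l k j.
have dG k : k \in `[k1, k2] -> is_derive k (1 : R) G
    (psign R anti * \sum_(j < N) (l 0 j / 2) * (pcos anti l k j) ^- 2).
  by move=> /c0; exact: is_derive_sum_ptan.
have [||||k kI dk] := @Rolle R G k1 k2.
- exact: k12.
- by move=> k /subset_itv_oo_cc /dG [].
- apply: derivable_within_continuous => k /dG [] //.
- by rewrite /G s1 s2.
have [_ e1] := dk; have [_ e2] := dG k (subset_itv_oo_cc kI).
have : psign R anti * \sum_(j < N) (l 0 j / 2) * (pcos anti l k j) ^- 2 = 0 by rewrite -e2 e1.
apply/eqP; rewrite mulf_neq0 //; first by rewrite /psign; case: (anti); rewrite ?oppr_eq0 oner_eq0.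
have ck := c0 k (subset_itv_oo_cc kI).
rewrite gt_eqF // (bigD1 (Ordinal N0)) //=; apply: ltr_pwDl.
  by rewrite mulr_gt0 ?divr_gt0 ?lp // invr_gt0 exprn_even_gt0 //= ck.
by apply: sumr_ge0 => j _; rewrite mulr_ge0 ?invr_ge0 ?sqr_ge0 // divr_ge0 // ltW //; exact: lp.
Qed.

Lemma ang_dist anti l k k' j : pos_lengths l ->
  `|ang anti l k j - ang anti l k' j| = `|k - k'| * l 0 j / 2.
Proof.
move=> lp; rewrite /ang /hphase; transitivity (`|(k - k') * (l 0 j / 2)|).
  by case: (anti); [rewrite distrC|]; congr `|_|; field.
by rewrite normrM [X in _ * X]gtr0_norm ?divr_gt0 ?lp // mulrA.
Qed.

Lemma pcos_zero_apart anti l k k' (j : 'I_N) : pos_lengths l ->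
  pcos anti l k j = 0 -> pcos anti l k' j = 0 -> k != k' -> 2 * pi <= `|k - k'| * l 0 j.
Proof.
move=> lp c c' kk'.
have : sin (ang anti l k j - ang anti l k' j) = 0.
  by rewrite sinB !cos_ang c c' mulr0 mul0r subr0.
move=> /sin_eq0_int[m mE].
have lj : 0 < l 0 j by exact: lp.
have hm : `|k - k'| * l 0 j = 2 * pi * `|m%:~R|.
  have := ang_dist anti k k' j lp; rewrite mE normrM (gtr0_norm (pi_gt0 R)) => h; lra.
rewrite hm ler_pMr ?mulr_gt0 ?pi_gt0 //.
have m0 : m != 0.
  apply: contra kk' => /eqP m0; move/eqP: hm; rewrite m0 normr0 mulr0 mulf_eq0 (gt_eqF lj) orbF.
  by rewrite normr_eq0 subr_eq0.
by rewrite -intr_norm ler1z -gtz0_ge1 normr_gt0.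
Qed.

(** Between consecutive zeros some [pcos] vanishes. The zeros of one [pcos] are at least 2 pi / l_j
    apart, so different gaps in the window use different edges, and there are at most N gaps. *)
Lemma window_count anti l (a h : R) (s : seq R) : (0 < N)%N -> pos_lengths l ->
  (forall j, h * l 0 j <= 2 * pi) -> uniq s ->
  (forall k, k \in s -> a <= k < a + h /\ gzero anti l k) -> (size s <= N.+1)%N.
Proof.
move=> N0 lp hl us hs; pose t := sort <=%R s.
have st : sorted <%R t by rewrite lt_sorted_uniq_le sort_uniq us sort_sorted //; exact: le_total.
have szt : size t = size s by rewrite size_sort.
have ht k : k \in t -> a <= k < a + h /\ gzero anti l k by rewrite mem_sort; exact: hs.
rewrite -szt; case tE : t => [//|k0 t']; rewrite /= ltnS.
have mono i i' : (i < i')%N -> (i' < size t)%N -> nth 0 t i < nth 0 t i'.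
  move=> ii' i't; apply: (sorted_ltn_nth (@lt_trans _ R)) => //.
  by rewrite inE (ltn_trans ii').
have pick (i : 'I_(size t')) : exists p : 'I_N * R,
    nth 0 t i < p.2 < nth 0 t i.+1 /\ pcos anti l p.2 p.1 = 0.
  have i1 : (i.+1 < size t)%N by rewrite tE /= ltnS.
  have [||j [k hk ck]] := @pcos_zero_between anti l (nth 0 t i) (nth 0 t i.+1) N0 lp (mono _ _ (ltnSn i) i1).
  - by have [] := ht _ (mem_nth 0 (ltnW i1)).
  - by have [] := ht _ (mem_nth 0 i1).
  by exists (j, k).
have [f hf] := choice pick.
have finj : injective (fun i => (f i).1).
  have key (i i' : 'I_(size t')) : (i < i')%N -> (f i).1 <> (f i').1.
    move=> ii' E; have [/andP[a1 a2] c1] := hf i; have [/andP[b1 b2] c2] := hf i'.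
    have i'1 : (i'.+1 < size t)%N by rewrite tE /= ltnS.
    have lt12 : (f i).2 < (f i').2.
      apply: lt_trans a2 _; apply: le_lt_trans b1.
      move: ii'; rewrite leq_eqVlt => /predU1P[->//|/mono]; move=> /(_ (ltnW i'1)); exact: ltW.
    rewrite E in c1; have := pcos_zero_apart lp c1 c2; rewrite lt_eqF // => /(_ isT).
    apply/negP; rewrite -ltNge; apply: lt_le_trans (hl (f i').1).
    rewrite ltr_pM2r; last exact: lp.
    have it : (i < size t)%N by rewrite tE /= ltnS ltnW.
    have [/andP[w1 _] _] := ht _ (mem_nth 0 it).
    have [/andP[_ w2] _] := ht _ (mem_nth 0 i'1).
    by rewrite ltr0_norm ?subr_lt0 // opprB; lra.
  move=> i i' E; apply/val_inj; case: (ltngtP i i') => // /key; rewrite E => /(_ erefl) [].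
by have := leq_card _ finj; rewrite !card_ord.
Qed.

End ZeroWindows.

(** * Linear bounds on numbers of frequencies *)

Section Density.
Variable R : realType.
Implicit Types (D : R -> Prop) (K T : R) (s : seq R).

(** Lists of distinct points avoid assuming that [D] is locally finite; finiteness of the spectrum
    is later deduced from such a bound. *)
Definition density_le D K := exists B : R, forall T s, 0 <= T -> uniq s ->
  (forall k, k \in s -> 0 < k <= T /\ D k) -> (size s)%:R <= K * T + B.

Lemma density_le_sub D D' K : (forall k, 0 < k -> D k -> D' k) ->
  density_le D' K -> density_le D K.
Proof.
move=> DD [B hB]; exists B => T s T0 us hs; apply: hB => // k /hs[kT Dk].
by split=> //; apply: DD => //; case/andP: kT.
Qed.

Lemma density_le_mono D K K' : K <= K' -> density_le D K -> density_le D K'.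
Proof.
move=> KK [B hB]; exists B => T s T0 us hs; apply: le_trans (hB T s T0 us hs) _.
by rewrite lerD2r ler_wpM2r.
Qed.

Lemma density_le_or D D' K K' : density_le D K -> density_le D' K' ->
  density_le (fun k => D k \/ D' k) (K + K').
Proof.
move=> [B hB] [B' hB']; exists (B + B') => T s T0 us hs.
pose p k := `[< D k >].
have h1 := hB T [seq k <- s | p k] T0 (filter_uniq _ us).
have h2 := hB' T [seq k <- s | predC p k] T0 (filter_uniq _ us).
have -> : (size s)%:R = (size [seq k <- s | p k])%:R + (size [seq k <- s | predC p k])%:R :> R.
  by rewrite -natrD !size_filter count_predC.
rewrite mulrDl addrACA; apply: lerD.
  by apply: h1 => k; rewrite mem_filter => /andP[/asboolP Dk /hs[]].
apply: h2 => k; rewrite mem_filter => /andP[/asboolPn Dk /hs[kT [//|]]]; by split.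
Qed.

Lemma density_le_bigor (I : Type) (L : seq I) (D : I -> R -> Prop) K :
  (forall c, density_le (D c) K) ->
  density_le (fun k => exists2 c, List.In c L & D c k) ((size L)%:R * K).
Proof.
move=> hD; elim: L => [|c L IH].
  exists 0 => T s T0 us hs; rewrite !mul0r add0r.
  by case: s us hs => // k s _ /(_ k (mem_head _ _))[_ []].
rewrite /= -natr1 addrC mulrDl mul1r.
apply: density_le_sub (density_le_or (hD c) IH) => k k0 [c' [->|c'L] Dk]; first by left.
by right; exists c'.
Qed.

End Density.

Section SinLipschitz.
Variable R : realType.
Implicit Types x y : R.

Lemma sin_lipschitz x y : `|sin x - sin y| <= `|x - y|.
Proof.
wlog xy : x y / y <= x => [H|].
  case/orP: (le_total y x) => [yx|xy]; first exact: (H x y yx).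
  by rewrite (distrC x) (distrC (sin x)); exact: (H y x xy).
have ds (z : R) : z \in `]y, x[ -> is_derive z 1 sin (cos z).
  by move=> _; exact: is_derive_sin.
have cs : {within `[y, x], continuous (@sin R)}.
  by apply: continuous_subspaceT => z; exact: continuous_sin.
have [c _ ->] := MVT_segment xy ds cs.
by rewrite normrM ler_piMl // ler_norml cos_le1 cos_geN1.
Qed.

End SinLipschitz.

Section NearCount.
Variables (R : realType) (N : nat) (anti : bool) (l : 'rV[R]_N).
Hypotheses (N0 : (0 < N)%N) (lp : pos_lengths l).

Lemma count_windows (h : R) s n (V : pred nat) : 0 < h ->
  (forall j, h * l 0 j <= 2 * pi) -> uniq s ->
  (forall k, k \in s -> [/\ gzero anti l k, 0 <= k, (Num.truncn (k / h) < n)%N &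
     V (Num.truncn (k / h))]) -> (size s <= N.+1 * \sum_(m < n) V m)%N.
Proof.
move=> h0 hl us hs; pose w k := Num.truncn (k / h).
have -> : size s = (\sum_(m < n) count (fun k => w k == m) s)%N.
  rewrite -sum1_size (eq_bigr (fun m : 'I_n => \sum_(k <- s) (w k == m)%N)%N); last first.
    by move=> m _; rewrite -sumn_count sumnE big_map.
  rewrite exchange_big /=; apply: eq_big_seq => k /hs[_ _ wn _].
  rewrite (bigD1 (Ordinal wn)) //= eqxx big1 // => m.
  by rewrite -val_eqE /= eq_sym => /negbTE ->.
rewrite big_distrr; apply: leq_sum => m _.
have [->|] := eqVneq (count (fun k => w k == m) s) 0%N; first by [].
rewrite -lt0n -has_count => /hasP[k ks /eqP wk].
have [_ _ _ Vk] := hs k ks; rewrite -/(w k) wk in Vk.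
rewrite Vk [X in (_ <= X)%N]muln1 -size_filter.
apply: (window_count (anti := anti) (a := m%:R * h) (h := h)) => //; first exact: filter_uniq.
move=> k'; rewrite mem_filter => /andP[wk' /hs[gk k'0 _ _]]; split=> //.
have kh : 0 <= k' / h by rewrite divr_ge0 // ltW.
have /andP[h1 h2] := truncn_itv kh; rewrite -/(w k') (eqP wk') in h1 h2.
by rewrite -ler_pdivlMr // h1 /= -[X in _ + X]mul1r -mulrDl natr1 -ltr_pdivrMr.
Qed.

(** From k back to the last multiple of h the phases move by at most h l_j / 2, so the window of
    such a k starts at a visit counted by [visits_bound] with tolerance d. A window holds at most N
    + 1 zeros, and there are 1 / h windows per unit length. *)
Lemma density_near (h d : R) (al : 'I_N -> R) (J : pred 'I_N) : 0 < h ->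
  freq_free (fun j => h * l 0 j / 2) -> (forall j, h * l 0 j <= 2 * pi) ->
  0 < d -> d <= 1 / 2 ->
  density_le (fun k => gzero anti l k /\
    forall j, J j -> `|sin (ang anti l k j - al j)| <= d - h * l 0 j / 2)
    ((N.+1%:R * 2 ^+ N * (2 * d) ^+ #|J|) / h).
Proof.
move=> h0 ff hl d0 d1; pose al' j := if anti then pi / 2 - al j else al j.
have [B hB] := visits_bound al' J ff d0 d1.
exists (N.+1%:R * 2 ^+ N * ((2 * d) ^+ #|J| + B)) => T s T0 us hs.
set V := fun m : nat => `[< forall j, J j -> `|sin (m%:R * (h * l 0 j / 2) - al' j)| <= d >].
pose n := (Num.truncn (T / h)).+1.
have Th : 0 <= T / h by rewrite divr_ge0 // ltW.
have nT : n%:R <= T / h + 1.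
  by have /andP[h1 _] := truncn_itv Th; rewrite /n -natr1 lerD2r.
have le1 : (size s <= N.+1 * \sum_(m < n) V m)%N.
  apply: (count_windows h0) => // k ks; have [/andP[k0 kT] [gk nk]] := hs k ks.
  have kh : 0 <= k / h by rewrite divr_ge0 // ltW.
  split=> //; first exact: ltW.
    by rewrite ltnS le_truncn // ler_pM2r ?invr_gt0.
  have /andP[h1 h2] := truncn_itv kh; set m := Num.truncn _ in h1 h2 *.
  rewrite ler_pdivlMr // in h1; rewrite ltr_pdivrMr // -natr1 mulrDl mul1r in h2.
  apply/asboolP => j Jj; have nkj := nk j Jj.
  have -> : `|sin (m%:R * (h * l 0 j / 2) - al' j)| = `|sin (ang anti l (m%:R * h) j - al j)|.
    rewrite /al' /ang /hphase; case: (anti); last by congr `|sin _|; field.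
    by rewrite -normrN -sinN; congr `|sin _|; field.
  have mk : `|m%:R * h - k| <= h by rewrite ler_norml; apply/andP; split; lra.
  have : `|sin (ang anti l (m%:R * h) j - al j) - sin (ang anti l k j - al j)| <= h * l 0 j / 2.
    apply: le_trans (sin_lipschitz _ _) _.
    rewrite (_ : _ - _ - _ = ang anti l (m%:R * h) j - ang anti l k j); last by ring.
    by rewrite ang_dist // ler_pM2r ?invr_gt0 // ler_pM2r ?lp.
  move=> dd; rewrite -[X in `|X|](subrK (sin (ang anti l k j - al j))).
  by apply: le_trans (ler_normD _ _) _; lra.
apply: (@le_trans _ _ (N.+1%:R * \sum_(m < n) (V m)%:R)).
  by rewrite -natr_sum -natrM ler_nat.
apply: (@le_trans _ _ (N.+1%:R * (2 ^+ N * ((2 * d) ^+ #|J| * n%:R + B)))).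
  by rewrite ler_wpM2l.
have -> : N.+1%:R * 2 ^+ N * (2 * d) ^+ #|J| / h * T + N.+1%:R * 2 ^+ N * ((2 * d) ^+ #|J| + B) =
  N.+1%:R * (2 ^+ N * ((2 * d) ^+ #|J| * (T / h + 1) + B)) by field; rewrite gt_eqF.
apply: ler_wpM2l => //; apply: ler_wpM2l; first exact: exprn_ge0.
by rewrite lerD2r; apply: ler_wpM2l => //; apply: exprn_ge0; rewrite mulr_ge0 // ltW.
Qed.

End NearCount.

Lemma mem_List_In (T : eqType) (x : T) (s : seq T) : x \in s -> List.In x s.
Proof.
elim: s => //= y s IH; rewrite inE => /predU1P[->|/IH]; by [left|right].
Qed.

Section BadSparse.
Variables (R : realType) (N : nat) (anti : bool) (l : 'rV[R]_N).
Hypotheses (N0 : (0 < N)%N) (lp : pos_lengths l) (ql : Q_independent l).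

Let Lam : R := \sum_j l 0 j.

Let lLam j : l 0 j <= Lam.
Proof.
rewrite /Lam (bigD1 j) //= lerDl; apply: sumr_ge0 => i _; exact/ltW/lp.
Qed.

Let Lam0 : 0 < Lam.
Proof. exact: lt_le_trans (lp (Ordinal N0)) (lLam _). Qed.

Let window_le (h : R) j : 0 < h -> h * (1 + Lam) < 1 / 2 -> h * l 0 j <= 2 * pi.
Proof.
move=> h0 hL; have : h * l 0 j <= h * Lam by rewrite ler_wpM2l ?lLam ?ltW.
have := pi_ge2 R; nra.
Qed.

(* If some t_j is large then, as sum_j t_j = 0, a second one is large too: two phases are
   near their poles, which happens for a proportion O(e^2) of the steps of length e. *)
Lemma small_pcos_sparse (eps : R) : 0 < eps -> exists2 e : R, 0 < e &
  density_le (fun k => gzero anti l k /\ exists i j : 'I_N,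
    [/\ i != j, `|pcos anti l k i| <= e & `|pcos anti l k j| <= e]) eps.
Proof.
move=> e0.
pose L := enum [pred p : 'I_N * 'I_N | p.1 != p.2].
(* [density_near] with two constrained phases and d = h (1 + Lam) gives density K h for each pair;
   the bound [h2] on h brings the sum over all pairs below eps. *)
pose K : R := N.+1%:R * 2 ^+ N * (2 * (1 + Lam)) ^+ 2.
have K0 : 0 < K by rewrite !mulr_gt0 ?exprn_gt0 ?mulr_gt0 //; have := Lam0; lra.
have L1 : 0 < 1 + Lam by have := Lam0; lra.
pose h1 := 1 / 2 / (1 + Lam); pose h2 := eps / ((size L)%:R * K + 1).
have X0 : 0 < (size L)%:R * K + 1 by rewrite ltr_wpDl // mulr_ge0 // ltW.
have h10 : 0 < Num.min h1 h2 by rewrite lt_min !divr_gt0.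
have [h /andP[h0]] := freq_free_step ql h10.
rewrite lt_min /h1 /h2 (ltr_pdivlMr _ _ L1) (ltr_pdivlMr _ _ X0) => /andP[hh1 hh2] ff.
exists h => //.
have main (p : 'I_N * 'I_N) : density_le (fun k => [/\ p.1 != p.2, gzero anti l k &
    `|pcos anti l k p.1| <= h /\ `|pcos anti l k p.2| <= h]) (K * h).
  have [pp|pp] := eqVneq p.1 p.2.
    exists 0 => T s T0 us hs; rewrite addr0 (_ : s = [::]) ?mulr_ge0 // 1?ltW //.
    by case: s us hs => // k s _ /(_ k (mem_head _ _))[_ []].
  have d0 : 0 < h * (1 + Lam) by exact: mulr_gt0.
  have dn := @density_near R N anti l N0 lp h (h * (1 + Lam)) (fun=> - (pi / 2))
    [pred j | (j == p.1) || (j == p.2)] h0 ff (fun j => window_le j h0 hh1) d0 (ltW hh1).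
  have cJ : #|[pred j | (j == p.1) || (j == p.2)]| = 2%N by have := card2 p.1 p.2; rewrite pp => <-.
  rewrite cJ in dn.
  have -> : K * h = N.+1%:R * 2 ^+ N * (2 * (h * (1 + Lam))) ^+ 2 / h.
    by rewrite /K; field; rewrite gt_eqF.
  apply: density_le_sub dn => k k0 [_ gk [c1 c2]]; split=> // j jp.
  have -> : sin (ang anti l k j - - (pi / 2)) = pcos anti l k j.
    by rewrite opprK sinDpihalf cos_ang.
  apply: (@le_trans _ _ h); first by case/orP: jp => /eqP ->.
  rewrite mulrDr mulr1 -addrA lerDl subr_ge0 ler_pdivrMr //.
  have : h * l 0 j <= h * Lam by rewrite ler_wpM2l ?lLam ?ltW.
  have : 0 < h * Lam by exact: mulr_gt0.
  lra.
have := density_le_bigor L main; move=> /density_le_mono H.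
apply: density_le_sub (H eps _).
  move=> k k0 [gk [i [j [ij ci cj]]]]; exists (i, j); last by split.
  by apply: mem_List_In; rewrite mem_enum inE.
move: hh2; rewrite mulrDr mulr1 mulrA [_ * h]mulrC; have := h0; lra.
Qed.

(** The side of the covering cubes equals the sampling step h. One cube is visited with density K
    h^(N-1), that is K h^N per step divided by h, and there are at most (eps / K) h^(1-N) cubes, so
    the powers of h cancel. *)
Lemma poly_zero_sparse (f : (nat -> R) -> R) (M eps : R) : polyfun N.-1 f ->
  (exists x, f x != 0) -> 0 < M -> 0 < eps ->
  density_le (fun k => [/\ gzero anti l k, forall j : 'I_N, `|ptan anti l k j| <= M &
    f (fun i => if insub i is Some j then ptan anti l k j else 0) = 0]) eps.
Proof.
move=> pf fx M0 e0.
pose K : R := N.+1%:R * 2 ^+ N * (2 * (N%:R + Lam)) ^+ N.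
have NL : 0 < N%:R + Lam by rewrite ltr_wpDl.
have K0 : 0 < K by rewrite !mulr_gt0 ?exprn_gt0 ?mulr_gt0.
have [d0 d00 hcov] := polyfun_zero_cover pf fx M0 (divr_gt0 e0 K0).
have N1 : 1 <= N%:R :> R by rewrite ler1n.
pose h1 := 1 / 2 / (N%:R + Lam).
have h10 : 0 < Num.min d0 h1 by rewrite lt_min d00 !divr_gt0.
have [h /andP[h0]] := freq_free_step ql h10.
rewrite lt_min /h1 (ltr_pdivlMr _ _ NL) => /andP[hd0 hh1] ff.
have [L sL hL] := hcov h h0 hd0.
have hw : h * (1 + Lam) < 1 / 2.
  by apply: le_lt_trans hh1; rewrite ler_pM2l // lerD2r.
(* The last coordinate of [tvec] adds up N - 1 errors of size h, hence the tolerance N h. *)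
have main (c : nat -> R) : density_le (fun k => gzero anti l k /\
    forall j, `|ptan anti l k j - tvec c j| <= N%:R * h) (K * h ^+ N.-1).
  have dd : 0 < h * (N%:R + Lam) by exact: mulr_gt0.
  have dn := @density_near R N anti l N0 lp h (h * (N%:R + Lam)) (fun j => atan (tvec c j))
    predT h0 ff (fun j => window_le j h0 hw) dd (ltW hh1).
  rewrite card_ord in dn.
  have -> : K * h ^+ N.-1 = N.+1%:R * 2 ^+ N * (2 * (h * (N%:R + Lam))) ^+ N / h.
    have hN : h ^+ N = h * h ^+ N.-1 by rewrite -exprS prednK.
    rewrite /K (mulrCA 2 h) [(h * _) ^+ N]exprMn hN.
    by field; rewrite gt_eqF.
  apply: density_le_sub dn => k k0 [gk tk]; split=> // j _.
  have [c0 _] := gk.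
  have [m mE] : exists m : int, ang anti l k j = atan (ptan anti l k j) + m%:~R * pi.
    by apply: tan_eq_int; rewrite ?cos_ang ?sin_ang.
  (* [ang] and the arctangent of t_j differ by a multiple of pi, which changes the sine only in
     sign. *)
  have -> : `|sin (ang anti l k j - atan (tvec c j))| =
      `|sin (atan (ptan anti l k j) - atan (tvec c j))|.
    have sm : sin (m%:~R * pi) = 0 :> R.
      have sn (n : nat) : sin (n%:R * pi) = 0 :> R.
        by rewrite mulr_natl -[pi *+ n]add0r (alternatingn (@sinDpi R)) sin0 mulr0.
      by case: (m) => n; rewrite ?NegzE ?mulrNz ?mulNr ?sinN -pmulrn sn ?oppr0.
    have cm : `|cos (m%:~R * pi)| = 1 :> R.
      by apply/eqP; rewrite -sqrp_eq1 // real_normK ?num_real // cos2sin2 sm expr0n subr0.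
    have -> : ang anti l k j - atan (tvec c j) =
       (atan (ptan anti l k j) - atan (tvec c j)) + m%:~R * pi by rewrite mE; ring.
    by rewrite sinD sm mulr0 addr0 normrM cm mulr1.
  have := sin_lipschitz (atan (ptan anti l k j) - atan (tvec c j)) 0.
  rewrite sin0 !subr0 => /le_trans; apply; apply: le_trans (atan_lipschitz _ _) _.
  apply: le_trans (tk j) _; rewrite mulrDr mulrC -addrA lerDl subr_ge0 ler_pdivrMr //.
  have : h * l 0 j <= h * Lam by rewrite ler_wpM2l ?lLam ?ltW.
  have : 0 < h * Lam by exact: mulr_gt0.
  lra.
have := density_le_bigor L main; move=> /density_le_mono H.
apply: density_le_sub (H eps _); last first.
  by rewrite mulrCA mulrC -ler_pdivlMr.
move=> k k0 [gk Mk fk]; have [|c cL cc] := hL _ _ fk.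
  move=> i iN; case: insubP => [j _ _|]; first exact: Mk.
  by rewrite (leq_trans iN) ?leq_pred.
exists c => //; split=> // j.
have [_ /tvecP <-] := gk.
set x := (fun i : nat => _) in cc *.
have hN : N%:R = N.-1%:R + 1 :> R by rewrite natr1 prednK.
rewrite /tvec; case: ifP => jN.
  by apply: le_trans (cc j jN) _; rewrite ler_peMl // ltW.
rewrite -opprD normrN -sumrB.
apply: le_trans (ler_norm_sum _ _ _) _.
apply: (@le_trans _ _ (\sum_(i < N.-1) h)); first by apply: ler_sum => i _; exact: cc.
by rewrite sumr_const card_ord -[leLHS]mulr_natl ler_pM2r // hN lerDl.
Qed.

Lemma bad_sparse q (eps : R) : (3 <= N)%N -> (exists t, Qfun anti q (tvec t) != 0) -> 0 < eps ->
  density_le (fun k => [/\ forall j : 'I_N, pcos anti l k j != 0,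
    \sum_(j < N) ptan anti l k j = 0 & esymN1 (ptan anti l k) = 0 \/ Qfun anti q (ptan anti l k) = 0])
   eps.
Proof.
move=> N3 [t0 Qt0] eps0.
have [e e0 small] := small_pcos_sparse (divr_gt0 eps0 (ltr0Sn R 2)).
have NR : 0 < N%:R :> R by rewrite ltr0n.
(* As the t_j sum to 0, one of modulus above N / e forces another above 1 / e; and |t_i| > 1 / e
   makes [pcos] at most e in modulus. *)
have M0 : 0 < N%:R / e by rewrite divr_gt0.
have [W pW WQ] := Qfun_tvec_polyfun anti q.
have W0 : exists x, W x != 0 by exists t0; apply/eqP => /WQ/eqP; apply/negP.
have z1 := poly_zero_sparse pW W0 M0 (divr_gt0 eps0 (ltr0Sn R 2)).
have z2 := poly_zero_sparse (@esym_tvec_polyfun R N) (@esym_neq0 R N N3) M0 (divr_gt0 eps0 (ltr0Sn R 2)).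
have eE : eps = eps / 3 + (eps / 3 + eps / 3) by field.
rewrite {}eE; apply: density_le_sub (density_le_or small (density_le_or z1 z2)).
move=> k k0 [c0 s0 bad]; have gk : gzero anti l k by split.
have [allM|] := pselect (forall j, `|ptan anti l k j| <= N%:R / e).
  right; case: bad => [es|Qs]; [right|left]; split=> //; first by rewrite tvecP.
  by apply/WQ; rewrite tvecP.
move=> /existsNP[j /negP]; rewrite -ltNge => jM; left; split=> //.
have key i : e^-1 < `|ptan anti l k i| -> `|pcos anti l k i| <= e.
  move=> ti; have -> : `|pcos anti l k i| = `|psin anti l k i| / `|ptan anti l k i|.
    rewrite /ptan normrM normfV invfM invrK mulrA divff ?mul1r //.
    rewrite normr_eq0; apply: contraTneq ti => s; rewrite /ptan s mul0r normr0 -leNgt invr_ge0.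
    exact: ltW.
  have t1 : 0 < `|ptan anti l k i| by apply: lt_trans ti; rewrite invr_gt0.
  rewrite ler_pdivrMr //; apply: (@le_trans _ _ 1).
    rewrite /psin; by case: (anti); rewrite ler_norml ?cos_le1 ?cos_geN1 ?sin_le1 ?sin_geN1.
  by rewrite mulrC -ler_pdivrMr // div1r ltW.
have [i ij ti] : exists2 i, i != j & e^-1 < `|ptan anti l k i|.
  apply: contrapT => H; have le i : i != j -> `|ptan anti l k i| <= e^-1.
    by move=> ij; rewrite leNgt; apply/negP => ti; apply: H; exists i.
  have : `|ptan anti l k j| <= N%:R / e.
    have -> : ptan anti l k j = - \sum_(i | i != j) ptan anti l k i.
      by move: s0; rewrite (bigD1 j) //= => /eqP; rewrite addr_eq0 => /eqP.
    rewrite normrN; apply: le_trans (ler_norm_sum _ _ _) _.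
    apply: le_trans (ler_sum _ le) _; rewrite sumr_const -[leLHS]mulr_natl ler_pM2r ?invr_gt0 //.
    by rewrite ler_nat (leq_trans (max_card _)) ?card_ord.
  by rewrite leNgt jM.
exists i, j; split=> //; first exact: key.
apply: key; apply: le_lt_trans jM; rewrite -[leLHS]mul1r ler_pM2r ?invr_gt0 // ler1n //.
Qed.

End BadSparse.

(** * Lower bound on the number of eigenvalues *)

Section Existence.
Variables (R : realType) (N : nat) (l : 'rV[R]_N).
Hypothesis lp : pos_lengths l.

Lemma gzero_mult (anti : bool) k : (0 < N)%N -> 0 < k -> gzero anti l k -> (0 < mult l k)%N.
Proof.
move=> N0 k0 [c0 s0]; pose F j := (cR (pcos anti l k j))^-1.
apply: (@mult_gt0 _ _ _ _ (of_pcoef anti l k F)).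
  apply/eqP => E; have := pcoef_of_pcoef anti l k F (Ordinal N0).
  rewrite E -(scale0r 0) pcoefZ mul0r => /eqP; rewrite eq_sym invr_eq0 cR_eq0.
  exact/negP.
by apply: vertex_conditions_of_pcoef => //; apply: inU_inv.
Qed.

(* (1, 0) is multiplied by the factors (cos phi_j + eps sin phi_j) of the dual numbers, so
   that snd / fst is the sum of the tangents; unlike this sum, snd has no poles. *)
Fixpoint dual_prod k (js : seq 'I_N) : R * R :=
  if js is j :: js' then
    let p := dual_prod k js' in
    (cos (hphase l k j) * p.1, sin (hphase l k j) * p.1 + cos (hphase l k j) * p.2)
  else (1, 0).

Lemma is_derive_hphase k j : is_derive k (1 : R) (fun k => hphase l k j) (l 0 j / 2).
Proof.
have -> : (fun k => hphase l k j) = (fun k => (l 0 j / 2) * k).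
  by apply/funext => u; rewrite /hphase; field.
by apply: is_derive_eq; rewrite ?scaler0 ?add0r ?addr0 // /GRing.scale /= mulr1.
Qed.

(* By induction the Wronskian of the two components is nonpositive, and it vanishes only where
   the second component does. *)
Lemma dual_prod_wronskian k js : exists C' S' : R,
  [/\ is_derive k (1 : R) (fun k => (dual_prod k js).1) C',
      is_derive k (1 : R) (fun k => (dual_prod k js).2) S',
      C' * (dual_prod k js).2 - (dual_prod k js).1 * S' <= 0 &
      C' * (dual_prod k js).2 - (dual_prod k js).1 * S' = 0 -> (dual_prod k js).2 = 0].
Proof.
elim: js => [|j js [C' [S' [dC dS le0 eq0]]]].
  exists 0, 0; split; [exact: is_derive_cst|exact: is_derive_cst| |by []].
  by rewrite /= !mul0r mulr0 subr0.
have dh := is_derive_hphase k j.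
have dc : is_derive k (1 : R) (fun k => cos (hphase l k j)) (- sin (hphase l k j) * (l 0 j / 2)).
  exact: (@is_derive1_comp R cos (fun k => hphase l k j) k _ _ (is_derive_cos _) dh).
have ds : is_derive k (1 : R) (fun k => sin (hphase l k j)) (cos (hphase l k j) * (l 0 j / 2)).
  exact: (@is_derive1_comp R sin (fun k => hphase l k j) k _ _ (is_derive_sin _) dh).
have E1 : (fun k => (dual_prod k (j :: js)).1) =
    (fun k => cos (hphase l k j)) * (fun k => (dual_prod k js).1).
  by [].
have E2 : (fun k => (dual_prod k (j :: js)).2) =
    (fun k => sin (hphase l k j)) * (fun k => (dual_prod k js).1) +
    (fun k => cos (hphase l k j)) * (fun k => (dual_prod k js).2).
  by [].
rewrite E1 E2 /=; move: dC dS le0 eq0.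
pose CC := fun k => (dual_prod k js).1; pose SS := fun k => (dual_prod k js).2.
rewrite -/CC -/SS -/(CC k) -/(SS k) => dC dS.
set c := cos _ in dc ds *; set s := sin _ in dc ds *; set w := l 0 j / 2 in dc ds *.
have w0 : 0 < w by rewrite divr_gt0 ?lp.
have cs : c ^+ 2 + s ^+ 2 = 1 by exact: cos2Dsin2.
move=> le0 eq0; exists (c * C' + CC k * (- s * w)),
  (s * C' + CC k * (c * w) + (c * S' + SS k * (- s * w))).
have W : (c * C' + CC k * (- s * w)) * (s * CC k + c * SS k) -
   c * CC k * (s * C' + CC k * (c * w) + (c * S' + SS k * (- s * w))) =
   - (w * CC k ^+ 2) + c ^+ 2 * (C' * SS k - CC k * S').
  by rewrite -[w * CC k ^+ 2]mulr1 -cs; ring.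
have W1 : 0 <= w * CC k ^+ 2 by rewrite mulr_ge0 ?sqr_ge0 // ltW.
have W2 : c ^+ 2 * (C' * SS k - CC k * S') <= 0.
  by rewrite mulr_ge0_le0 // sqr_ge0.
split.
- exact: (is_deriveM dc dC).
- exact: (is_deriveD (is_deriveM ds dC) (is_deriveM dc dS)).
- rewrite W; lra.
rewrite W => W3; have /eqP : w * CC k ^+ 2 = 0 by lra.
rewrite mulf_eq0 (gt_eqF w0) sqrf_eq0 /= => /eqP C0; rewrite C0 mulr0 add0r.
have /eqP : c ^+ 2 * (C' * SS k - CC k * S') = 0 by lra.
by rewrite mulf_eq0 sqrf_eq0 => /orP[/eqP ->|/eqP /eq0 ->]; rewrite ?mul0r ?mulr0.
Qed.

Lemma dual_prod_fst k js : (dual_prod k js).1 = \prod_(j <- js) cos (hphase l k j).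
Proof.
elim: js => [|j js IH]; first by rewrite big_nil.
by rewrite big_cons -IH.
Qed.

Lemma dual_prod_snd k js : (dual_prod k js).1 != 0 ->
  (dual_prod k js).2 = (dual_prod k js).1 * \sum_(j <- js) ptan false l k j.
Proof.
elim: js => [|j js IH] /=; first by rewrite big_nil mulr0.
rewrite big_cons.
rewrite mulf_eq0 negb_or => /andP[c0 /IH ->]; rewrite /ptan /pcos /psin; field; exact: c0.
Qed.

(** If the first component vanished, some cosine would. By [no_double] only one can, and then the
    second component is, up to sign, the product of the other cosines, hence nonzero. *)
Lemma dual_prod_neq0 k js : no_double l k -> uniq js -> (dual_prod k js).2 = 0 ->
  (dual_prod k js).1 != 0.
Proof.
move=> nd; elim: js => [|j js IH] /=; first by rewrite oner_eq0.
move=> /andP[jjs ujs]; have := dual_prod_fst k js; move: IH.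
case: (dual_prod k js) => x y /= IH CE.
have [c0|c0] := eqVneq (cos (hphase l k j)) 0.
  rewrite c0 !mul0r addr0 => /eqP; rewrite mulf_eq0.
  have s0 : sin (hphase l k j) != 0.
    apply/eqP => s0; have := cos2Dsin2 (hphase l k j); rewrite c0 s0 expr0n addr0 => /eqP.
    by rewrite eq_sym oner_eq0.
  rewrite (negbTE s0) /= CE => p0; exfalso.
  have /hasP[i ijs /eqP ci] : has (fun i => cos (hphase l k i) == 0) js.
    by rewrite prodf_seq_eq0 in p0.
  have ij : i != j by apply: contraNneq jjs => <-.
  by have [h _] := nd i j ij; apply: h.
move=> SE; rewrite mulf_neq0 //; apply/eqP => C0.
move: SE; rewrite C0 mulr0 add0r => /eqP; rewrite mulf_eq0 (negbTE c0) /= => /eqP S0.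
by have := IH ujs S0; rewrite C0 eqxx.
Qed.

(** Other cosines may vanish between a and b, so Rolle's theorem is applied to the quotient of the
    first component by the second, which is 0 at both ends. If the second component had no zero, the
    derivative, Wronskian over square, would vanish somewhere, and there the second component would
    be 0 after all. *)
Lemma gzero_between j0 a b : (forall k, 0 < k -> no_double l k) -> 0 < a -> a < b ->
  cos (hphase l a j0) = 0 -> cos (hphase l b j0) = 0 ->
  exists2 k, a < k < b & gzero false l k.
Proof.
move=> nd a0 ab ca cb; pose js := enum 'I_N.
have j0js : j0 \in js by rewrite mem_enum.
have C0 k : cos (hphase l k j0) = 0 -> (dual_prod k js).1 = 0.
  by move=> ck; rewrite dual_prod_fst (big_rem j0) //= ck mul0r.
have [k kI S0] : exists2 k, k \in `[a, b] & (dual_prod k js).2 = 0.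
  apply: contrapT => H.
  have Sn k : k \in `[a, b] -> (dual_prod k js).2 != 0.
    by move=> kI; apply/eqP => S0; apply: H; exists k.
  have [C' hC] := choice (fun k => dual_prod_wronskian k js).
  have [S' hS] := choice hC.
  pose G := (fun k => (dual_prod k js).1) * (fun k => (dual_prod k js).2^-1).
  have dG k : k \in `[a, b] -> is_derive k (1 : R) G
      ((C' k * (dual_prod k js).2 - (dual_prod k js).1 * S' k) / (dual_prod k js).2 ^+ 2).
    move=> kI; have [dC dS _ _] := hS k; have S0 := Sn k kI.
    have dV := @is_deriveV R (fun k => (dual_prod k js).2) k _ _ S0 dS.
    apply: (is_derive_eq (is_deriveM dC dV)).
    by rewrite /GRing.scale /=; field.
  have ea : a \in `[a, b] by rewrite in_itv /= lexx ltW.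
  have eb : b \in `[a, b] by rewrite in_itv /= lexx ltW.
  have [||||k kI dk] := @Rolle R G a b.
  - exact: ab.
  - by move=> k /subset_itv_oo_cc /dG [].
  - apply: derivable_within_continuous => k /dG [] //.
  - by rewrite /G !fctE !C0 // !mul0r.
  have kI' := subset_itv_oo_cc kI.
  have [_ e1] := dk; have [_ e2] := dG k kI'.
  have /eqP : (C' k * (dual_prod k js).2 - (dual_prod k js).1 * S' k) / (dual_prod k js).2 ^+ 2 = 0.
    by rewrite -e2 e1.
  rewrite mulf_eq0 invr_eq0 sqrf_eq0 (negbTE (Sn k kI')) orbF => /eqP W0.
  have [_ _ _ /(_ W0) S0] := hS k.
  by have := Sn k kI'; rewrite S0 eqxx.
have /andP[ka kb] : a <= k <= b by move: kI; rewrite in_itv.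
have Cn : (dual_prod k js).1 != 0.
  by apply: dual_prod_neq0; [apply: nd; exact: lt_le_trans ka|exact: enum_uniq|].
have cn j : cos (hphase l k j) != 0.
  apply: contraNneq Cn => cj; rewrite dual_prod_fst (big_rem j) ?mem_enum //= cj.
  by rewrite mul0r.
exists k.
  rewrite !lt_neqAle ka kb !andbT; apply/andP; split; apply: contraNneq (cn j0).
    by move=> <-; rewrite ca.
  by move=> ->; rewrite cb.
split=> //; have := dual_prod_snd Cn; rewrite S0 => /eqP; rewrite eq_sym mulf_eq0 (negbTE Cn) /=.
by rewrite big_enum => /eqP.
Qed.

Lemma many_gzeros (j0 : 'I_N) n : (forall k, 0 < k -> no_double l k) ->
  exists s : seq R, [/\ size s = n, uniq s &
    forall k, k \in s -> 0 < k <= (2 * n%:R + 1) * pi / l 0 j0 /\ gzero false l k].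
Proof.
move=> nd; have lj := lp j0.
(* The positive zeros of cos(k l_{j0} / 2), in increasing order. *)
pose a (m : nat) := (2 * m%:R + 1) * pi / l 0 j0.
have a0 m : 0 < a m by rewrite !mulr_gt0 ?invr_gt0 ?pi_gt0 // ltr_wpDl // mulr_ge0.
have am m m' : (m <= m')%N -> a m <= a m'.
  move=> mm; rewrite /a ler_pM2r ?invr_gt0 // ler_pM2r ?pi_gt0 // lerD2r ler_pM2l //.
  by rewrite ler_nat.
have aS m : a m < a m.+1.
  rewrite /a ltr_pM2r ?invr_gt0 // ltr_pM2r ?pi_gt0 // ltrD2r ltr_pM2l //.
  by rewrite ltr_nat.
have ca m : cos (hphase l (a m) j0) = 0.
  have -> : hphase l (a m) j0 = pi / 2 + pi *+ m.
    by rewrite /hphase /a -mulr_natl; field; rewrite gt_eqF.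
  by rewrite (alternatingn (@cosDpi R)) cos_pihalf mulr0.
have pick m : exists k, a m < k < a m.+1 /\ gzero false l k.
  by have [k hk gk] := gzero_between nd (a0 m) (aS m) (ca m) (ca m.+1); exists k.
have [f hf] := choice pick.
exists [seq f m | m <- iota 0 n]; split.
- by rewrite size_map size_iota.
- rewrite map_inj_in_uniq ?iota_uniq //.
  have key m m' : (m < m')%N -> f m < f m'.
    move=> mm; have [/andP[_ h1] _] := hf m; have [/andP[h2 _] _] := hf m'.
    by apply: lt_trans h1 (le_lt_trans (am _ _ mm) h2).
  by move=> m m' _ _ E; case: (ltngtP m m') => // /key; rewrite E ltxx.
- move=> k /mapP[m]; rewrite mem_iota add0n /= => mn ->; have [/andP[h1 h2] gm] := hf m.
  split=> //; rewrite (lt_trans (a0 m) h1) /=; apply: le_trans (ltW h2) (am _ _ mn).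
Qed.

End Existence.

(** * From densities to proportions *)

Section Ergodic.
Variables (R : realType) (N : nat) (l : 'rV[R]_N).
Hypotheses (N0 : (0 < N)%N) (lp : pos_lengths l) (ql : Q_independent l).

Let nd (k : R) : 0 < k -> no_double l k.
Proof. by move=> k0; apply: no_double_rat_indep => //; exact: Q_independent_rat_indep. Qed.

(** [density_near] with no constrained phase counts all zeros. *)
Lemma gzero_density (anti : bool) : exists K, density_le (gzero anti l) K.
Proof.
have s0 : 0 < \sum_j l 0 j.
  by rewrite (bigD1 (Ordinal N0)) //= ltr_pwDl ?lp // sumr_ge0 // => j _; exact/ltW/lp.
have [h /andP[h0 hl] ff] := freq_free_step ql (divr_gt0 (pi_gt0 R) s0).
rewrite ltr_pdivlMr // in hl.
have hl' j : h * l 0 j <= 2 * pi.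
  apply: (@le_trans _ _ (h * \sum_j l 0 j)); last by have := pi_gt0 R; lra.
  by rewrite ler_pM2l // (bigD1 j) //= lerDl sumr_ge0 // => i _; exact/ltW/lp.
have d0 : 0 < 1 / 2 :> R by [].
have dn := @density_near R N anti l N0 lp h (1 / 2) (fun=> 0) pred0 h0 ff hl' d0 (lexx _).
exists (N.+1%:R * 2 ^+ N * (2 * (1 / 2)) ^+ #|(pred0 : pred 'I_N)| / h).
by apply: density_le_sub dn => k k0 gk; split.
Qed.

Definition spectrum (T : R) := [set k : R | 0 < k <= T /\ mult l k != 0%N].

Lemma spectrum_gzero T k : spectrum T k -> exists anti, gzero anti l k.
Proof.
move=> [/andP[k0 _] /mult_eq0[x x0 vx]].
have [anti [c0 s0]] := eigen_structure k0 (nd k0) x0 vx.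
by exists anti; split.
Qed.

(** An infinite set would contain finite subsets larger than the linear bound allows. *)
Lemma spectrum_finite T : finite_set (spectrum T).
Proof.
apply: contrapT => inf.
have [K1 d1] := gzero_density false; have [K2 d2] := gzero_density true.
have [B hB] := density_le_or d1 d2.
pose T' := Num.max 0 T.
have [A AS sA] := infinite_set_fset (Num.truncn `|(K1 + K2) * T' + B|).+1 inf.
have T'0 : 0 <= T' by rewrite le_max lexx.
have := hB T' (finmap.enum_fset A) T'0 (finmap.fset_uniq A).
move=> H; have {}H : (size (finmap.enum_fset A))%:R <= (K1 + K2) * T' + B.
  apply: H => k kA; have sk := AS k kA; have [/andP[k0 kT] _] := sk.
  split; first by rewrite k0 le_max kT orbT.
  by have [[]] := spectrum_gzero sk; [right|left].
have := lt_le_trans (truncnS_gt `|(K1 + K2) * T' + B|) (le_trans _ (le_trans H (ler_norm _))).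
by rewrite ler_nat => /(_ sA); rewrite ltxx.
Qed.

Definition count_real (Q : set R) T : R :=
  \sum_(k <- finmap.enum_fset (fset_set (spectrum T `&` Q))) (mult l k)%:R.

Let fin Q T : finite_set (spectrum T `&` Q).
Proof. exact: finite_setIl (spectrum_finite T). Qed.

Lemma spec_countE (Q : set R) T : spec_count l Q T = (count_real Q T)%:E.
Proof.
rewrite /spec_count; transitivity (\esum_(k in spectrum T `&` Q) ((mult l k)%:R%:E : \bar R)).
  rewrite esum_mkcond [RHS]esum_mkcond; apply: eq_esum => k _.
  have [m0|m0] := eqVneq (mult l k) 0%N; first by rewrite m0 !if_same.
  congr (if _ then _ else _); apply/idP/idP => /set_mem h; apply/mem_set.
    by have [kT Qk] := h.
  by have [[kT _] Qk] := h.
rewrite esum_fset; [|exact: fin|by move=> k _; rewrite lee_fin].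
by rewrite fsbig_finite ?sumEFin //; exact: fin.
Qed.

Lemma count_realID (Q : set R) T :
  count_real setT T = count_real Q T + count_real (~` Q) T.
Proof.
apply: EFin_inj; rewrite EFinD -!spec_countE /spec_count.
rewrite (esumID Q); last by move=> k _; rewrite lee_fin.
congr (_ + _)%E; congr esum; apply/seteqP; split=> k /=; tauto.
Qed.

Lemma count_real_ge0 Q T : 0 <= count_real Q T.
Proof. by apply: sumr_ge0. Qed.

Lemma count_real_le (Q : set R) (eps : R) :
  density_le (fun k => mult l k != 0%N /\ Q k) eps ->
  exists B, forall T, 0 <= T -> count_real Q T <= (N + N)%:R * (eps * T + B).
Proof.
move=> [B hB]; exists B => T T0.
set s := finmap.enum_fset (fset_set (spectrum T `&` Q)).
have sz : (size s)%:R <= eps * T + B.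
  apply: hB => //; first exact: finmap.fset_uniq.
  by move=> k ks; have [[kT mk] Qk] : (spectrum T `&` Q) k; [apply/set_mem; rewrite -in_fset_set|].
apply: le_trans (_ : \sum_(k <- s) (N + N)%:R <= _).
  by apply: ler_sum => k _; rewrite ler_nat mult_le.
by rewrite big_const_seq count_predT iter_addr_0 -[leLHS]mulr_natr ler_wpM2l.
Qed.

Lemma count_real_ge (j0 : 'I_N) T n : (2 * n%:R + 1) * pi / l 0 j0 <= T ->
  n%:R <= count_real setT T.
Proof.
move=> nT; have [s [sn us hs]] := many_gzeros lp j0 n nd.
rewrite /count_real; set s' := finmap.enum_fset _.
have ss' : {subset s <= s'}.
  move=> k /hs[/andP[k0 kn] gk]; rewrite /s' in_fset_set //; apply/mem_set; split=> //; split.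
    by rewrite k0 (le_trans kn).
  by rewrite -lt0n; exact: gzero_mult gk.
apply: (@le_trans _ _ (size s')%:R); first by rewrite ler_nat -sn; exact: uniq_leq_size.
rewrite -sum1_size natr_sum big_seq [leRHS]big_seq; apply: ler_sum => k.
rewrite /s' in_fset_set // => /set_mem[[_ m0] _].
by rewrite ler_nat lt0n.
Qed.

(** Multiplicities are at most 2N and the total count grows at least linearly, so exceptional
    frequencies of arbitrarily small density are negligible. *)
Lemma ergodic_of_density (Q : set R) :
  (forall eps, 0 < eps -> density_le (fun k => mult l k != 0%N /\ ~ Q k) eps) ->
  (fun T => fine (spec_count l Q T) / fine (spec_count l setT T)) @ +oo --> (1 : R).
Proof.
move=> dQ; apply/cvgrPdist_lt => e e0.
pose j0 : 'I_N := Ordinal N0; have lj := lp j0.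
(* The number per unit length of zeros of cos(k l_{j0} / 2), any two consecutive ones enclosing an
   eigenvalue. *)
pose a := l 0 j0 / (2 * pi).
have a0 : 0 < a by rewrite divr_gt0 // mulr_gt0 // pi_gt0.
have NN : 0 < (N + N)%:R :> R by rewrite ltr0n addn_gt0 N0.
have [B hB] := count_real_le (dQ _ (divr_gt0 (mulr_gt0 e0 a0) (mulr_gt0 (ltr0Sn R 3) NN))).
(* Beyond 3 / a the total count is at least a T / 2. The linear part of the exceptional count is e a
   T / 4 by the choice of density, and the second summand keeps its constant part below e a T /
   8. *)
pose T0 := 3 / a + 8 * ((N + N)%:R * `|B|) / (e * a).
exists T0; split; first exact: num_real.
move=> T T0T.
have T1 : 3 < a * T.
  rewrite mulrC -ltr_pdivrMr //; apply: le_lt_trans T0T; rewrite lerDl.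
  by apply: divr_ge0; [rewrite !mulr_ge0|exact/ltW/mulr_gt0].
have T2 : 8 * ((N + N)%:R * `|B|) < e * a * T.
  have ea : 0 < e * a by exact: mulr_gt0.
  rewrite [ltRHS]mulrC -(ltr_pdivrMr _ _ ea); apply: le_lt_trans T0T; rewrite lerDr.
  by rewrite divr_ge0 // ltW.
have T00 : 0 <= T by rewrite -(pmulr_rge0 _ a0) ltW // (lt_trans _ T1).
rewrite !spec_countE /=.
have := count_realID Q T; have := hB T T00; have := count_real_ge0 (~` Q) T.
set tot := count_real setT T; set good := count_real Q T; set bad := count_real _ T.
move=> b0 b1 tgb.
have t1 : a * T / 2 <= tot.
  pose n := Num.truncn (a * T - 1 / 2).
  have /andP[n1 n2] := @truncn_itv R (a * T - 1 / 2) ltac:(lra).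
  have : n%:R <= tot.
    apply: (count_real_ge (j0 := j0)); rewrite ler_pdivrMr //.
    have p0 := lt0r_neq0 (pi_gt0 R).
    have fld (x y p : R) : p != 0 -> x * y = 2 * (y / (2 * p) * x) * p by move=> p_neq0; field.
    rewrite (fld T (l 0 j0) _ p0) -/a.
    by rewrite ler_pM2r ?pi_gt0 //; rewrite -/n in n1; lra.
  rewrite -/n -(natr1 n) in n2; lra.
have tp : 0 < tot by apply: lt_le_trans t1; lra.
have -> : 1 - good / tot = bad / tot by rewrite tgb; field; rewrite -tgb gt_eqF.
rewrite ger0_norm ?divr_ge0 ?(ltW tp) // ltr_pdivrMr //.
apply: (@lt_le_trans _ _ (e * (a * T / 2))); last by rewrite ler_pM2l.
apply: le_lt_trans b1 _.
have -> : (N + N)%:R * (e * a / (4 * (N + N)%:R) * T + B) = e * a * T / 4 + (N + N)%:R * B.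
  have fld (m x : R) : m != 0 -> m * (x / (4 * m) * T + B) = x * T / 4 + m * B by move=> m0; field.
  by rewrite fld // gt_eqF.
have : (N + N)%:R * B <= (N + N)%:R * `|B| by rewrite ler_pM2l // ler_norm.
have : 0 < e * (a * T) by rewrite mulr_gt0 //; lra.
lra.
Qed.

End Ergodic.

Lemma ergodically_generic_propP (R : realType) (N : nat) (anti : bool)
  (q : mpoly.mpoly (N + (N + N + N + N)) R[i]) : homog_in_trace q -> (3 <= N)%N ->
  (exists t, Qfun anti q (tvec t) != 0) -> ergodically_generic (propP anti q).
Proof.
move=> hq N3 tq l lp ql; have N0 : (0 < N)%N by exact: leq_trans N3.
apply: (ergodic_of_density N0 lp ql) => eps eps0.
apply: density_le_sub (bad_sparse N0 lp ql N3 tq eps0) => k k0 [/mult_eq0[x x0 vx] nQ].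
have nd : no_double l k.
  by apply: no_double_rat_indep => //; exact: Q_independent_rat_indep.
apply: (bad_structure k0 lp nd hq (x := x)); first by split.
by move=> px; apply: nQ; exists x; split; [split|].
Qed.

(* anti = false : the "symmetric" version; anti = true : the "anti-symmetric" version *)
Theorem mainTheorem4 (R : realType) (N : nat) (anti : bool)
  (q : mpoly.mpoly (N + (N + N + N + N)) R[i]) :
  (3 <= N)%N ->
  homog_in_trace q ->
  (exists (l : 'rV[R]_N) (k : R) (x : 'rV[R[i]]_(N + N)),
      pos_lengths l /\ eigenpair l k x /\ simple_eigenvalue l k /\
      has_parity anti l k x /\
      exists v, is_trace l k x v /\ qeval q l k v != 0) ->
  strongly_generic (propP anti q) /\ ergodically_generic (propP anti q).
Proof.
move=> N3 hq [l [k [x [lp [ex [sx [px [v [tv qv]]]]]]]]].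
have [t t0 Qt] := witness_Qfun lp ex sx hq px tv qv.
have tq : exists t, Qfun anti q (tvec t) != 0.
  by exists (fun i => if insub i is Some j then t j else 0); rewrite tvecP.
by split; [exact: strongly_generic_propP|exact: ergodically_generic_propP].
Qed.
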